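(* Let $K\subset\mathbb{R}^n$ be a proper cone and let $\mathcal{S}=\bigcup_t\mathcal{S}_t\subset\pi(K)$ be a $K$-irreducible semigroup generated in one of the three ways described in the context (in case (C) assume each $\mathcal{S}_t$ is bounded). Then there exists a norm $v$ on $\mathbb{R}^n$ which is monotone with respect to $K$ and extremal for $\mathcal{S}$. If $K$ is simplicial, then $v$ may be chosen to be absolute.
   Context: A proper cone $K\subset\mathbb{R}^n$ is a nonempty set with $rK\subset K$ for all $r>0$ which is convex, pointed, closed and has nonempty interior. Write $x\ge_K y$ if $x-y\in K$. A face of $K$ is a cone $F\subseteq K$ with: $x\in F$, $x\ge_K y\ge_K0$ imply $y\in F$; $\{0\},K$ are trivial. $\pi(K)=\{A: AK\subset K\}$; $A\in\pi(K)$ is $K$-irreducible if no nontrivial face $F$ has $AF\subset F$. Semigroups: (A) discrete: compact $\mathcal{M}$, $\mathcal{S}_0=\{I\}$, $\mathcal{S}_t=\{A_{t-1}\cdots A_0:A_s\in\mathcal{M}\}$. (B) continuous: compact $\mathcal{M}$, $\mathcal{S}_t=\{\Phi_\sigma(t)\}$ over measurable $\sigma:[0,t]\to\mathcal{M}$, $\dot\Phi_\sigma=\sigma\Phi_\sigma$, $\Phi_\sigma(0)=I$. (C) with jumps: compact set $\mathcal{M}$ of pairs $(A,\Pi)$ with $\Pi^2=\Pi$, $A\Pi=\Pi A$; for piecewise constant right-continuous $\sigma$ with switching times $0=t_0<t_1<\dots\to\infty$ and $t\in[t_k,t_{k+1})$, $\Phi_\sigma(t)=e^{A_{\sigma(t_k)}(t-t_k)}\Pi_{\sigma(t_k)}\cdots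 e^{A_{\sigma(t_0)}(t_1-t_0)}\Pi_{\sigma(t_0)}$, $\mathcal{S}_t$ the set of these. $\mathcal{S}=\bigcup_t\mathcal{S}_t$. Joint spectral radius $\rho(\mathcal{S})=\lim_{t\to\infty}\sup\{\|S\|:S\in\mathcal{S}_t\}^{1/t}$. $\mathcal{S}\subset\pi(K)$ is $K$-irreducible if for some $t>0$, $\operatorname{conv}\mathcal{S}_t$ contains a $K$-irreducible element. A norm $v$ is extremal for $\mathcal{S}$ if $v(Sx)\le\rho(\mathcal{S})^t v(x)$ for all $x\in\mathbb{R}^n$, all $t$, all $S\in\mathcal{S}_t$. A norm is monotone (w.r.t. $K$) if $x\ge_K y\ge_K0$ implies $\|x\|\ge\|y\|$. $K$ is simplicial if it is the conical hull of $n$ linearly independent vectors; then $|x|_K$ denotes the least upper bound of $x$ and $-x$ in the order $\ge_K$, and a norm is absolute if $\|x\|=\||x|_K\|$ for all $x$. *)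

(* Defs.v *)
From Stdlib Require Import Reals.
From mathcomp Require Import ssreflect ssrbool ssrfun eqtype ssrnat seq fintype.
Open Scope R_scope.

Section Defs.
Variable n : nat.

Definition vec := 'I_n -> R.
Definition mat := 'I_n -> 'I_n -> R.

Definition sumI (f : 'I_n -> R) : R := foldr Rplus 0 (map f (enum 'I_n)).
Fixpoint sumN (m : nat) (f : nat -> R) : R :=
  match m with O => 0 | S k => sumN k f + f k end.

Definition vzero : vec := fun _ => 0.
Definition vadd (x y : vec) : vec := fun i => x i + y i.
Definition vsub (x y : vec) : vec := fun i => x i - y i.
Definition vscal (c : R) (x : vec) : vec := fun i => c * x i.
Definition vopp (x : vec) : vec := fun i => - x i.
Definition enorm (x : vec) : R := sqrt (sumI (fun i => x i ^ 2)).

Definition mid : mat := fun i j => if i == j then 1 else 0.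
Definition mzero : mat := fun _ _ => 0.
Definition madd (A B : mat) : mat := fun i j => A i j + B i j.
Definition msub (A B : mat) : mat := fun i j => A i j - B i j.
Definition mscal (c : R) (A : mat) : mat := fun i j => c * A i j.
Definition mmul (A B : mat) : mat := fun i j => sumI (fun k => A i k * B k j).
Definition mv (A : mat) (x : vec) : vec := fun i => sumI (fun j => A i j * x j).
Fixpoint mpow (A : mat) (m : nat) : mat :=
  match m with O => mid | S k => mmul A (mpow A k) end.
Definition frob (A : mat) : R := sqrt (sumI (fun i => sumI (fun j => A i j ^ 2))).

Definition rpow (x t : R) : R :=
  if Req_EM_T t 0 then 1 else if Rle_dec x 0 then 0 else Rpower x t.

Definition is_cone (K : vec -> Prop) : Prop :=
  (exists x, K x) /\ (forall r x, 0 < r -> K x -> K (vscal r x)).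
Definition convex_set (K : vec -> Prop) : Prop :=
  forall x y l, 0 <= l <= 1 -> K x -> K y -> K (vadd (vscal l x) (vscal (1 - l) y)).
Definition pointed (K : vec -> Prop) : Prop :=
  forall x, K x -> K (vopp x) -> x = vzero.
Definition closed_set (K : vec -> Prop) : Prop :=
  forall x, (forall eps, 0 < eps -> exists y, K y /\ enorm (vsub x y) < eps) -> K x.
Definition nonempty_interior (K : vec -> Prop) : Prop :=
  exists x eps, 0 < eps /\ forall y, enorm (vsub y x) < eps -> K y.
Definition proper_cone (K : vec -> Prop) : Prop :=
  is_cone K /\ convex_set K /\ pointed K /\ closed_set K /\ nonempty_interior K.

Definition geK (K : vec -> Prop) (x y : vec) : Prop := K (vsub x y).

Definition face (K F : vec -> Prop) : Prop :=
  is_cone F /\ convex_set F /\ (forall x, F x -> K x) /\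
  (forall x y, F x -> geK K x y -> geK K y vzero -> F y).
Definition nontrivial_face (K F : vec -> Prop) : Prop :=
  face K F /\ (exists x, F x /\ x <> vzero) /\ (exists x, K x /\ ~ F x).

Definition in_piK (K : vec -> Prop) (A : mat) : Prop := forall x, K x -> K (mv A x).
Definition K_irreducible_mat (K : vec -> Prop) (A : mat) : Prop :=
  in_piK K A /\
  ~ (exists F, nontrivial_face K F /\ forall x, F x -> F (mv A x)).

Definition compact_mat (M : mat -> Prop) : Prop :=
  (forall A, (forall eps, 0 < eps -> exists B, M B /\ frob (msub A B) < eps) -> M A) /\
  (exists c, forall A, M A -> frob A <= c).
Definition compact_pairs (M : mat * mat -> Prop) : Prop :=
  (forall A P, (forall eps, 0 < eps -> exists B Q, M (B, Q) /\
        frob (msub A B) + frob (msub P Q) < eps) -> M (A, P)) /\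
  (exists c, forall A P, M (A, P) -> frob A + frob P <= c).

Fixpoint S_disc (M : mat -> Prop) (t : nat) : mat -> Prop :=
  match t with
  | O => fun P => P = mid
  | S k => fun P => exists A Q, M A /\ S_disc M k Q /\ P = mmul A Q
  end.

Definition small_cover (E : R -> Prop) (eps : R) : Prop :=
  exists (a b : nat -> R) (l : R),
    (forall k, a k <= b k) /\
    (forall x, E x -> exists k, a k < x < b k) /\
    infinite_sum (fun k => b k - a k) l /\ l < eps.
Definition null_set (E : R -> Prop) : Prop :=
  forall eps, 0 < eps -> small_cover E eps.
Definition open_R (G : R -> Prop) : Prop :=
  forall x, G x -> exists d, 0 < d /\ forall y, Rabs (y - x) < d -> G y.
Definition leb_measurable (E : R -> Prop) : Prop :=
  forall eps, 0 < eps -> exists G, open_R G /\ (forall x, E x -> G x) /\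
     small_cover (fun x => G x /\ ~ E x) eps.
Definition open_mat (U : mat -> Prop) : Prop :=
  forall A, U A -> exists d, 0 < d /\ forall B, frob (msub B A) < d -> U B.
Definition measurable_on (t : R) (sigma : R -> mat) : Prop :=
  forall U, open_mat U -> leb_measurable (fun s => 0 <= s <= t /\ U (sigma s)).

Definition abs_cont_on (t : R) (Phi : R -> mat) : Prop :=
  forall eps, 0 < eps -> exists d, 0 < d /\
    forall (m : nat) (a b : nat -> R),
      (forall k : nat, (k < m)%N -> 0 <= a k <= b k /\ b k <= t) ->
      (forall k : nat, (k.+1 < m)%N -> b k <= a k.+1) ->
      sumN m (fun k => b k - a k) < d ->
      sumN m (fun k => frob (msub (Phi (b k)) (Phi (a k)))) < eps.
Definition has_mderiv (Phi : R -> mat) (s : R) (D : mat) : Prop :=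
  forall eps, 0 < eps -> exists d, 0 < d /\ forall h, h <> 0 -> Rabs h < d ->
    frob (msub (mscal (/ h) (msub (Phi (s + h)) (Phi s))) D) < eps.
Definition cara_solution (t : R) (sigma : R -> mat) (Phi : R -> mat) : Prop :=
  Phi 0 = mid /\ abs_cont_on t Phi /\
  null_set (fun s => 0 < s < t /\ ~ has_mderiv Phi s (mmul (sigma s) (Phi s))).

Definition S_cont (M : mat -> Prop) (t : R) (P : mat) : Prop :=
  exists sigma Phi, measurable_on t sigma /\
    (forall s, 0 <= s <= t -> M (sigma s)) /\
    cara_solution t sigma Phi /\ P = Phi t.

Definition is_mexp (A E : mat) : Prop :=
  forall i j, Un_cv (fun N => sum_f_R0 (fun m => mpow A m i j / INR (Factorial.fact m)) N) (E i j).
Definition valid_switching (tt : nat -> R) : Prop :=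
  tt O = 0 /\ (forall k, tt k < tt (S k)) /\ (forall B, exists k, B < tt k).
Fixpoint jump_prod (tt : nat -> R) (p : nat -> mat * mat) (k : nat) : mat -> Prop :=
  match k with
  | O => fun Q => Q = mid
  | S j => fun Q => exists E Q', is_mexp (mscal (tt (S j) - tt j) (fst (p j))) E /\
        jump_prod tt p j Q' /\ Q = mmul E (mmul (snd (p j)) Q')
  end.
Definition S_jump (M : mat * mat -> Prop) (t : R) (P : mat) : Prop :=
  exists (tt : nat -> R) (p : nat -> mat * mat) (k : nat) (E Q : mat),
    valid_switching tt /\ (forall j, M (p j)) /\
    tt k <= t < tt (S k) /\
    is_mexp (mscal (t - tt k) (fst (p k))) E /\ jump_prod tt p k Q /\
    P = mmul E (mmul (snd (p k)) Q).

(* ---------- the three kinds of semigroups ----------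
   A semigroup is given by a set of admissible times [time] and the family
   [Sg t] (= S_t) for admissible t; S is the union of the S_t. *)
Definition gen_semigroup (time : R -> Prop) (Sg : R -> mat -> Prop) : Prop :=
  (exists M, compact_mat M /\ (forall t, time t <-> exists k : nat, t = INR k) /\
     (forall (k : nat) P, Sg (INR k) P <-> S_disc M k P))
  \/
  (exists M, compact_mat M /\ (forall t, time t <-> 0 <= t) /\
     (forall t P, 0 <= t -> (Sg t P <-> S_cont M t P)))
  \/
  (exists M, compact_pairs M /\
     (forall A Pi, M (A, Pi) -> mmul Pi Pi = Pi /\ mmul A Pi = mmul Pi A) /\
     (forall t, time t <-> 0 <= t) /\
     (forall t P, 0 <= t -> (Sg t P <-> S_jump M t P)) /\
     (forall t, 0 <= t -> exists c, forall P, Sg t P -> frob P <= c)).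

Definition in_conv (X : mat -> Prop) (A : mat) : Prop :=
  exists (m : nat) (l : nat -> R) (B : nat -> mat),
    (forall k : nat, (k < m)%N -> 0 <= l k /\ X (B k)) /\
    sumN m l = 1 /\
    (forall i j, A i j = sumN m (fun k => l k * B k i j)).

Definition K_irreducible_sg (K : vec -> Prop) (time : R -> Prop)
    (Sg : R -> mat -> Prop) : Prop :=
  exists t A, time t /\ 0 < t /\ in_conv (Sg t) A /\ K_irreducible_mat K A.

Definition is_jsr (time : R -> Prop) (Sg : R -> mat -> Prop) (rho : R) : Prop :=
  forall eps, 0 < eps -> exists T0, forall t, time t -> T0 <= t -> 0 < t ->
    exists s, is_lub (fun r => exists P, Sg t P /\ r = frob P) s /\
              Rabs (rpow s (/ t) - rho) < eps.

Definition is_norm (v : vec -> R) : Prop :=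
  (forall x, 0 <= v x) /\ (forall x, v x = 0 -> x = vzero) /\
  (forall c x, v (vscal c x) = Rabs c * v x) /\
  (forall x y, v (vadd x y) <= v x + v y).
Definition extremal (time : R -> Prop) (Sg : R -> mat -> Prop) (rho : R)
    (v : vec -> R) : Prop :=
  forall t P x, time t -> Sg t P -> v (mv P x) <= rpow rho t * v x.
Definition monotone (K : vec -> Prop) (v : vec -> R) : Prop :=
  forall x y, geK K x y -> geK K y vzero -> v y <= v x.

(* simplicial cone: conical hull of n linearly independent vectors
   (the columns of B) *)
Definition simplicial (K : vec -> Prop) : Prop :=
  exists B : mat, (forall c, mv B c = vzero -> c = vzero) /\
    (forall x, K x <-> exists c : vec, (forall i, 0 <= c i) /\ x = mv B c).
Definition absK (K : vec -> Prop) (x z : vec) : Prop :=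
  geK K z x /\ geK K z (vopp x) /\
  (forall w, geK K w x -> geK K w (vopp x) -> geK K w z).
Definition absolute (K : vec -> Prop) (v : vec -> R) : Prop :=
  forall x z, absK K x z -> v x = v z.

End Defs.

(* Main.v *)
Require Import Defs.
From Stdlib Require Import Reals Lra Lia Classical ClassicalEpsilon.
From Stdlib Require Import FunctionalExtensionality.
From Coquelicot Require Import Coquelicot.
From mathcomp Require Import ssreflect ssrbool ssrfun eqtype ssrnat seq fintype.
From mathcomp Require Import zify.
From mathcomp Require bigop ssralg matrix mxalgebra Rstruct.
Open Scope R_scope.

(* Let [e] be an interior point of [K] and let [f t] be the least [m] with
   [P e <= m e] for all [P] in S_t.  Splitting S_(s+t) gives [f (s+t) <= f s * f t].
   If [A] in conv S_t0 is irreducible, the face generated by an orbit [x, A x, ...]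
   is [K], so by compactness [x + A x + ... + A^(N-1) x >= c |x| e] on [K] for some
   [N] and [c > 0]; inserting this sum between two factors gives
   [c' * (f s * f t) <= f (s+t)].  Hence [f t] lies between constant multiples of
   [rho ^ t], which identifies [rho] as the joint spectral radius, and
     [v x = inf {m | exists z >= x, -x, with U z <= m * rho ^ t * e for all U in S_t}]
   is a norm with all the required properties.

   For continuous time one needs S_(s+t) = S_s S_t and local boundedness.  They follow
   from the mean value inequality for absolutely continuous functions: it shows that
   [|Phi x|] at most doubles over short times in either direction, so that [Phi] is
   bounded, Lipschitz and invertible. *)

(** * Vectors and matrices *)

(** What irreducibility buys is the upper bound [f t <= C * rho ^ t]. Submultiplicativity alone lets
    [f t / rho ^ t] grow without bound, as for a Jordan block, and then some [x] would have no
    finite [m] in the infimum. The reverse inequality measures [U e] from below: [c |U e| e] lies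
    under the orbit sum of [U e], so [c |U e| P e] is bounded by finitely many terms [P A ^ k U e].
    Order bounds are inherited by convex combinations, so each such term is controlled by products
    of elements of S_t0 although [A] is only in their hull.

    Extremality is built into the infimum: applying [P] in S_t first replaces the family of all [U]
    by products [U P], a part of the same family shifted by [t], at the price of one factor
    [rho ^ t]. Definiteness needs the identity at time 0. For [rho = 0] the same formula works,
    because [f] then vanishes at every positive time. *)

Lemma choice_fun (A B : Type) (Q : A -> B -> Prop) :
  (forall a, exists b, Q a b) -> exists f : A -> B, forall a, Q a (f a).
Proof.
move=> H.
exists (fun a => proj1_sig (constructive_indefinite_description _ (H a))) => a.
exact: proj2_sig (constructive_indefinite_description _ (H a)).
Qed.

Section LinearAlgebra.
Variable n : nat.
Local Notation vec := (vec n).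
Local Notation mat := (mat n).
Arguments sumI {n}. Arguments vadd {n}. Arguments vsub {n}. Arguments vscal {n}.
Arguments vopp {n}. Arguments vzero {n}. Arguments enorm {n}. Arguments mid {n}.
Arguments madd {n}. Arguments msub {n}. Arguments mscal {n}. Arguments mmul {n}.
Arguments mv {n}. Arguments mpow {n}. Arguments frob {n}.

Implicit Types (A B C : mat) (x y : vec).

Lemma sumI_ind2 (Q : R -> R -> Prop) (f g : 'I_n -> R) :
  Q 0 0 -> (forall i a b, Q a b -> Q (f i + a) (g i + b)) -> Q (sumI f) (sumI g).
Proof. by move=> Q0 QS; rewrite /sumI; elim: (enum _) => //= i s IH; apply: QS. Qed.

Lemma sumI_ind1 (Q : R -> Prop) (f : 'I_n -> R) :
  Q 0 -> (forall i a, Q a -> Q (f i + a)) -> Q (sumI f).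
Proof. by move=> Q0 QS; apply: (sumI_ind2 (fun a _ => Q a) f f) => // i a _; apply: QS. Qed.

Lemma sumI_ext (f g : 'I_n -> R) : (forall i, f i = g i) -> sumI f = sumI g.
Proof. by move=> H; apply: sumI_ind2 => // i a b ->; rewrite H. Qed.

Lemma sumI_le (f g : 'I_n -> R) : (forall i, f i <= g i) -> sumI f <= sumI g.
Proof. move=> H; apply: (sumI_ind2 Rle) => [|i a b]; first lra. by have := H i; lra. Qed.

Lemma sumI_scal c (f : 'I_n -> R) : sumI (fun i => c * f i) = c * sumI f.
Proof. apply: (sumI_ind2 (fun a b => a = c * b)) => [|i a b ->]; lra. Qed.

Lemma sumI_scalr c (f : 'I_n -> R) : sumI (fun i => f i * c) = sumI f * c.
Proof. apply: (sumI_ind2 (fun a b => a = b * c)) => [|i a b ->]; lra. Qed.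

Lemma sumI_add (f g : 'I_n -> R) : sumI (fun i => f i + g i) = sumI f + sumI g.
Proof. rewrite /sumI; elim: (enum _) => /= [|i s ->]; lra. Qed.

Lemma sumI_sub (f g : 'I_n -> R) : sumI (fun i => f i - g i) = sumI f - sumI g.
Proof. rewrite /sumI; elim: (enum _) => /= [|i s ->]; lra. Qed.

Lemma sumI_ge0 (f : 'I_n -> R) : (forall i, 0 <= f i) -> 0 <= sumI f.
Proof. move=> H; apply: (sumI_ind1 (fun a => 0 <= a)) => [|i a]; first lra. by have := H i; lra. Qed.

Lemma sumI_0 : sumI (fun _ : 'I_n => 0) = 0.
Proof. apply: (sumI_ind1 (fun a => a = 0)) => // i a ->; lra. Qed.

Lemma sumI_abs (f : 'I_n -> R) : Rabs (sumI f) <= sumI (fun i => Rabs (f i)).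
Proof.
apply: (sumI_ind2 (fun a b => Rabs a <= b)) => [|i a b H]; first by rewrite Rabs_R0; lra.
by have := Rabs_triang (f i) a; lra.
Qed.

Lemma sumI_exch (f : 'I_n -> 'I_n -> R) :
  sumI (fun i => sumI (fun j => f i j)) = sumI (fun j => sumI (fun i => f i j)).
Proof.
rewrite {1 4}/sumI; elim: (enum _) => /= [|i s ->]; first by rewrite sumI_0.
by rewrite -sumI_add.
Qed.

Lemma sumI_term (f : 'I_n -> R) i : (forall i, 0 <= f i) -> f i <= sumI f.
Proof.
move=> H; rewrite /sumI; have : i \in enum 'I_n by rewrite mem_enum.
have ge0 s : 0 <= foldr Rplus 0 (map f s).
  by elim: s => /= [|j s IH]; [lra | have := H j; lra].
elim: (enum _) => //= j s IH; rewrite in_cons => /orP [/eqP -> | /IH].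
  by have := ge0 s; lra.
by have := H j; lra.
Qed.

Lemma sumI_delta (f : 'I_n -> R) i : sumI (fun j => (if i == j then 1 else 0) * f j) = f i.
Proof.
rewrite /sumI; have : i \in enum 'I_n by rewrite mem_enum.
have zero s : i \notin s ->
    foldr Rplus 0 (map (fun j => (if i == j then 1 else 0) * f j) s) = 0.
  elim: s => //= j s IH; rewrite in_cons negb_or => /andP [/negbTE -> /IH ->]; lra.
have := enum_uniq 'I_n; elim: (enum _) => //= j s IH /andP [nj us].
rewrite in_cons => /orP [/eqP ij | si].
  by rewrite -ij in nj *; rewrite eqxx zero //; lra.
rewrite IH //; case: eqP => [ij | _]; last lra.
by rewrite -ij si in nj.
Qed.

Lemma sumI_const c : sumI (fun _ : 'I_n => c) = INR n * c.
Proof.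
transitivity (INR (size (enum 'I_n)) * c); last by rewrite size_enum_ord.
rewrite /sumI; elim: (enum _) => [|i s IH]; first by rewrite /= Rmult_0_l.
change (c + foldr Rplus 0 (map (fun=> c) s) = INR (S (size s)) * c).
by rewrite S_INR IH; ring.
Qed.

Lemma sumI_cv (u : nat -> 'I_n -> R) (l : 'I_n -> R) :
  (forall i, is_lim_seq (fun k => u k i) (l i)) ->
  is_lim_seq (fun k => sumI (u k)) (sumI l).
Proof.
move=> H; rewrite /sumI; elim: (enum _) => /= [|i s IH]; first exact: is_lim_seq_const.
exact: is_lim_seq_plus' (H i) IH.
Qed.

(** The l1 norms: submultiplicativity and compatibility with [mv] need only the triangle inequality.
    [enorm <= vn] and [frob <= mn <= n^2 * frob] connect them with the norms of the definitions. *)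
Definition vn (x : vec) : R := sumI (fun i => Rabs (x i)).
Definition mn (A : mat) : R := sumI (fun i => sumI (fun j => Rabs (A i j))).

Lemma sumI_sqr (f : 'I_n -> R) : (forall i, 0 <= f i) -> sumI (fun i => f i ^ 2) <= sumI f ^ 2.
Proof.
move=> H; suff : 0 <= sumI f /\ sumI (fun i => f i ^ 2) <= sumI f ^ 2 by case.
apply: (sumI_ind2 (fun a b => 0 <= b /\ a <= b ^ 2)) => [|i a b [b0 ab]]; first by lra.
have := H i; nra.
Qed.

Lemma enorm_le_vn x : enorm x <= vn x.
Proof.
have v0 : 0 <= vn x by apply: sumI_ge0 => i; apply: Rabs_pos.
rewrite /enorm -(sqrt_pow2 (vn x)) //; apply: sqrt_le_1_alt.
rewrite (sumI_ext _ (fun i => Rabs (x i) ^ 2)); last by move=> i; rewrite -Rsqr_pow2 Rsqr_abs Rsqr_pow2.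
by apply: sumI_sqr => i; apply: Rabs_pos.
Qed.

Lemma frob_le_mn A : frob A <= mn A.
Proof.
have r0 i : 0 <= sumI (fun j => Rabs (A i j)) by apply: sumI_ge0 => j; apply: Rabs_pos.
rewrite /frob -(sqrt_pow2 (mn A)); last exact: sumI_ge0.
apply: sqrt_le_1_alt; apply: Rle_trans; last exact: sumI_sqr.
apply: sumI_le => i.
rewrite (sumI_ext _ (fun j => Rabs (A i j) ^ 2)); last by move=> j; rewrite -Rsqr_pow2 Rsqr_abs Rsqr_pow2.
by apply: sumI_sqr => j; apply: Rabs_pos.
Qed.

Lemma entry_le_frob A i j : Rabs (A i j) <= frob A.
Proof.
have sq k l : 0 <= A k l ^ 2 by apply: pow2_ge_0.
rewrite /frob -sqrt_Rsqr_abs; apply: sqrt_le_1_alt; rewrite Rsqr_pow2.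
apply: Rle_trans (sumI_term (fun i => sumI (fun j => A i j ^ 2)) i _).
  exact: (sumI_term (fun j => A i j ^ 2)).
by move=> k; apply: sumI_ge0.
Qed.

Lemma mn_le_entries A c : (forall i j, Rabs (A i j) <= c) -> mn A <= INR n * (INR n * c).
Proof.
move=> H; rewrite -!sumI_const; apply: sumI_le => i; apply: sumI_le => j; exact: H.
Qed.

Lemma mn_le_frob A : mn A <= INR n * (INR n * frob A).
Proof. by apply: mn_le_entries => i j; apply: entry_le_frob. Qed.

Lemma vn_ge0 x : 0 <= vn x.
Proof. by apply: sumI_ge0 => i; apply: Rabs_pos. Qed.

Lemma mn_ge0 A : 0 <= mn A.
Proof. by apply: sumI_ge0 => i; apply: sumI_ge0 => j; apply: Rabs_pos. Qed.

Lemma frob_ge0 A : 0 <= frob A.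
Proof. exact: sqrt_pos. Qed.

Lemma coord_le_vn x i : Rabs (x i) <= vn x.
Proof. by apply: (sumI_term (fun i => Rabs (x i))) => j; apply: Rabs_pos. Qed.

Lemma vn_eq0 x : vn x = 0 -> x = vzero.
Proof.
move=> H; apply: functional_extensionality => i; have := coord_le_vn x i.
rewrite H /vzero; have := Rabs_pos (x i); split_Rabs; lra.
Qed.

Lemma vn_scal c x : vn (vscal c x) = Rabs c * vn x.
Proof. by rewrite /vn -sumI_scal; apply: sumI_ext => i; rewrite /vscal Rabs_mult. Qed.

Lemma vn_add x y : vn (vadd x y) <= vn x + vn y.
Proof. by rewrite /vn -sumI_add; apply: sumI_le => i; apply: Rabs_triang. Qed.

Lemma vn_sub_sym x y : vn (vsub x y) = vn (vsub y x).
Proof. by apply: sumI_ext => i; rewrite /vsub Rabs_minus_sym. Qed.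

Lemma mn_add A B : mn (madd A B) <= mn A + mn B.
Proof.
rewrite /mn -sumI_add; apply: sumI_le => i; rewrite -sumI_add.
by apply: sumI_le => j; apply: Rabs_triang.
Qed.

Lemma mn_sub_sym A B : mn (msub A B) = mn (msub B A).
Proof. by apply: sumI_ext => i; apply: sumI_ext => j; rewrite /msub Rabs_minus_sym. Qed.

Lemma vn_mv A x : vn (mv A x) <= mn A * vn x.
Proof.
rewrite /vn /mn -sumI_scalr; apply: sumI_le => i; rewrite -sumI_scalr.
apply: Rle_trans (sumI_abs _) _; apply: sumI_le => j; rewrite Rabs_mult.
by apply: Rmult_le_compat_l; [apply: Rabs_pos | apply: coord_le_vn].
Qed.

Lemma mn_mmul A B : mn (mmul A B) <= mn A * mn B.
Proof.
rewrite /mn -sumI_scalr; apply: sumI_le => i; rewrite -sumI_scalr.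
apply: (Rle_trans _ (sumI (fun j => sumI (fun k => Rabs (A i k) * Rabs (B k j))))).
  apply: sumI_le => j; apply: Rle_trans (sumI_abs _) _.
  by apply: sumI_le => k; rewrite Rabs_mult; apply: Rle_refl.
rewrite sumI_exch; apply: sumI_le => k; rewrite sumI_scal.
apply: Rmult_le_compat_l; first exact: Rabs_pos.
apply: (sumI_term (fun i => sumI (fun j => Rabs (B i j)))) => l.
by apply: sumI_ge0 => m; apply: Rabs_pos.
Qed.

Lemma mat_ext (A B : mat) : (forall i j, A i j = B i j) -> A = B.
Proof. by move=> H; do 2 (apply: functional_extensionality => ?). Qed.

Lemma mv_mmul A B x : mv (mmul A B) x = mv A (mv B x).
Proof.
apply: functional_extensionality => i; rewrite /mv /mmul.
rewrite (sumI_ext _ (fun j => sumI (fun k => A i k * B k j * x j))); last first.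
  by move=> j; rewrite sumI_scalr.
rewrite sumI_exch; apply: sumI_ext => k; rewrite -sumI_scal.
by apply: sumI_ext => j; ring.
Qed.

Lemma mmulA A B C : mmul A (mmul B C) = mmul (mmul A B) C.
Proof.
apply: mat_ext => i j; rewrite /mmul.
rewrite [RHS](sumI_ext _ (fun k => sumI (fun l => A i l * B l k * C k j))); last first.
  by move=> k; rewrite sumI_scalr.
rewrite [RHS]sumI_exch; apply: sumI_ext => l; rewrite -sumI_scal.
by apply: sumI_ext => k; ring.
Qed.

Lemma mv_mid x : mv mid x = x.
Proof. by apply: functional_extensionality => i; rewrite /mv /mid sumI_delta. Qed.

Lemma mmul1m A : mmul mid A = A.
Proof. by apply: mat_ext => i j; rewrite /mmul /mid (sumI_delta (fun k => A k j)). Qed.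

Lemma mmulm1 A : mmul A mid = A.
Proof.
apply: mat_ext => i j; rewrite /mmul /mid -[RHS](sumI_delta (fun k => A i k)).
by apply: sumI_ext => k; rewrite Rmult_comm eq_sym.
Qed.

Lemma mv_add A x y : mv A (vadd x y) = vadd (mv A x) (mv A y).
Proof.
apply: functional_extensionality => i; rewrite /mv /vadd -sumI_add.
by apply: sumI_ext => j; ring.
Qed.

Lemma mv_sub A x y : mv A (vsub x y) = vsub (mv A x) (mv A y).
Proof.
apply: functional_extensionality => i; rewrite /mv /vsub -sumI_sub.
by apply: sumI_ext => j; ring.
Qed.

Lemma mv_scal A c x : mv A (vscal c x) = vscal c (mv A x).
Proof.
apply: functional_extensionality => i; rewrite /mv /vscal -sumI_scal.
by apply: sumI_ext => j; ring.
Qed.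

Lemma mv_opp A x : mv A (vopp x) = vopp (mv A x).
Proof.
apply: functional_extensionality => i.
rewrite /mv /vopp -[RHS]Rmult_1_l Ropp_mult_distr_r_reverse Ropp_mult_distr_l -sumI_scal.
by apply: sumI_ext => j; ring.
Qed.

Lemma mv_msub A B x : mv (msub A B) x = vsub (mv A x) (mv B x).
Proof.
apply: functional_extensionality => i; rewrite /mv /msub /vsub -sumI_sub.
by apply: sumI_ext => j; ring.
Qed.

Lemma mmul_msubl A B C : mmul (msub A B) C = msub (mmul A C) (mmul B C).
Proof.
apply: mat_ext => i j; rewrite /mmul /msub -sumI_sub.
by apply: sumI_ext => k; ring.
Qed.

Lemma mmul_msubr A B C : mmul A (msub B C) = msub (mmul A B) (mmul A C).
Proof.
apply: mat_ext => i j; rewrite /mmul /msub -sumI_sub.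
by apply: sumI_ext => k; ring.
Qed.

Lemma mn_sub_triangle A B C : mn (msub A C) <= mn (msub A B) + mn (msub B C).
Proof.
have -> : msub A C = madd (msub A B) (msub B C).
  by apply: mat_ext => i j; rewrite /madd /msub; ring.
exact: mn_add.
Qed.

Lemma mn_le_sub A B : mn A <= mn (msub A B) + mn B.
Proof.
have {1}-> : A = madd (msub A B) B by apply: mat_ext => i j; rewrite /madd /msub; ring.
exact: mn_add.
Qed.

(** An index map with [k <= phi k] already preserves limits and composes with others of its kind, so
    the recursive choice of a strictly increasing map is avoided. *)
Lemma real_BW (u : nat -> R) c : (forall k, Rabs (u k) <= c) ->
  exists (phi : nat -> nat) (l : R), (forall k, (k <= phi k)%coq_nat) /\
    is_lim_seq (fun k => u (phi k)) l.
Proof.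
move=> H.
have [l lP] : exists l, ValAdh u l.
  refine (Bolzano_Weierstrass u _ (compact_P3 (- c) c) _).
  by move=> k; have := H k; split_Rabs; lra.
have /choice_fun [phi phiP] : forall k : nat, exists p : nat,
    (k <= p)%coq_nat /\ Rabs (u p - l) < / (INR k + 1).
  move=> k; have k0 : 0 < / (INR k + 1) by apply: Rinv_0_lt_compat; have := pos_INR k; lra.
  apply: (lP (fun a => Rabs (a - l) < / (INR k + 1)) k).
  by exists (mkposreal _ k0) => a.
exists phi, l; split=> [k|]; first exact: (phiP k).1.
apply: (is_lim_seq_le_le (fun k => l - / (INR k + 1)) _ (fun k => l + / (INR k + 1))).
- by move=> k; have := (phiP k).2; split_Rabs; lra.
- rewrite -{2}(Rminus_0_r l); apply: is_lim_seq_minus'; first exact: is_lim_seq_const.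
  apply: (is_lim_seq_ext (fun k => / INR (S k))); first by move=> k; rewrite S_INR.
  apply: (is_lim_seq_incr_1 (fun k => / INR k) 0).1.
  exact: (is_lim_seq_inv INR p_infty is_lim_seq_INR).
- rewrite -{2}(Rplus_0_r l); apply: is_lim_seq_plus'; first exact: is_lim_seq_const.
  apply: (is_lim_seq_ext (fun k => / INR (S k))); first by move=> k; rewrite S_INR.
  apply: (is_lim_seq_incr_1 (fun k => / INR k) 0).1.
  exact: (is_lim_seq_inv INR p_infty is_lim_seq_INR).
Qed.

Lemma lim_seq_sub (u : nat -> R) (phi : nat -> nat) (l : Rbar) :
  (forall k, (k <= phi k)%coq_nat) -> is_lim_seq u l -> is_lim_seq (fun k => u (phi k)) l.
Proof.
move=> phiP ul; apply: filterlim_comp ul => Q [N HN]; exists N => k Nk.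
by apply: HN; have := phiP k; lia.
Qed.

Lemma vec_BW (x : nat -> vec) c : (forall k, vn (x k) <= c) ->
  exists (phi : nat -> nat) (l : vec), (forall k, (k <= phi k)%coq_nat) /\
    is_lim_seq (fun k => vn (vsub (x (phi k)) l)) 0.
Proof.
move=> H.
suff [phi [l [phiP lP]]] : exists (phi : nat -> nat) (l : vec),
    (forall k, (k <= phi k)%coq_nat) /\
    (forall i, i \in enum 'I_n -> is_lim_seq (fun k => x (phi k) i) (l i)).
  exists phi, l; split=> //.
  rewrite -sumI_0 /vn; apply: sumI_cv => i; rewrite -Rabs_R0 -(Rminus_diag (l i)).
  apply: (is_lim_seq_abs _ (Rbar.Finite _)); apply: is_lim_seq_minus'; last exact: is_lim_seq_const.
  by apply: lP; rewrite mem_enum.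
(* Coordinates are treated one at a time; those already handled keep converging along the finer
   index map. *)
elim: (enum _) => [|i s [phi [l [phiP lP]]]].
  by exists id, (fun _ => 0).
have [|psi [a [psiP aP]]] := real_BW (fun k => x (phi k) i) c.
  by move=> k; apply: Rle_trans (coord_le_vn _ _) (H _).
exists (fun k => phi (psi k)), (fun j => if j == i then a else l j); split.
  by move=> k; have := phiP (psi k); have := psiP k; lia.
move=> j; rewrite in_cons; case: eqP => [-> _ | _ /= js]; first exact: aP.
exact: (lim_seq_sub (fun k => x (phi k) j)) (lP _ js).
Qed.

End LinearAlgebra.

(** * Cones *)

Section Cone.
Variable n : nat.
Local Notation vec := (vec n).
Local Notation mat := (mat n).
Arguments sumI {n}. Arguments vadd {n}. Arguments vsub {n}. Arguments vscal {n}.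
Arguments vopp {n}. Arguments vzero {n}. Arguments enorm {n}. Arguments mid {n}.
Arguments madd {n}. Arguments msub {n}. Arguments mscal {n}. Arguments mmul {n}.
Arguments mv {n}. Arguments mpow {n}. Arguments frob {n}.
Arguments vn {n}. Arguments mn {n}.
Implicit Types (A B C : mat) (x y z : vec).

Variable K : vec -> Prop.
Hypothesis HK : proper_cone n K.

Lemma Kscal_pos r x : 0 < r -> K x -> K (vscal r x).
Proof. by case: HK => [[_ H] _]; apply: H. Qed.

Lemma Kclosed x : (forall eps, 0 < eps -> exists y, K y /\ vn (vsub x y) < eps) -> K x.
Proof.
case: HK => _ [_ [_ [H _]]] Hx; apply: H => eps /Hx [y [Ky xy]].
by exists y; split=> //; apply: Rle_lt_trans (enorm_le_vn _ _) xy.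
Qed.

(** [is_cone] only permits positive factors, so 0 is reached as a limit of shrinking multiples of a
    point of [K]. *)
Lemma K0 : K vzero.
Proof.
case: (HK) => [[[x Kx] _] _]; apply: Kclosed => eps e0.
have v0 := vn_ge0 n x.
have d0 : 0 < eps / (vn x + 1) by apply: Rdiv_lt_0_compat; lra.
exists (vscal (eps / (vn x + 1)) x); split; first exact: Kscal_pos.
have -> : vsub vzero (vscal (eps / (vn x + 1)) x) = vscal (- (eps / (vn x + 1))) x.
  by apply: functional_extensionality => i; rewrite /vsub /vscal /vzero; ring.
rewrite vn_scal Rabs_Ropp Rabs_pos_eq; last lra.
apply: (Rmult_lt_reg_r (vn x + 1)); first lra.
field_simplify; nra.
Qed.

Lemma Kscal r x : 0 <= r -> K x -> K (vscal r x).
Proof.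
case=> [r0 | <-]; first exact: Kscal_pos.
move=> _; have -> : vscal 0 x = vzero; last exact: K0.
by apply: functional_extensionality => i; rewrite /vscal /vzero; ring.
Qed.

Lemma Kadd x y : K x -> K y -> K (vadd x y).
Proof.
move=> Kx Ky; case: (HK) => _ [cK _].
have -> : vadd x y = vscal 2 (vadd (vscal (1/2) x) (vscal (1 - 1/2) y)).
  by apply: functional_extensionality => i; rewrite /vscal /vadd; field.
by apply: Kscal; [lra | apply: cK => //; lra].
Qed.

Lemma KsumN m (l : nat -> R) (w : nat -> vec) :
  (forall k : nat, (k < m)%N -> 0 <= l k /\ K (w k)) ->
  K (fun i => sumN m (fun k => l k * w k i)).
Proof.
elim: m => [|m IH] H /=; first exact: K0.
have [l0 Kw] := H m (ltnSn m).
apply: (Kadd (fun i => sumN m (fun k => l k * w k i)) (vscal (l m) (w m))).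
  by apply: IH => k km; apply: H; apply: ltnW.
exact: Kscal.
Qed.

Definition leK x y := K (vsub y x).

Lemma leK_trans x y z : leK x y -> leK y z -> leK x z.
Proof.
move=> xy yz; rewrite /leK; have -> : vsub z x = vadd (vsub z y) (vsub y x).
  by apply: functional_extensionality => i; rewrite /vsub /vadd; ring.
exact: Kadd.
Qed.

Lemma leK_add x y x' y' : leK x y -> leK x' y' -> leK (vadd x x') (vadd y y').
Proof.
move=> xy yz; rewrite /leK.
have -> : vsub (vadd y y') (vadd x x') = vadd (vsub y x) (vsub y' x').
  by apply: functional_extensionality => i; rewrite /vsub /vadd; ring.
exact: Kadd.
Qed.

Lemma leK_scal r x y : 0 <= r -> leK x y -> leK (vscal r x) (vscal r y).
Proof.
move=> r0 xy; rewrite /leK.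
have -> : vsub (vscal r y) (vscal r x) = vscal r (vsub y x).
  by apply: functional_extensionality => i; rewrite /vsub /vscal; ring.
exact: Kscal.
Qed.

Lemma leK_scalr a b x : K x -> a <= b -> leK (vscal a x) (vscal b x).
Proof.
move=> Kx ab; rewrite /leK.
have -> : vsub (vscal b x) (vscal a x) = vscal (b - a) x.
  by apply: functional_extensionality => i; rewrite /vsub /vscal; ring.
by apply: Kscal => //; lra.
Qed.

Lemma leK_mv A x y : in_piK n K A -> leK x y -> leK (mv A x) (mv A y).
Proof. by move=> KA xy; rewrite /leK -mv_sub; apply: KA. Qed.

Lemma vscalA a b x : vscal a (vscal b x) = vscal (a * b) x.
Proof. by apply: functional_extensionality => i; rewrite /vscal; ring. Qed.

Lemma leK_limit x y :
  (forall eps, 0 < eps -> exists x' y', leK x' y' /\ vn (vsub x x') < eps /\ vn (vsub y y') < eps) ->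
  leK x y.
Proof.
move=> H; apply: Kclosed => eps e0.
have [|x' [y' [xy [xx yy]]]] := H (eps / 2); first lra.
exists (vsub y' x'); split=> //.
have -> : vsub (vsub y x) (vsub y' x') = vadd (vsub y y') (vsub x' x).
  by apply: functional_extensionality => i; rewrite /vsub /vadd; ring.
rewrite vn_sub_sym in xx; apply: Rle_lt_trans (vn_add _ _ _) _; lra.
Qed.

Lemma vn_sub_self x : vn (vsub x x) = 0.
Proof.
rewrite -[RHS](sumI_0 n); apply: sumI_ext => i; rewrite /vsub Rminus_diag; exact: Rabs_R0.
Qed.

(** Closedness of [K] lets the coefficient pass to its infimum; this is why least admissible factors
    are attained. *)
Lemma leK_scal_limit x y a :
  (forall eps, 0 < eps -> exists2 b, b < a + eps & leK x (vscal b y)) -> K y -> leK x (vscal a y).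
Proof.
move=> H Ky; apply: leK_limit => eps e0; have y0 := vn_ge0 n y.
have d0 : 0 < eps / (vn y + 1) by apply: Rdiv_lt_0_compat; lra.
have [b ba xb] := H _ d0.
exists x, (vscal (a + eps / (vn y + 1)) y); split; last split.
- by apply: leK_trans xb _; apply: leK_scalr => //; lra.
- by rewrite vn_sub_self.
- have -> : vsub (vscal a y) (vscal (a + eps / (vn y + 1)) y) = vscal (- (eps / (vn y + 1))) y.
    by apply: functional_extensionality => i; rewrite /vsub /vscal; ring.
  rewrite vn_scal Rabs_Ropp Rabs_pos_eq; last lra.
  apply: (Rmult_lt_reg_r (vn y + 1)); first lra.
  field_simplify; nra.
Qed.

Lemma order_unit : exists e c, K e /\ 0 < c /\ forall x, leK x (vscal (c * vn x) e).
Proof.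
case: (HK) => _ [_ [_ [_ [e [eps [e0 He]]]]]].
(* With a ball of radius [eps] around [e], the vector [e - (eps / (2 |x|)) x] stays at distance
   [eps / 2] from [e]; scaling by [2 |x| / eps] produces the constant. *)
exists e, (2 / eps); split; last split.
- apply: He; apply: Rle_lt_trans (enorm_le_vn _ _) _; rewrite vn_sub_self //.
- by apply: Rdiv_lt_0_compat; lra.
move=> x; have [x0 | x0] := Req_dec (vn x) 0.
  rewrite x0 (vn_eq0 _ _ x0) /leK.
  have -> : vsub (vscal (2 / eps * 0) e) vzero = vzero; last exact: K0.
  by apply: functional_extensionality => i; rewrite /vsub /vscal /vzero; ring.
have xp : 0 < vn x by have := vn_ge0 n x; lra.
rewrite /leK.
have -> : vsub (vscal (2 / eps * vn x) e) x
    = vscal (2 / eps * vn x) (vsub e (vscal (eps / (2 * vn x)) x)).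
  by apply: functional_extensionality => i; rewrite /vsub /vscal; field; lra.
apply: Kscal.
  by apply: Rmult_le_pos; [apply: Rlt_le; apply: Rdiv_lt_0_compat | ]; lra.
apply: He; apply: Rle_lt_trans (enorm_le_vn _ _) _.
have -> : vsub (vsub e (vscal (eps / (2 * vn x)) x)) e = vscal (- (eps / (2 * vn x))) x.
  by apply: functional_extensionality => i; rewrite /vsub /vscal; ring.
rewrite vn_scal Rabs_Ropp Rabs_pos_eq; last by apply: Rlt_le; apply: Rdiv_lt_0_compat; lra.
have -> : eps / (2 * vn x) * vn x = eps / 2 by field.
lra.
Qed.

(** The index returned belongs to the original sequence, because the property that defines [x k] in
    the applications sharpens with [k] itself. *)
Lemma seq_inv_lim (x : nat -> vec) l (phi : nat -> nat) :
  (forall k, (k <= phi k)%coq_nat) ->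
  is_lim_seq (fun k => vn (vsub (x (phi k)) l)) 0 ->
  forall eps N, 0 < eps -> exists2 k, (N <= k)%coq_nat &
    vn (vsub (x k) l) < eps /\ / (INR k + 1) < eps.
Proof.
move=> phiP /is_lim_seq_spec lP eps N e0.
have [N1 HN1] := lP (mkposreal _ e0).
have [N2 HN2] : exists N2 : nat, / eps < INR N2 by apply: INR_unbounded.
pose k := (N + N1 + N2)%coq_nat; exists (phi k).
  by have := phiP k; rewrite /k; lia.
split.
  have := HN1 k; rewrite /= Rminus_0_r Rabs_pos_eq; last exact: vn_ge0.
  by apply; rewrite /k; lia.
have : INR N2 <= INR (phi k) by apply: le_INR; have := phiP k; rewrite /k; lia.
move=> H; rewrite -(Rinv_inv eps); apply: Rinv_lt_contravar; last lra.
apply: Rmult_lt_0_compat; first exact: Rinv_0_lt_compat.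
by have := pos_INR (phi k); lra.
Qed.

Lemma normalize_unit x : 0 < vn x -> vn (vscal (/ vn x) x) = 1.
Proof.
move=> x0; rewrite vn_scal Rabs_pos_eq; first by field; lra.
by apply: Rlt_le; apply: Rinv_0_lt_compat.
Qed.

Lemma vn_cont x y : vn x <= vn (vsub x y) + vn y.
Proof.
have {1}-> : x = vadd (vsub x y) y; last exact: vn_add.
by apply: functional_extensionality => i; rewrite /vadd /vsub; ring.
Qed.

(** * Normality of the cone and orbits of an irreducible matrix *)

Section OrderUnit.
Variables (e : vec) (ce : R).
Hypotheses (Ke : K e) (ce0 : 0 < ce) (He : forall x, leK x (vscal (ce * vn x) e)).

(** Normality of the order. Otherwise there are unit vectors [x k] between [-e / (k + 1)] and
    [e / (k + 1)]; a limit [l] satisfies [l <= 0] and [-l <= 0], hence [l = 0] by pointedness,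
    against [|l| = 1]. *)
Lemma cone_normal : exists2 D, 0 < D & forall x m, 0 <= m ->
  leK x (vscal m e) -> leK (vopp x) (vscal m e) -> vn x <= D * m.
Proof.
apply: NNPP => HN.
have /choice_fun [x xP] : forall k : nat, exists x, vn x = 1 /\
    leK x (vscal (/ (INR k + 1)) e) /\ leK (vopp x) (vscal (/ (INR k + 1)) e).
  move=> k; apply: NNPP => Hk; apply: HN; exists (INR k + 1).
    by have := pos_INR k; lra.
  move=> x m m0 xm1 xm2; apply: Rnot_lt_le => xm; apply: Hk.
  have k0 := pos_INR k.
  have x0 : 0 < vn x by nra.
  have i0 : 0 < / vn x by apply: Rinv_0_lt_compat.
  have mx : / vn x * m <= / (INR k + 1).
    apply: (Rmult_le_reg_l (vn x * (INR k + 1))); first nra.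
    field_simplify; lra.
  exists (vscal (/ vn x) x); split; first exact: normalize_unit.
  split; apply: (leK_trans _ (vscal (/ vn x) (vscal m e))).
  - by apply: leK_scal => //; lra.
  - by rewrite vscalA; apply: leK_scalr.
  - have -> : vopp (vscal (/ vn x) x) = vscal (/ vn x) (vopp x).
      by apply: functional_extensionality => i; rewrite /vopp /vscal; ring.
    by apply: leK_scal => //; lra.
  - by rewrite vscalA; apply: leK_scalr.
have [|phi [l [phiP lP]]] := vec_BW _ x 1; first by move=> k; rewrite (xP k).1; lra.
have lim := seq_inv_lim _ _ _ phiP lP.
have le0 : 0 <= vn e := vn_ge0 n e.
(* [s] is [id] or [vopp], so one limit argument gives both signs. *)
have small (s : vec -> vec) : (forall y z, vn (vsub (s y) (s z)) = vn (vsub y z)) ->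
    (forall k, leK (s (x k)) (vscal (/ (INR k + 1)) e)) -> leK (s l) vzero.
  move=> sE sP; apply: leK_limit => eps e0.
  have d0 : 0 < eps / (vn e + 1) by apply: Rdiv_lt_0_compat; lra.
  have [k _ [xl kd]] := lim (Rmin eps (eps / (vn e + 1))) 0%N (Rmin_glb_lt _ _ _ e0 d0).
  exists (s (x k)), (vscal (/ (INR k + 1)) e); split=> //; split.
    rewrite sE vn_sub_sym; apply: Rlt_le_trans xl _; exact: Rmin_l.
  have -> : vsub vzero (vscal (/ (INR k + 1)) e) = vscal (- / (INR k + 1)) e.
    by apply: functional_extensionality => i; rewrite /vsub /vscal /vzero; ring.
  have i0 : 0 < / (INR k + 1) by apply: Rinv_0_lt_compat; have := pos_INR k; lra.
  rewrite vn_scal Rabs_Ropp Rabs_pos_eq; last lra.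
  have kd' := Rlt_le_trans _ _ _ kd (Rmin_r _ _).
  have -> : eps = eps / (vn e + 1) * (vn e + 1) by field; lra.
  nra.
have l1 : leK l vzero by apply: (small id) => // k; case: (xP k) => _ [].
have l2 : leK (vopp l) vzero.
  apply: (small vopp) => [y z|k]; last by case: (xP k) => _ [].
  rewrite vn_sub_sym; apply: sumI_ext => i; rewrite /vsub /vopp; congr Rabs; ring.
have lz : l = vzero.
  case: (HK) => _ [_ [ptd _]]; apply: ptd.
    have -> : l = vsub vzero (vopp l); last exact: l2.
    by apply: functional_extensionality => i; rewrite /vsub /vzero /vopp; ring.
  have -> : vopp l = vsub vzero l; last exact: l1.
  by apply: functional_extensionality => i; rewrite /vsub /vzero /vopp; ring.
have [k _ [xl _]] := lim (1/2) 0%N ltac:(lra).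
have := vn_cont (x k) l; rewrite (xP k).1 lz.
have -> : vn (vzero : vec) = 0.
  by rewrite -[RHS](sumI_0 n); apply: sumI_ext => i; rewrite /vzero Rabs_R0.
by rewrite lz in xl; lra.
Qed.

Definition orbit_sum A N x : vec := fun i => sumN N (fun k => mv (mpow A k) x i).

Lemma orbit_sumS A N x : orbit_sum A (S N) x = vadd (orbit_sum A N x) (mv (mpow A N) x).
Proof. by []. Qed.

Lemma in_piK_mpow A k : in_piK n K A -> in_piK n K (mpow A k).
Proof.
move=> KA; elim: k => [|k IH] x Kx /=; first by rewrite mv_mid.
by rewrite mv_mmul; apply: KA; apply: IH.
Qed.

Lemma K_orbit_sum A N x : in_piK n K A -> K x -> K (orbit_sum A N x).
Proof.
move=> KA Kx; elim: N => [|N IH]; first exact: K0.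
by rewrite orbit_sumS; apply: Kadd => //; apply: in_piK_mpow.
Qed.

Lemma leK_addr x y : K y -> leK x (vadd x y).
Proof.
move=> Ky; rewrite /leK; have -> : vsub (vadd x y) x = y => //.
by apply: functional_extensionality => i; rewrite /vsub /vadd; ring.
Qed.

Lemma leK_refl x : leK x x.
Proof.
rewrite /leK; have -> : vsub x x = vzero; last exact: K0.
by apply: functional_extensionality => i; rewrite /vsub /vzero; ring.
Qed.

Lemma orbit_sum_mono A N M x : in_piK n K A -> K x -> (N <= M)%coq_nat ->
  leK (orbit_sum A N x) (orbit_sum A M x).
Proof.
move=> KA Kx; elim: M / => [|M NM IH]; first exact: leK_refl.
apply: leK_trans IH _; rewrite orbit_sumS; apply: leK_addr; exact: in_piK_mpow.
Qed.

Lemma mv_orbit_sum A N x : in_piK n K A -> K x ->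
  leK (mv A (orbit_sum A N x)) (orbit_sum A (S N) x).
Proof.
move=> KA Kx; suff -> : orbit_sum A (S N) x = vadd (mv A (orbit_sum A N x)) x by exact: leK_addr.
elim: N => [|N IH].
  apply: functional_extensionality => i; rewrite orbit_sumS /vadd /orbit_sum /= mv_mid.
  have -> : mv A (fun=> 0) i = 0; last by [].
  by rewrite /mv -[RHS](sumI_0 n); apply: sumI_ext => j; ring.
rewrite orbit_sumS {1}IH (orbit_sumS A N) mv_add /= mv_mmul.
by apply: functional_extensionality => i; rewrite /vadd; ring.
Qed.

Lemma mv_orbit_sum_comm A B N x : mv B (orbit_sum A N x) =
  (fun i => sumN N (fun k => mv B (mv (mpow A k) x) i)).
Proof.
elim: N => [|N IH].
  apply: functional_extensionality => i; rewrite /orbit_sum /=.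
  by rewrite /mv -[RHS](sumI_0 n); apply: sumI_ext => j; ring.
by rewrite orbit_sumS mv_add IH.
Qed.

Lemma orbit_sum_sub A N x y :
  vsub (orbit_sum A N x) (orbit_sum A N y) = orbit_sum A N (vsub x y).
Proof.
elim: N => [|N IH].
  by apply: functional_extensionality => i; rewrite /vsub /orbit_sum /=; ring.
rewrite !orbit_sumS -IH mv_sub.
by apply: functional_extensionality => i; rewrite /vsub /vadd; ring.
Qed.

Lemma vn_orbit_sum A N : exists2 c, 0 < c & forall x, vn (orbit_sum A N x) <= c * vn x.
Proof.
elim: N => [|N [c c0 IH]].
  exists 1; first lra.
  move=> x; have -> : vn (orbit_sum A 0 x) = 0; last by have := vn_ge0 n x; lra.
  by rewrite -[RHS](sumI_0 n); apply: sumI_ext => i; rewrite /orbit_sum /= Rabs_R0.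
exists (c + mn (mpow A N)); first by have := mn_ge0 n (mpow A N); lra.
move=> x; rewrite orbit_sumS; apply: Rle_trans (vn_add _ _ _) _.
have := IH x; have := vn_mv n (mpow A N) x; lra.
Qed.

(** A face need not be closed here, so a union of order intervals over [N] and [r] can serve. The
    orbit sums increase with [N], which gives convexity; [A] maps the sum of length [N] below the
    sum of length [N + 1], which gives invariance. *)
Lemma orbit_face A x : in_piK n K A -> K x ->
  let F y := K y /\ exists N r, 0 <= r /\ leK y (vscal r (orbit_sum A N x)) in
  face n K F /\ F x /\ forall y, F y -> F (mv A y).
Proof.
move=> KA Kx F.
have Fx : F x.
  split=> //; exists 1%N, 1; split; first lra.
  have -> : vscal 1 (orbit_sum A 1 x) = x; last exact: leK_refl.
  by apply: functional_extensionality => i; rewrite /vscal /orbit_sum /= mv_mid; ring.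
have KS N : K (orbit_sum A N x) by apply: K_orbit_sum.
split; last split=> //.
  split; [split|split; [|split]].
  - by exists x.
  - move=> r y r0 [Ky [N [s [s0 ys]]]]; split; first by apply: Kscal => //; lra.
    exists N, (r * s); split; first nra.
    by rewrite -vscalA; apply: leK_scal => //; lra.
  - move=> y z l [l0 l1] [Ky [N [r [r0 yr]]]] [Kz [M [s [s0 zs]]]]; split.
      by apply: Kadd; apply: Kscal => //; lra.
    exists (N + M)%coq_nat, (l * r + (1 - l) * s); split; first nra.
    have -> : vscal (l * r + (1 - l) * s) (orbit_sum A (N + M)%coq_nat x)
        = vadd (vscal l (vscal r (orbit_sum A (N + M)%coq_nat x)))
               (vscal (1 - l) (vscal s (orbit_sum A (N + M)%coq_nat x))).
      by apply: functional_extensionality => i; rewrite /vscal /vadd; ring.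
    apply: leK_add; (apply: leK_scal; first lra).
    + apply: leK_trans yr _; apply: leK_scal => //; apply: orbit_sum_mono => //; lia.
    + apply: leK_trans zs _; apply: leK_scal => //; apply: orbit_sum_mono => //; lia.
  - by move=> y [].
  - move=> y z [Ky [N [r [r0 yr]]]] yz z0; split.
      move: z0; rewrite /geK; have -> // : vsub z vzero = z.
      by apply: functional_extensionality => i; rewrite /vsub /vzero; ring.
    by exists N, r; split=> //; apply: leK_trans yr.
move=> y [Ky [N [r [r0 yr]]]]; split; first exact: KA.
exists (S N), r; split=> //.
apply: (leK_trans _ (mv A (vscal r (orbit_sum A N x)))); first exact: leK_mv.
by rewrite mv_scal; apply: leK_scal => //; apply: mv_orbit_sum.
Qed.

(** An invariant face with a nonzero point cannot be nontrivial, so the face generated by the orbit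
    contains [e]. *)
Lemma orbit_unit A x : K_irreducible_mat n K A -> K x -> x <> vzero ->
  exists N r, 0 < r /\ leK (vscal r e) (orbit_sum A N x).
Proof.
move=> [KA irr] Kx x0; have [FF [Fx FA]] := orbit_face A x KA Kx.
set F := (fun y => _ /\ _) in FF Fx FA.
have [_ [N [r [r0 er]]]] : F e.
  apply: NNPP => nFe; apply: irr; exists F; split=> //; split=> //; split.
    by exists x.
  by exists e.
(* [r] may be 0, hence [r + 1]. *)
exists N, (/ (r + 1)); split; first by apply: Rinv_0_lt_compat; lra.
have -> : orbit_sum A N x = vscal (/ (r + 1)) (vscal (r + 1) (orbit_sum A N x)).
  by apply: functional_extensionality => i; rewrite /vscal; field; lra.
apply: leK_scal; first by apply: Rlt_le; apply: Rinv_0_lt_compat; lra.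
apply: leK_trans er _; apply: leK_scalr; last lra.
exact: K_orbit_sum.
Qed.

(** [orbit_unit] gives constants depending on the point. If no uniform choice existed, unit vectors
    [x k] failing for [N = k] and [c = 1 / (k + 1)] would accumulate at some [l] in [K]; the
    estimate at [l] persists nearby with half the constant, and for all longer sums. *)
Lemma orbit_uniform A : K_irreducible_mat n K A ->
  exists N c, 0 < c /\ forall x, K x -> leK (vscal (c * vn x) e) (orbit_sum A N x).
Proof.
move=> irr; have KA := irr.1; apply: NNPP => HN.
have /choice_fun [x xP] : forall k : nat, exists x, K x /\ vn x = 1 /\
    ~ leK (vscal (/ (INR k + 1)) e) (orbit_sum A k x).
  move=> k; apply: NNPP => Hk; apply: HN; exists k, (/ (INR k + 1)); split.
    by apply: Rinv_0_lt_compat; have := pos_INR k; lra.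
  move=> x Kx; apply: NNPP => nx; apply: Hk.
  have [x0 | x0] := Req_dec (vn x) 0.
    case: nx; rewrite x0 Rmult_0_r /leK.
    have -> : vsub (orbit_sum A k x) (vscal 0 e) = orbit_sum A k x.
      by apply: functional_extensionality => i; rewrite /vscal /vsub; ring.
    exact: K_orbit_sum.
  have xp : 0 < vn x by have := vn_ge0 n x; lra.
  exists (vscal (/ vn x) x); split.
    by apply: Kscal => //; apply: Rlt_le; apply: Rinv_0_lt_compat.
  split; first exact: normalize_unit.
  move=> H; apply: nx; rewrite Rmult_comm -vscalA.
  have -> : orbit_sum A k x = vscal (vn x) (orbit_sum A k (vscal (/ vn x) x)).
    have {1}-> : x = vscal (vn x) (vscal (/ vn x) x).
      by apply: functional_extensionality => i; rewrite /vscal; field.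
    elim: k {H} => [|k IH].
      by apply: functional_extensionality => i; rewrite /vscal /orbit_sum /=; ring.
    rewrite !orbit_sumS IH mv_scal.
    by apply: functional_extensionality => i; rewrite /vscal /vadd; ring.
  by apply: leK_scal => //; lra.
have [|phi [l [phiP lP]]] := vec_BW _ x 1; first by move=> k; rewrite (xP k).2.1; lra.
have lim := seq_inv_lim _ _ _ phiP lP.
have Kl : K l.
  apply: Kclosed => eps e0; have [k _ [xl _]] := lim eps 0%N e0.
  by exists (x k); split; [case: (xP k) | rewrite vn_sub_sym].
have l0 : l <> vzero.
  move=> l0; have [k _ [xl _]] := lim (1/2) 0%N ltac:(lra).
  have := vn_cont (x k) l; rewrite (xP k).2.1 l0.
  have -> : vn (vzero : vec) = 0.
    by rewrite -[RHS](sumI_0 n); apply: sumI_ext => i; rewrite /vzero Rabs_R0.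
  by rewrite l0 in xl; lra.
have [N [r [r0 rP]]] := orbit_unit A l irr Kl l0.
have [c c0 cP] := vn_orbit_sum A N.
(* In units of [e], the orbit sum changes by at most [ce * c] times the distance to [l]; this radius
   keeps the change below [r / 2]. *)
have d0 : 0 < r / (2 * (ce * c + 1)) by apply: Rdiv_lt_0_compat; nra.
have r20 : 0 < r / 2 by lra.
have [k Nk [xl kr]] := lim (Rmin (r / 2) (r / (2 * (ce * c + 1)))) N (Rmin_glb_lt _ _ _ r20 d0).
have xl' := Rlt_le_trans _ _ _ xl (Rmin_r _ _).
have kr' := Rlt_le_trans _ _ _ kr (Rmin_l _ _).
case: (xP k) => Kxk [_]; apply.
apply: (leK_trans _ (vscal (r / 2) e)); first by apply: leK_scalr => //; lra.
apply: (leK_trans _ (orbit_sum A N (x k))); last exact: orbit_sum_mono.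
have h1 := He (orbit_sum A N (vsub l (x k))).
have h2 : leK (vscal (ce * vn (orbit_sum A N (vsub l (x k)))) e) (vscal (r / 2) e).
  apply: leK_scalr => //.
  have := cP (vsub l (x k)); rewrite (vn_sub_sym n l) => h.
  have v0 := vn_ge0 n (vsub (x k) l).
  have : (ce * c + 1) * vn (vsub (x k) l) <= r / 2.
    have -> : r / 2 = (ce * c + 1) * (r / (2 * (ce * c + 1))) by field; nra.
    apply: Rmult_le_compat_l; nra.
  nra.
have h3 := leK_add _ _ _ _ rP (leK_trans _ _ _ h1 h2).
move: h3; rewrite /leK -orbit_sum_sub; congr K.
by apply: functional_extensionality => i; rewrite /vscal /vsub /vadd; field.
Qed.

End OrderUnit.
End Cone.

(** * Growth rates *)

Lemma exp_le_compat x y : x <= y -> exp x <= exp y.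
Proof. by case=> [xy | ->]; [apply: Rlt_le; apply: exp_increasing | apply: Rle_refl]. Qed.

Lemma rpow_pos rho t : 0 < rho -> rpow rho t = exp (t * ln rho).
Proof.
move=> r0; rewrite /rpow; destruct (Req_EM_T t 0) as [->|t0].
  by rewrite /= Rmult_0_l exp_0.
by destruct (Rle_dec rho 0); [exfalso; lra | ].
Qed.

Lemma rpow_0r rho : rpow rho 0 = 1.
Proof. by rewrite /rpow; destruct (Req_EM_T 0 0). Qed.

Lemma rpow_0l t : t <> 0 -> rpow 0 t = 0.
Proof.
move=> t0; rewrite /rpow; destruct (Req_EM_T t 0) => //.
by destruct (Rle_dec 0 0) as [|[]]; last exact: Rle_refl.
Qed.

Lemma rpow_ge0 rho t : 0 <= rpow rho t.
Proof.
rewrite /rpow; destruct (Req_EM_T t 0) => /=; first lra.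
destruct (Rle_dec rho 0) => /=; [lra | exact: Rlt_le (exp_pos _)].
Qed.

(** For [rho = 0] this rests on [rpow 0 0 = 1] and [rpow 0 t = 0] for [t <> 0]; nonnegative
    exponents cannot cancel to 0. *)
Lemma rpow_add rho s t : 0 <= rho -> 0 <= s -> 0 <= t ->
  rpow rho (s + t) = rpow rho s * rpow rho t.
Proof.
move=> [r0 | <-] s0 t0.
  by rewrite !rpow_pos // Rmult_plus_distr_r exp_plus.
have [->|sn] := Req_dec s 0; first by rewrite Rplus_0_l rpow_0r Rmult_1_l.
by rewrite (rpow_0l s) // rpow_0l; lra.
Qed.

(** [ln s = t ln rho + O(1)], so dividing by [t] and applying [exp] gives the limit; for [rho = 0]
    the value [s] is itself 0. *)
Lemma jsr_limit rho al be : 0 <= rho -> 0 < al -> 0 < be ->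
  forall eps, 0 < eps -> exists T0, forall t s, T0 <= t -> 0 < t ->
    al * rpow rho t <= s <= be * rpow rho t -> Rabs (rpow s (/ t) - rho) < eps.
Proof.
move=> [r0 | <-] al0 be0 eps e0; last first.
  exists 0 => t s _ t0; rewrite rpow_0l; last lra.
  move=> H; have -> : s = 0 by lra.
  rewrite rpow_0l; last by apply: Rinv_neq_0_compat; lra.
  by rewrite Rminus_0_r Rabs_R0.
have [d [d0 dP]] := derivable_continuous_pt _ _ (derivable_pt_exp (ln rho)) eps e0.
set D := Rabs (ln al) + Rabs (ln be) + 1.
have D0 : 0 < D by rewrite /D; have := Rabs_pos (ln al); have := Rabs_pos (ln be); lra.
(* [D] bounds [|ln s - t ln rho|] and [d] is a continuity radius of [exp] at [ln rho]; beyond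
   [D / d] the quotient [D / t] is below [d]. *)
exists (D / d + 1) => t s tT t0; rewrite rpow_pos // => -[s1 s2].
have ep := exp_pos (t * ln rho).
have s0 : 0 < s by nra.
have l1 : ln al + t * ln rho <= ln s.
  rewrite -(ln_exp (t * ln rho)) -ln_mult //; apply: ln_le => //; nra.
have l2 : ln s <= ln be + t * ln rho.
  rewrite -(ln_exp (t * ln rho)) -ln_mult //; exact: ln_le.
rewrite rpow_pos // -{1}(exp_ln rho) //.
have [-> | ne] := Req_dec (/ t * ln s) (ln rho); first by rewrite Rminus_diag Rabs_R0.
apply: dP; split; first by split=> // H; apply: ne.
rewrite /= /Rdist.
have -> : / t * ln s - ln rho = (ln s - t * ln rho) / t by field; lra.
rewrite Rabs_div; last lra.
rewrite (Rabs_pos_eq t); last lra.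
apply: (Rmult_lt_reg_r t) => //.
have -> : Rabs (ln s - t * ln rho) / t * t = Rabs (ln s - t * ln rho) by field; lra.
have : Rabs (ln s - t * ln rho) <= D by rewrite /D; split_Rabs; lra.
have : D < d * t.
  have -> : D = d * (D / d) by field; lra.
  apply: Rmult_lt_compat_l; lra.
lra.
Qed.

Section GrowthRate.
Variables (time : R -> Prop) (f : R -> R) (c t0 : R).
Hypotheses (tm0 : time 0) (tm_ge0 : forall t, time t -> 0 <= t).
Hypothesis tm_add : forall s t, time s -> time t -> time (s + t).
Hypothesis tm_sub : forall s t, time s -> time t -> s <= t -> time (t - s).
Hypotheses (Tt0 : time t0) (t00 : 0 < t0).
Hypothesis f_ge0 : forall t, time t -> 0 <= f t.
Hypothesis f_sub : forall s t, time s -> time t -> f (s + t) <= f s * f t.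
Hypothesis c0 : 0 < c.
Hypothesis f_sup : forall s t, time s -> time t -> c * (f s * f t) <= f (s + t).
Hypothesis f_loc : forall T, exists L, forall t, time t -> t <= T -> f t <= L.

Lemma tm_mul k t : time t -> time (INR k * t).
Proof.
move=> Tt; elim: k => [|k IH]; first by rewrite Rmult_0_l.
by rewrite S_INR Rmult_plus_distr_r Rmult_1_l; apply: tm_add.
Qed.

Lemma growth_sup_pow m t : time t -> (c * f t) ^ S m <= c * f (INR (S m) * t).
Proof.
move=> Tt; elim: m => [|m IH]; first by rewrite /= !Rmult_1_l !Rmult_1_r; lra.
have Tm := tm_mul (S m) t Tt.
rewrite -tech_pow_Rmult (S_INR (S m)) Rmult_plus_distr_r Rmult_1_l.
have h := f_sup _ _ Tm Tt; have ft := f_ge0 _ Tt.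
apply: (Rle_trans _ (c * f t * (c * f (INR (S m) * t)))).
  by apply: Rmult_le_compat_l => //; nra.
nra.
Qed.

Lemma growth_sub_pow k t r : time t -> time r -> f (INR k * t + r) <= f t ^ k * f r.
Proof.
move=> Tt Tr; elim: k => [|k IH]; first by rewrite /= Rmult_0_l Rplus_0_l; lra.
have -> : INR (S k) * t + r = t + (INR k * t + r) by rewrite S_INR; ring.
apply: Rle_trans (f_sub _ _ Tt _) _; first by apply: tm_add => //; exact: tm_mul.
rewrite /= Rmult_assoc; apply: Rmult_le_compat_l => //; exact: f_ge0.
Qed.

(** Fekete's argument from both sides. [f] is submultiplicative and [c * f] supermultiplicative, so,
    when [f] has no positive zero, every [ln (c f s) / s] lies below every [ln (f t) / t], and
    [ln rho] is the supremum of the former. The lower bound excludes [t = 0], where [rpow rho 0 = 1]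
    while [f 0] may vanish. *)
Lemma growth_rate : exists rho C, 0 <= rho /\ 0 < C /\ forall t, time t ->
  f t <= C * rpow rho t /\ (0 < t -> rpow rho t <= f t).
Proof.
(* One positive zero spreads to all positive times: [(c f t)^(m+1) <= c f ((m+1) t)], and the right
   side vanishes once [(m+1) t >= t1]. Then [rho = 0]. *)
have [[t1 [Tt1 [t10 ft1]]] | Hpos] := classic (exists t1, time t1 /\ 0 < t1 /\ f t1 = 0).
  exists 0, (f 0 + 1); split; first lra; split; first by have := f_ge0 _ tm0; lra.
  move=> t Tt; split; last first.
    by move=> tp; rewrite rpow_0l; [apply: f_ge0 | lra].
  have [->|tn] := Req_dec t 0; first by rewrite rpow_0r; lra.
  rewrite rpow_0l // Rmult_0_r.
  have tp : 0 < t by have := tm_ge0 _ Tt; lra.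
  have [m mP] := INR_unbounded (t1 / t).
  have mt : t1 <= INR (S m) * t.
    have -> : t1 = t1 / t * t by field; lra.
    by apply: Rmult_le_compat_r; rewrite ?S_INR; lra.
  have Tm := tm_mul (S m) t Tt.
  have h := growth_sup_pow m t Tt.
  have h2 : f (INR (S m) * t) <= 0.
    have -> : INR (S m) * t = t1 + (INR (S m) * t - t1) by ring.
    apply: Rle_trans (f_sub _ _ Tt1 (tm_sub _ _ Tt1 Tm mt)) _; rewrite ft1; lra.
  apply: Rnot_lt_le => ft; have := pow_lt (c * f t) (S m) (Rmult_lt_0_compat _ _ c0 ft).
  nra.
have fp t : time t -> 0 < t -> 0 < f t.
  move=> Tt tp; have := f_ge0 _ Tt; case=> // E; case: Hpos; by exists t.
have fp0 t : time t -> 0 < f t.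
  move=> Tt; have [tp | <-] := tm_ge0 _ Tt; first exact: fp.
  have := f_sub 0 t0 tm0 Tt0; rewrite Rplus_0_l; have := fp _ Tt0 t00; have := f_ge0 _ tm0; nra.
(* Write [(m+1) s = k t + r] with [0 <= r <= t]; then [(c f s)^(m+1) <= f(t)^k f(r)], and the
   contribution of [r] to the logarithm stays bounded while [m] grows. *)
have key s t : time s -> time t -> 0 < s -> 0 < t -> ln (c * f s) / s <= ln (f t) / t.
  move=> Ts Tt sp tp; have fs := fp _ Ts sp; have ft := fp _ Tt tp.
  have [L LP] := f_loc t.
  set be := ln (f t) / t; set al := ln (c * f s).
  have L0 : 0 < L by apply: Rlt_le_trans (LP t Tt (Rle_refl _)).
  have main m : INR (S m) * (al - s * be) <= t * Rabs be + ln L.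
    have m0 : 0 < INR (S m) by apply: lt_0_INR; lia.
    have [k [k1 k2]] : exists k, INR k <= INR (S m) * s / t < INR k + 1.
      have [|k kP] := nfloor_ex (INR (S m) * s / t); last by exists k.
      by apply: Rlt_le; apply: Rdiv_lt_0_compat => //; nra.
    set r := INR (S m) * s - INR k * t.
    have E : INR (S m) * s = INR (S m) * s / t * t by field; lra.
    have r1 : 0 <= r by rewrite /r E; nra.
    have r2 : r <= t by rewrite /r E; nra.
    have Tr : time r by apply: tm_sub; [exact: tm_mul | exact: tm_mul | rewrite /r in r1; lra].
    have h1 := growth_sup_pow m s Ts.
    have h2 := growth_sub_pow k t r Tt Tr.
    have rE : INR k * t + r = INR (S m) * s by rewrite /r; ring.
    rewrite rE in h2; have h3 := LP _ Tr r2.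
    have cs : 0 < c * f s by nra.
    have Tms := tm_mul (S m) s Ts.
    (* Comparing both inequalities at time 0 forces [c <= 1], which removes the leading factor of
       [growth_sup_pow]. *)
    have c1 : c <= 1.
      have a1 := f_sup 0 0 tm0 tm0; have a2 := f_sub 0 0 tm0 tm0.
      have a3 := fp0 _ tm0; rewrite Rplus_0_l in a1 a2.
      have : 0 < f 0 * f 0 by nra.
      nra.
    have h4 : (c * f s) ^ S m <= f t ^ k * L.
      apply: Rle_trans h1 _; have fm := fp0 _ Tms; have := pow_lt (f t) k ft; nra.
    have := ln_le _ _ (pow_lt _ (S m) cs) h4.
    rewrite ln_mult //; last exact: pow_lt.
    rewrite !ln_pow // -/al => h5.
    have -> : INR (S m) * (al - s * be) = INR (S m) * al - INR (S m) * s * be by ring.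
    have h6 : INR k * ln (f t) = INR (S m) * s * be - r * be.
      by rewrite -rE /be; field; lra.
    have : - r * be <= t * Rabs be.
      have := Rle_abs (- be); rewrite Rabs_Ropp; have := Rabs_pos be; nra.
    lra.
  apply: Rnot_lt_le => H.
  have H' : 0 < al - s * be.
    have -> : al - s * be = s * (al / s - be) by field; lra.
    by apply: Rmult_lt_0_compat => //; lra.
  have [m mP] := INR_unbounded ((t * Rabs be + ln L) / (al - s * be)).
  have := main m; apply: Rlt_not_le.
  have -> : t * Rabs be + ln L = (t * Rabs be + ln L) / (al - s * be) * (al - s * be) by field; lra.
  apply: Rmult_lt_compat_r => //; rewrite S_INR; lra.
have [||lam [lam1 lam2]] := completeness (fun x => exists s, time s /\ 0 < s /\ x = ln (c * f s) / s).
- by exists (ln (f t0) / t0) => x [s [Ts [sp ->]]]; apply: key.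
- by exists (ln (c * f t0) / t0), t0.
have ep := exp_pos lam; have f0 := fp0 _ tm0.
(* [1 / c] serves positive times, [f 0] serves [t = 0]. *)
exists (exp lam), (/ c + f 0); split; first lra; split.
  by have := Rinv_0_lt_compat _ c0; lra.
move=> t Tt; rewrite rpow_pos // ln_exp; have ft := fp0 _ Tt; split.
  have [tp | <-] := tm_ge0 _ Tt; last first.
    by rewrite Rmult_0_l exp_0; have := Rinv_0_lt_compat _ c0; lra.
  have h : ln (c * f t) / t <= lam by apply: lam1; exists t.
  have h2 : c * f t <= exp (t * lam).
    rewrite -(exp_ln (c * f t)); last nra.
    apply: exp_le_compat; have -> : ln (c * f t) = t * (ln (c * f t) / t) by field; lra.
    apply: Rmult_le_compat_l; lra.
  have h3 : f t <= / c * exp (t * lam).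
    apply: (Rmult_le_reg_l c) => //; rewrite -Rmult_assoc Rinv_r; lra.
  have := exp_pos (t * lam); nra.
move=> tp; have h : lam <= ln (f t) / t.
  by apply: lam2 => x [s [Ts [sp ->]]]; apply: key.
rewrite -{1}(exp_ln (f t)) //; apply: exp_le_compat.
have -> : ln (f t) = t * (ln (f t) / t) by field; lra.
apply: Rmult_le_compat_l; lra.
Qed.

End GrowthRate.

(** * Abstract families of matrices *)

Section AbstractFamily.
Variable n : nat.
Local Notation vec := (vec n).
Local Notation mat := (mat n).
Arguments sumI {n}. Arguments vadd {n}. Arguments vsub {n}. Arguments vscal {n}.
Arguments vopp {n}. Arguments vzero {n}. Arguments enorm {n}. Arguments mid {n}.
Arguments madd {n}. Arguments msub {n}. Arguments mscal {n}. Arguments mmul {n}.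
Arguments mv {n}. Arguments mpow {n}. Arguments frob {n}.
Arguments vn {n}. Arguments mn {n}. Arguments leK {n}. Arguments orbit_sum {n}.

(* In case (C) a product of elements of S_s and S_t need not lie in S_(s+t), since
   switching intervals have positive length; it is only a limit of elements of
   S_(s+t+d) as d tends to 0. *)
Record family_axioms (time : R -> Prop) (Sg : R -> mat -> Prop) : Prop := {
  fam_time0 : time 0;
  fam_time_ge0 : forall t, time t -> 0 <= t;
  fam_time_add : forall s t, time s -> time t -> time (s + t);
  fam_time_sub : forall s t, time s -> time t -> s <= t -> time (t - s);
  fam_split : forall s t P, time s -> time t -> Sg (s + t) P ->
    exists Q U, Sg s Q /\ Sg t U /\ P = mmul Q U;
  fam_join : forall s t Q U eps, time s -> time t -> Sg s Q -> Sg t U -> 0 < eps ->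
    exists d V, time d /\ d <= eps /\ Sg (s + t + d) V /\ mn (msub (mmul Q U) V) < eps;
  fam_bound : forall T, exists L, forall t P, time t -> t <= T -> Sg t P -> mn P <= L }.

Variables (K : vec -> Prop) (time : R -> Prop) (Sg : R -> mat -> Prop).
Hypothesis HK : proper_cone n K.
Hypothesis fam : family_axioms time Sg.
Hypothesis Sg_pos : forall t P, time t -> Sg t P -> in_piK n K P.
Variables (t0 : R) (A0 : mat).
Hypotheses (Tt0 : time t0) (t00 : 0 < t0).
Hypothesis A0_conv : in_conv n (Sg t0) A0.
Hypothesis A0_irr : K_irreducible_mat n K A0.
Variables (e : vec) (ce : R).
Hypotheses (Ke : K e) (ce0 : 0 < ce) (He : forall x, leK K x (vscal (ce * vn x) e)).

Let tm0 := fam_time0 _ _ fam.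
Let tm_ge0 := fam_time_ge0 _ _ fam.
Let tm_add := fam_time_add _ _ fam.
Let tm_sub := fam_time_sub _ _ fam.
Let leKt := leK_trans n K HK.

(** Suprema over S_t need a point. Joining copies of an element of S_t0 reaches arbitrarily late
    times, possibly overshooting because of the delays; splitting then gives an element at exactly
    [t]. *)
Lemma Sg_nonempty t : time t -> exists P, Sg t P.
Proof.
move=> Tt.
have [P0 SP0] : exists P, Sg t0 P.
  case: A0_conv => -[|m] [l [B [H [/= sl _]]]]; first lra.
  by exists (B 0%N); case: (H 0%N).
have big k : exists r P, time r /\ INR k * t0 <= r /\ Sg r P.
  elim: k => [|k [r [P [Tr [rk SP]]]]].
    by exists t0, P0; split=> //; split=> //; rewrite /=; lra.
  have [d [V [Td [_ [SV _]]]]] := fam_join _ _ fam _ _ _ _ 1 Tr Tt0 SP SP0 ltac:(lra).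
  exists (r + t0 + d), V; split; first by apply: tm_add => //; apply: tm_add.
  by split=> //; rewrite S_INR; have := tm_ge0 _ Td; lra.
have [k kP] := INR_unbounded (t / t0).
have [r [P [Tr [rk SP]]]] := big k.
have tr : t <= r.
  have -> : t = t / t0 * t0 by field; lra.
  nra.
have E : r = r - t + t by ring.
rewrite E in SP; have [Q [U [_ [SU _]]]] := fam_split _ _ fam _ _ _ (tm_sub _ _ Tt Tr tr) Tt SP.
by exists U.
Qed.

Lemma mv_e_le P L : mn P <= L -> leK K (mv P e) (vscal (ce * (L * vn e)) e).
Proof.
move=> PL; apply: leKt (He _) _; apply: leK_scalr => //.
apply: Rmult_le_compat_l; first lra.
apply: Rle_trans (vn_mv _ _ _) _; apply: Rmult_le_compat_r => //; exact: vn_ge0.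
Qed.

(** For a positive [P] the least [m] with [P e <= m e] is the operator norm belonging to the
    order-unit norm of [e], so this is the size of S_t in that norm. *)
Definition is_growth t m := 0 <= m /\ (forall P, Sg t P -> leK K (mv P e) (vscal m e)) /\
  (forall m', 0 <= m' -> (forall P, Sg t P -> leK K (mv P e) (vscal m' e)) -> m <= m').

Lemma growth_exists t : time t -> exists m, is_growth t m.
Proof.
move=> Tt; have [L LP] := fam_bound _ _ fam t.
pose G m := 0 <= m /\ forall P, Sg t P -> leK K (mv P e) (vscal m e).
have G1 : G (ce * (Rmax 0 L * vn e)).
  split.
    apply: Rmult_le_pos; first lra.
    apply: Rmult_le_pos; [exact: Rmax_l | exact: vn_ge0].
  move=> P SP; apply: mv_e_le; apply: Rle_trans (Rmax_r _ _).
  by apply: (LP t) => //; apply: Rle_refl.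
(* The infimum of [G] is taken as minus the supremum of the reflected set. *)
have [||m [m1 m2]] := completeness (fun y => G (- y)).
- by exists 0 => y [y0 _]; lra.
- by exists (- (ce * (Rmax 0 L * vn e))); rewrite /= Ropp_involutive.
have mlow m' : G m' -> - m <= m'.
  by move=> Gm; have : - m' <= m; [apply: m1; rewrite /= Ropp_involutive | lra].
have m0 : 0 <= - m by have : m <= 0; [apply: m2 => y [y0 _]; lra | lra].
exists (- m); split=> //; split; last by move=> m' m'0 H; apply: mlow.
move=> P SP; apply: leK_scal_limit => // eps e0.
have [y [Gy ym]] : exists y, G (- y) /\ m - eps < y.
  apply: NNPP => H; have : m <= m - eps; last lra.
  apply: m2 => y Gy; apply: Rnot_lt_le => ym; apply: H; by exists y.
by exists (- y); [lra | apply: Gy.2].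
Qed.

Variable f : R -> R.
Hypothesis fP : forall t, time t -> is_growth t (f t).

Lemma f_ge0 t : time t -> 0 <= f t.
Proof. by case/fP. Qed.

Lemma f_sub s t : time s -> time t -> f (s + t) <= f s * f t.
Proof.
move=> Ts Tt; have [_ [_ H]] := fP _ (tm_add _ _ Ts Tt).
have [s0 [sP _]] := fP _ Ts; have [t0' [tP _]] := fP _ Tt.
apply: H; first exact: Rmult_le_pos.
move=> P SP; have [Q [U [SQ [SU ->]]]] := fam_split _ _ fam _ _ _ Ts Tt SP.
rewrite mv_mmul; apply: (leKt _ (mv Q (vscal (f t) e))).
  by apply: leK_mv; [apply: Sg_pos SQ | apply: tP].
rewrite mv_scal Rmult_comm -vscalA; apply: leK_scal => //; exact: sP.
Qed.

Lemma f_loc T : exists L, forall t, time t -> t <= T -> f t <= L.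
Proof.
have [L LP] := fam_bound _ _ fam T; exists (ce * (Rmax 0 L * vn e)) => t Tt tT.
have [_ [_ H]] := fP _ Tt; apply: H.
  apply: Rmult_le_pos; first lra.
  by apply: Rmult_le_pos; [exact: Rmax_l | exact: vn_ge0].
move=> P SP; apply: mv_e_le; apply: Rle_trans (Rmax_r _ _); exact: (LP t).
Qed.

(** Limits of elements of S_(t+d) as the delay [d] tends to 0. Thanks to [fam_join] these closures
    multiply, and [f t] still governs their size up to a constant. *)
Definition Slim t (U : mat) := forall eps, 0 < eps -> exists d V,
  time d /\ d <= eps /\ Sg (t + d) V /\ mn (msub U V) < eps.

Lemma mn_sub_self (U : mat) : mn (msub U U) = 0.
Proof.
rewrite -[RHS](sumI_0 n); apply: sumI_ext => i; rewrite -[RHS](sumI_0 n).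
by apply: sumI_ext => j; rewrite /msub Rminus_diag Rabs_R0.
Qed.

Lemma Sg_Slim t U : Sg t U -> Slim t U.
Proof.
by move=> SU eps e0; exists 0, U; rewrite Rplus_0_r mn_sub_self; split=> //; split; [lra|].
Qed.

Lemma mul_close (P Q P' Q' : mat) eta : 0 <= eta <= 1 ->
  mn (msub P P') <= eta -> mn (msub Q Q') <= eta ->
  mn (msub (mmul P Q) (mmul P' Q')) <= eta * (mn P + mn Q + 1).
Proof.
move=> [e0 e1] HP HQ.
apply: Rle_trans (mn_sub_triangle _ _ (mmul P Q') _) _.
rewrite -mmul_msubr -mmul_msubl.
have h1 := mn_mmul n P (msub Q Q'); have h2 := mn_mmul n (msub P P') Q'.
have h3 := mn_le_sub n Q' Q; rewrite mn_sub_sym in h3.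
have := mn_ge0 n P; have := mn_ge0 n Q; have := mn_ge0 n Q'; have := mn_ge0 n (msub P P').
have := mn_ge0 n (msub Q Q'); nra.
Qed.

Lemma Slim_mul s t P Q : time s -> time t -> Slim s P -> Slim t Q -> Slim (s + t) (mmul P Q).
Proof.
move=> Ts Tt SP SQ eps e0.
set M := mn P + mn Q + 1.
have M0 : 0 < M by rewrite /M; have := mn_ge0 n P; have := mn_ge0 n Q; lra.
(* Each of the three delays and the joining error is at most [eps / 4]; the bound [eps / (4 * M)]
   makes the product error [eta * M] at most [eps / 4]. *)
set eta := Rmin 1 (Rmin (eps / 4) (eps / (4 * M))).
have q1 : 0 < eps / (4 * M) by apply: Rdiv_lt_0_compat; lra.
have eta0 : 0 < eta by do 2 (apply: Rmin_glb_lt; first lra).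
have eta1 : eta <= 1 := Rmin_l _ _.
have eta2 : eta <= eps / 4 := Rle_trans _ _ _ (Rmin_r _ _) (Rmin_l _ _).
have eta3 : eta <= eps / (4 * M) := Rle_trans _ _ _ (Rmin_r _ _) (Rmin_r _ _).
have [d1 [P' [Td1 [d1e [SP' PP]]]]] := SP _ eta0.
have [d2 [Q' [Td2 [d2e [SQ' QQ]]]]] := SQ _ eta0.
have [d3 [V [Td3 [d3e [SV VV]]]]] :=
  fam_join _ _ fam _ _ _ _ eta (tm_add _ _ Ts Td1) (tm_add _ _ Tt Td2) SP' SQ' eta0.
exists (d1 + d2 + d3), V; split; first by apply: tm_add => //; apply: tm_add.
split; first lra; split.
  by have <- : s + d1 + (t + d2) + d3 = s + t + (d1 + d2 + d3) by ring.
apply: Rle_lt_trans (mn_sub_triangle _ _ (mmul P' Q') _) _.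
have := mul_close P Q P' Q' eta ltac:(lra) ltac:(lra) ltac:(lra); rewrite -/M => h.
have : eta * M <= eps / 4.
  have -> : eps / 4 = eps / (4 * M) * M by field; lra.
  by apply: Rmult_le_compat_r; lra.
lra.
Qed.

Lemma mv_close (U V : mat) x eps : 0 < eps -> mn (msub U V) < eps / (vn x + 1) ->
  vn (vsub (mv U x) (mv V x)) < eps.
Proof.
move=> e0 UV; rewrite -mv_msub; apply: Rle_lt_trans (vn_mv _ _ _) _.
have x0 := vn_ge0 n x.
have -> : eps = eps / (vn x + 1) * (vn x + 1) by field; lra.
have := mn_ge0 n (msub U V); nra.
Qed.

Lemma Slim_growth : exists2 L, 0 < L & forall t U, time t -> Slim t U ->
  leK K (mv U e) (vscal (L * f t) e).
Proof.
have [L LP] := f_loc 1.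
have L0 : 0 <= L by apply: Rle_trans (f_ge0 _ tm0) (LP _ tm0 _); lra.
exists (L + 1); first lra.
move=> t U Tt SU; have ft := f_ge0 _ Tt.
apply: leK_limit => // eps e0.
have q0 : 0 < eps / (vn e + 1) by apply: Rdiv_lt_0_compat => //; have := vn_ge0 n e; lra.
have [|d [V [Td [dm [SV UV]]]]] := SU (Rmin 1 (eps / (vn e + 1))).
  by apply: Rmin_glb_lt; lra.
have d1 := Rle_trans _ _ _ dm (Rmin_l _ _).
have UV' := Rlt_le_trans _ _ _ UV (Rmin_r _ _).
exists (mv V e), (vscal ((L + 1) * f t) e); split; last first.
  by split; [exact: mv_close | rewrite vn_sub_self].
have [_ [H _]] := fP _ (tm_add _ _ Tt Td).
apply: leKt (H _ SV) _; apply: leK_scalr => //.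
apply: Rle_trans (f_sub _ _ Tt Td) _; have := LP _ Td d1; have := f_ge0 _ Td; nra.
Qed.

(** The weights sum to 1, so [z - P A0 y] is the weighted sum of the vectors [z - P B y] of [K].
    This is how the hull element [A0] enters estimates about S_t0. *)
Lemma conv_le (P : mat) (y z : vec) :
  (forall B, Sg t0 B -> leK K (mv P (mv B y)) z) -> leK K (mv P (mv A0 y)) z.
Proof.
move=> H; case: A0_conv => m [l [B [HB [sl AE]]]].
have Kw : K (fun i => sumN m (fun k => l k * vsub z (mv P (mv (B k) y)) i)).
  by apply: KsumN => // k km; have [l0 SB] := HB k km; split=> //; apply: H.
rewrite /leK; have <- // : (fun i => sumN m (fun k => l k * vsub z (mv P (mv (B k) y)) i))
   = vsub z (mv P (mv A0 y)).
have AyE : mv A0 y = (fun i => sumN m (fun k => l k * mv (B k) y i)).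
  apply: functional_extensionality => i; rewrite /mv.
  rewrite (sumI_ext _ _ (fun j => sumN m (fun k => l k * B k i j) * y j)); last by move=> j; rewrite AE.
  elim: (m) => [|k IH] /=.
    by rewrite -[RHS](sumI_0 n); apply: sumI_ext => j; ring.
  by rewrite -IH -sumI_scal -sumI_add; apply: sumI_ext => j; ring.
have PAE : mv P (mv A0 y) = (fun i => sumN m (fun k => l k * mv P (mv (B k) y) i)).
  rewrite AyE; apply: functional_extensionality => i; rewrite {1}/mv.
  elim: (m) => [|k IH] /=.
    by rewrite -[RHS](sumI_0 n); apply: sumI_ext => j; ring.
  by rewrite -IH [X in _ + _ * X]/mv -sumI_scal -sumI_add; apply: sumI_ext => j; ring.
rewrite PAE; apply: functional_extensionality => i; rewrite [RHS]/vsub -[z i]Rmult_1_l -sl.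
elim: (m) => [|k IH] /=; first by ring.
by rewrite IH /vsub; ring.
Qed.

(** By [orbit_uniform], [c |U e| P e] lies below the sum of the [P A0^k U e], hence below a multiple
    of [f (s + t) e]. Minimality of [f s] removes [P]; then [U e <= ce |U e| e] and minimality of
    [f t] remove [U]. *)
Lemma f_sup : exists2 c, 0 < c & forall s t, time s -> time t -> c * (f s * f t) <= f (s + t).
Proof.
have [N [c [c0 cP]]] := orbit_uniform n K HK e ce Ke ce0 He A0 A0_irr.
have [L L0 LP] := Slim_growth.
have Tk k : time (INR k * t0) by apply: (tm_mul time).
(* The leftmost [A0] is replaced by an arbitrary [B] in S_t0 and merged into [P], so the induction
   must keep [s] and [P] general. *)
have step k t U : time t -> Slim t U -> forall s P, time s -> Slim s P ->
    leK K (mv P (mv (mpow A0 k) (mv U e))) (vscal (L * f (s + INR k * t0 + t)) e).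
  move=> Tt SU; elim: k => [|k IH] s P Ts SP.
    rewrite /= mv_mid -mv_mmul Rmult_0_l Rplus_0_r; apply: LP; first exact: tm_add.
    exact: Slim_mul.
  rewrite /= mv_mmul; apply: conv_le => B SB; rewrite -mv_mmul.
  have -> : s + INR (S k) * t0 + t = s + t0 + INR k * t0 + t by rewrite S_INR; ring.
  apply: IH; first exact: tm_add.
  by apply: Slim_mul => //; apply: Sg_Slim.
have [M M0 MP] : exists2 M, 0 < M & forall s t P U, time s -> time t -> Slim s P -> Slim t U ->
    leK K (mv P (orbit_sum A0 N (mv U e))) (vscal (M * f (s + t)) e).
  elim: N {cP} => [|N [M M0 IH]].
    exists 1; first lra.
    move=> s t P U Ts Tt SP SU; rewrite mv_orbit_sum_comm /= /leK.
    have -> : vsub (vscal (1 * f (s + t)) e) (fun=> 0) = vscal (1 * f (s + t)) e.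
      by apply: functional_extensionality => i; rewrite /vsub; ring.
    by apply: Kscal => //; have := f_ge0 _ (tm_add _ _ Ts Tt); lra.
  have fN := f_ge0 _ (Tk N).
  (* [f (s + N t0 + t) <= f (N t0) * f (s + t)] absorbs the inserted time into the constant. *)
  exists (M + L * f (INR N * t0)); first nra.
  move=> s t P U Ts Tt SP SU; rewrite orbit_sumS mv_add.
  have -> : vscal ((M + L * f (INR N * t0)) * f (s + t)) e =
    vadd (vscal (M * f (s + t)) e) (vscal (L * f (INR N * t0) * f (s + t)) e).
    by apply: functional_extensionality => i; rewrite /vadd /vscal; ring.
  apply: leK_add => //; first exact: IH.
  apply: leKt (step N t U Tt SU s P Ts SP) _; apply: leK_scalr => //.
  have -> : s + INR N * t0 + t = INR N * t0 + (s + t) by ring.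
  have := f_sub _ _ (Tk N) (tm_add _ _ Ts Tt); nra.
have mid_le s t P U : time s -> time t -> Sg s P -> Sg t U ->
    leK K (vscal (c * vn (mv U e)) (mv P e)) (vscal (M * f (s + t)) e).
  move=> Ts Tt SP SU; apply: leKt (MP s t P U Ts Tt (Sg_Slim _ _ SP) (Sg_Slim _ _ SU)).
  rewrite -mv_scal; apply: leK_mv; first exact: Sg_pos SP.
  by apply: cP; apply: Sg_pos SU _ Ke.
exists (c / (ce * M)); first by apply: Rdiv_lt_0_compat => //; nra.
move=> s t Ts Tt; have fst := f_ge0 _ (tm_add _ _ Ts Tt).
have fs := f_ge0 _ Ts; have ft := f_ge0 _ Tt.
have le1 U : Sg t U -> c * vn (mv U e) * f s <= M * f (s + t).
  move=> SU; have v0 := vn_ge0 n (mv U e).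
  have [-> | vne] := Req_dec (vn (mv U e)) 0; first nra.
  have vp : 0 < c * vn (mv U e) by apply: Rmult_lt_0_compat; lra.
  have [_ [_ H]] := fP _ Ts.
  have -> : M * f (s + t) = c * vn (mv U e) * (/ (c * vn (mv U e)) * (M * f (s + t))).
    by field; lra.
  have iv : 0 < / (c * vn (mv U e)) by apply: Rinv_0_lt_compat.
  apply: Rmult_le_compat_l; first lra.
  apply: H; first by apply: Rmult_le_pos; nra.
  move=> P SP; rewrite -vscalA.
  have -> : mv P e = vscal (/ (c * vn (mv U e))) (vscal (c * vn (mv U e)) (mv P e)).
    by apply: functional_extensionality => i; rewrite /vscal; field; lra.
  by apply: leK_scal => //; [lra | apply: mid_le].
have cm : 0 < ce * M by nra.
have [fsp | <-] := fs; last by rewrite Rmult_0_l Rmult_0_r.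
have h : f t <= ce * (M * f (s + t) / (c * f s)).
  have [_ [_ H]] := fP _ Tt; apply: H.
    apply: Rmult_le_pos; first lra.
    apply: Rmult_le_pos; first nra.
    by apply: Rlt_le; apply: Rinv_0_lt_compat; nra.
  move=> U SU; apply: leKt (He _) _; apply: leK_scalr => //.
  apply: Rmult_le_compat_l; first lra.
  apply: (Rmult_le_reg_l (c * f s)); first nra.
  have -> : c * f s * (M * f (s + t) / (c * f s)) = M * f (s + t) by field; lra.
  have := le1 U SU; lra.
have -> : f (s + t) = c / (ce * M) * (f s * (ce * (M * f (s + t) / (c * f s)))) by field; lra.
apply: Rmult_le_compat_l; first by apply: Rlt_le; apply: Rdiv_lt_0_compat.
by apply: Rmult_le_compat_l; lra.
Qed.

(** A column of [P] is [P d] for a basis vector [d]; from [-ce e <= d <= ce e] it lies between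
    [-ce m e] and [ce m e], and normality bounds its length. The [+ 1] keeps [b] positive even for
    [n = 0]. *)
Lemma frob_growth : exists2 b, 0 < b & forall t P m, time t -> Sg t P -> 0 <= m ->
  leK K (mv P e) (vscal m e) -> frob P <= b * m.
Proof.
have [D D0 DP] := cone_normal n K HK e Ke.
exists (INR n * (INR n * (D * ce)) + 1).
  have := pos_INR n; have : 0 < D * ce by nra.
  have [n0 | <-] := pos_INR n; nra.
move=> t P m Tt SP m0 Pm; have KP := Sg_pos _ _ Tt SP.
apply: Rle_trans (frob_le_mn _ _) _.
apply: (Rle_trans _ (INR n * (INR n * (D * (ce * m))))); last by nra.
apply: mn_le_entries => i j.
pose d : vec := fun k => if j == k then 1 else 0.
have d1 : vn d = 1.
  rewrite /vn -[RHS](sumI_delta n (fun=> 1) j); apply: sumI_ext => k.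
  by rewrite /d; case: (j == k); rewrite ?Rabs_R1 ?Rabs_R0; ring.
have -> : P i j = mv P d i.
  rewrite /mv -[LHS](sumI_delta n (fun j => P i j) j); apply: sumI_ext => k.
  by rewrite /d; ring.
apply: Rle_trans (coord_le_vn _ _ _) _; apply: DP; first nra.
  apply: (leKt _ (mv P (vscal (ce * vn d) e))); first exact: leK_mv.
  by rewrite d1 Rmult_1_r mv_scal -vscalA; apply: leK_scal => //; lra.
have dN : vn (vopp d) = 1.
  by rewrite -d1; apply: sumI_ext => k; rewrite /vopp Rabs_Ropp.
rewrite -mv_opp; apply: (leKt _ (mv P (vscal (ce * vn (vopp d)) e))); first exact: leK_mv.
by rewrite dN Rmult_1_r mv_scal -vscalA; apply: leK_scal => //; lra.
Qed.

(** [f t] and the supremum of [frob] over S_t differ by constant factors, so the squeeze between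
    multiples of [rho ^ t] passes to the latter. *)
Lemma family_jsr rho C : 0 <= rho -> 0 < C ->
  (forall t, time t -> f t <= C * rpow rho t /\ (0 < t -> rpow rho t <= f t)) ->
  is_jsr n time Sg rho.
Proof.
move=> r0 C0 fr eps e0.
have [b b0 bP] := frob_growth.
set a := ce * (INR n * (INR n * (vn e + 1)) + 1).
have a0 : 0 < a.
  apply: Rmult_lt_0_compat => //; have := vn_ge0 n e; have [n0 | <-] := pos_INR n; nra.
have [T0 T0P] := jsr_limit rho (/ a) (b * C) r0 (Rinv_0_lt_compat _ a0)
  (Rmult_lt_0_compat _ _ b0 C0) eps e0.
exists T0 => t Tt tT tp; have [ft1 /(_ tp) ft2] := fr t Tt.
have ft := f_ge0 _ Tt.
have ub : is_upper_bound (fun r => exists P, Sg t P /\ r = frob P) (b * f t).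
  by move=> r [P [SP ->]]; apply: (bP t) => //; have [_ [H _]] := fP _ Tt; apply: H.
have [P0 SP0] := Sg_nonempty t Tt.
have [||s sP] := completeness (fun r => exists P, Sg t P /\ r = frob P).
- by exists (b * f t).
- by exists (frob P0), P0.
exists s; split=> //; apply: T0P => //; split; last first.
  by apply: (Rle_trans _ (b * f t)); [apply: sP.2 | nra].
have s0 : 0 <= s by apply: Rle_trans (frob_ge0 _ P0) _; apply: sP.1; exists P0.
have fs : f t <= a * s.
  have [_ [_ H]] := fP _ Tt; apply: H; first nra.
  move=> P SP; apply: leKt (He _) _; apply: leK_scalr => //.
  have Ps : frob P <= s by apply: sP.1; exists P.
  rewrite /a Rmult_assoc; apply: Rmult_le_compat_l; first lra.
  apply: Rle_trans (vn_mv _ _ _) _.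
  have v0 := vn_ge0 n e; have n0 := pos_INR n; have h := mn_le_frob n P.
  apply: (Rle_trans _ (INR n * (INR n * s) * (vn e + 1))); last nra.
  apply: Rmult_le_compat; [exact: mn_ge0 | exact: v0 | | lra].
  apply: Rle_trans h _; apply: Rmult_le_compat_l => //; exact: Rmult_le_compat_l.
apply: (Rmult_le_reg_l a) => //; rewrite -Rmult_assoc Rinv_r; lra.
Qed.

(** In case (C) S_0 consists of projections, so the identity is added at time 0; it lets an
    admissible [m] bound the majorant [z] itself, hence [x]. *)
Definition Sid t (U : mat) := Slim t U \/ (t = 0 /\ U = mid).

Lemma Sid_mul s t P Q : time s -> time t -> Sid s P -> Sid t Q -> Sid (s + t) (mmul P Q).
Proof.
move=> Ts Tt [SP | [-> ->]] [SQ | [-> ->]]; rewrite ?mmul1m ?mmulm1 ?Rplus_0_l ?Rplus_0_r.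
- by left; apply: Slim_mul.
- by left.
- by left.
- by right.
Qed.

(* The norm is the infimum of [bounds rho x]; minimising over the majorants [z] of
   [x] and [-x] makes it absolute. *)
Definition bounds rho x m := 0 <= m /\ exists z, leK K x z /\ leK K (vopp x) z /\
  forall t U, time t -> Sid t U -> leK K (mv U z) (vscal (m * rpow rho t) e).

(** The bound on [f] makes [bounds] inhabited, with [ce |x| e] as majorant of [x] and [-x]. *)
Lemma family_norm rho C : 0 <= rho -> 0 < C ->
  (forall t, time t -> f t <= C * rpow rho t) ->
  exists v, is_norm n v /\ monotone n K v /\ extremal n time Sg rho v /\ absolute n K v.
Proof.
move=> r0 C0 fr.
have [L L0 LP] := Slim_growth.
have Lr t U : time t -> Sid t U -> leK K (mv U e) (vscal ((L * C + 1) * rpow rho t) e).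
  move=> Tt [SU | [-> ->]]; last first.
    rewrite mv_mid rpow_0r -{1}[e](_ : vscal 1 e = e); last first.
      by apply: functional_extensionality => i; rewrite /vscal; ring.
    by apply: leK_scalr => //; nra.
  apply: leKt (LP _ _ Tt SU) _; apply: leK_scalr => //.
  have := fr _ Tt; have := rpow_ge0 rho t; nra.
have Bex x : exists m, bounds rho x m.
  exists (ce * vn x * (L * C + 1)); split.
    have h1 := vn_ge0 n x; have h2 : 0 < L * C by nra.
    by apply: Rmult_le_pos; [apply: Rmult_le_pos; lra | lra].
  exists (vscal (ce * vn x) e); split=> //; split.
    have -> : vn x = vn (vopp x); last exact: He.
    by apply: sumI_ext => i; rewrite /vopp Rabs_Ropp.
  move=> t U Tt SU; rewrite mv_scal Rmult_assoc -(vscalA n (ce * vn x)); apply: leK_scal => //; last exact: Lr.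
  by have := vn_ge0 n x; nra.
have /choice_fun [v vP] : forall x, exists v, (forall m, bounds rho x m -> v <= m) /\
    (forall w, (forall m, bounds rho x m -> w <= m) -> w <= v).
  move=> x; have [||w [w1 w2]] := completeness (fun y => bounds rho x (- y)).
  - by exists 0 => y [y0 _]; lra.
  - by have [m Bm] := Bex x; exists (- m); rewrite /= Ropp_involutive.
  exists (- w); split=> [m Bm | u Hu].
    by have : - m <= w; [apply: w1; rewrite /= Ropp_involutive | lra].
  have : w <= - u; last lra.
  by apply: w2 => y By; have := Hu _ By; lra.
have v0 x : 0 <= v x by apply: (vP x).2 => m [].
(* Inequalities between values of [v] come from transporting admissible bounds; [a = 0] is separate
   since it cannot be divided out. *)
have v_incl x y a : 0 <= a -> (forall m, bounds rho x m -> bounds rho y (a * m)) -> v y <= a * v x.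
  move=> [a0 | <-] H; last first.
    have [m Bm] := Bex x; have := (vP y).1 _ (H m Bm); lra.
  apply: (Rmult_le_reg_l (/ a)); first exact: Rinv_0_lt_compat.
  rewrite -Rmult_assoc Rinv_l ?Rmult_1_l; last lra.
  apply: (vP x).2 => m Bm; apply: (Rmult_le_reg_l a) => //.
  rewrite -Rmult_assoc Rinv_r ?Rmult_1_l; last lra.
  exact: (vP y).1 _ (H m Bm).
have v_le x y : (forall m, bounds rho x m -> bounds rho y m) -> v y <= v x.
  move=> H; rewrite -[v x]Rmult_1_l; apply: v_incl; first lra.
  by move=> m; rewrite Rmult_1_l; apply: H.
have v_scal c x : v (vscal c x) <= Rabs c * v x.
  apply: v_incl; first exact: Rabs_pos.
  move=> m [m0 [z [xz [xz' zU]]]]; split; first by apply: Rmult_le_pos => //; apply: Rabs_pos.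
  exists (vscal (Rabs c) z).
  have h1 := leK_scal n K HK _ _ _ (Rabs_pos c) xz.
  have h2 := leK_scal n K HK _ _ _ (Rabs_pos c) xz'.
  have [c0 | c0] := Rle_dec 0 c.
  - rewrite (Rabs_pos_eq c) // in h1 h2 *.
    split=> //; split.
      have -> // : vopp (vscal c x) = vscal c (vopp x).
      by apply: functional_extensionality => i; rewrite /vopp /vscal; ring.
    move=> t U Tt SU; rewrite mv_scal Rmult_assoc -vscalA; apply: leK_scal => //; exact: zU.
  - rewrite (Rabs_left1 c) in h1 h2 *; last lra.
    split.
      have -> // : vscal c x = vscal (- c) (vopp x).
      by apply: functional_extensionality => i; rewrite /vopp /vscal; ring.
    split.
      have -> // : vopp (vscal c x) = vscal (- c) x.
      by apply: functional_extensionality => i; rewrite /vopp /vscal; ring.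
    move=> t U Tt SU; rewrite mv_scal Rmult_assoc -vscalA; apply: leK_scal => //; [lra | exact: zU].
have T_id x : vscal 1 x = x.
  by apply: functional_extensionality => i; rewrite /vscal; ring.
exists v; split; last split; last split.
- split=> //; split; last split.
  (* The identity in [Sid 0] turns [v x = 0] into [x <= eps e] and [-x <= eps e] for all [eps];
     pointedness concludes. *)
  + move=> x vx.
    have small eps : 0 < eps -> exists2 m, m < eps & bounds rho x m.
      move=> e0; apply: NNPP => H; have : eps <= v x; last lra.
      by apply: (vP x).2 => m Bm; apply: Rnot_lt_le => me; apply: H; exists m.
    have le0 y : (y = x \/ y = vopp x) -> leK K y (vscal 0 e).
      move=> yE; apply: leK_scal_limit => // eps e0.
      have [m me [m0 [z [xz [xz' zU]]]]] := small _ e0.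
      exists m; first lra.
      have := zU 0 mid tm0 (or_intror (conj erefl erefl)).
      rewrite mv_mid rpow_0r Rmult_1_r => zm.
      by case: yE => ->; apply: leKt zm.
    case: (HK) => _ [_ [ptd _]]; apply: ptd.
      have -> : x = vsub (vscal 0 e) (vopp x).
        by apply: functional_extensionality => i; rewrite /vsub /vscal /vopp; ring.
      by apply: le0; right.
    have -> : vopp x = vsub (vscal 0 e) x.
      by apply: functional_extensionality => i; rewrite /vsub /vscal /vopp; ring.
    by apply: le0; left.
  + move=> c x; apply: Rle_antisym; first exact: v_scal.
    have [-> | cn] := Req_dec c 0; first by rewrite Rabs_R0 Rmult_0_l.
    have cp := Rabs_pos_lt _ cn.
    have := v_scal (/ c) (vscal c x); rewrite vscalA Rinv_l // T_id Rabs_inv => h.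
    apply: (Rmult_le_reg_l (/ Rabs c)); first exact: Rinv_0_lt_compat.
    rewrite -Rmult_assoc Rinv_l ?Rmult_1_l //; lra.
  + move=> x y; have : v (vadd x y) - v y <= v x; last lra.
    apply: (vP x).2 => m [m0 [z [xz [xz' zU]]]].
    have : v (vadd x y) - m <= v y; last lra.
    apply: (vP y).2 => m' [m'0 [z' [yz [yz' zU']]]].
    have : v (vadd x y) <= m + m'; last lra.
    apply: (vP _).1; split; first lra.
    exists (vadd z z'); split; first exact: leK_add.
    split.
      have -> : vopp (vadd x y) = vadd (vopp x) (vopp y); last exact: leK_add.
      by apply: functional_extensionality => i; rewrite /vopp /vadd; ring.
    move=> t U Tt SU; rewrite mv_add.
    have -> : vscal ((m + m') * rpow rho t) e =
        vadd (vscal (m * rpow rho t) e) (vscal (m' * rpow rho t) e).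
      by apply: functional_extensionality => i; rewrite /vscal /vadd; ring.
    by apply: leK_add => //; [apply: zU | apply: zU'].
(* From [0 <= y <= x], a majorant of [x] majorises [y], and also [-y] because [-y <= y]. *)
- move=> x y xy y0; apply: v_le => m [m0 [z [xz [xz' zU]]]]; split=> //; exists z.
  have yz : leK K y z by apply: leKt xz.
  split=> //; split=> //; apply: leKt yz; rewrite /leK.
  have -> : vsub y (vopp y) = vadd (vsub y vzero) (vsub y vzero).
    by apply: functional_extensionality => i; rewrite /vopp /vadd /vsub /vzero; ring.
  exact: Kadd.
(* [P z] majorises [P x] and [-P x], and [U P] belongs to [Sid (s + t)], whose bound at [z] contains
   the factor [rho ^ t]. *)
- move=> t P x Tt SP; apply: v_incl; first exact: rpow_ge0.
  move=> m [m0 [z [xz [xz' zU]]]]; split; first by apply: Rmult_le_pos => //; exact: rpow_ge0.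
  have KP := Sg_pos _ _ Tt SP.
  exists (mv P z); split; first exact: leK_mv; split.
    by rewrite -mv_opp; apply: leK_mv.
  move=> s U Ts SU; rewrite -mv_mmul.
  have -> : rpow rho t * m * rpow rho s = m * rpow rho (s + t).
    by rewrite rpow_add //; [ring | apply: tm_ge0 | apply: tm_ge0].
  by apply: zU; [apply: tm_add | apply: Sid_mul => //; left; apply: Sg_Slim].
(* Every common majorant of [x] and [-x] dominates [z], and [-z <= z]; so [x] and [z] have the same
   admissible majorants. *)
- move=> x z [zx [zx' zmin]].
  have z2 : leK K (vopp z) z.
    rewrite /leK; have -> : vsub z (vopp z) = vadd (vsub z x) (vsub z (vopp x)).
      by apply: functional_extensionality => i; rewrite /vopp /vadd /vsub; ring.
    exact: Kadd.
  apply: Rle_antisym; apply: v_le => m [m0 [w [h1 [h2 wU]]]]; split=> //; exists w.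
    by split; [apply: leKt h1 | split=> //; apply: leKt h1].
  have zw : leK K z w by apply: zmin.
  by split=> //; split=> //; apply: leKt zw.
Qed.

End AbstractFamily.

Theorem family_extremal_norm n (K : vec n -> Prop) time Sg : proper_cone n K ->
  family_axioms n time Sg -> (forall t P, time t -> Sg t P -> in_piK n K P) ->
  K_irreducible_sg n K time Sg ->
  exists rho, is_jsr n time Sg rho /\ exists v, is_norm n v /\ monotone n K v /\
    extremal n time Sg rho v /\ absolute n K v.
Proof.
move=> HK fam pos [t0 [A0 [Tt0 [t00 [cA iA]]]]].
have [e [ce [Ke [ce0 He]]]] := order_unit n K HK.
have gex := growth_exists n K time Sg HK fam e ce Ke ce0 He.
(* Outside [time] the value of [f] is a default 0. *)
have /choice_fun [f fP] : forall t, exists m, time t -> is_growth n K Sg e t m.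
  by move=> t; have [/gex [m mP] | nT] := classic (time t); [exists m | exists 0].
have fge := f_ge0 n K time Sg e f fP.
have fsub := f_sub n K time Sg HK fam pos e f fP.
have [c c0 fsup] := f_sup n K time Sg HK fam pos t0 A0 Tt0 cA iA e ce Ke ce0 He f fP.
have floc := f_loc n K time Sg HK fam e ce Ke ce0 He f fP.
have [rho [C [r0 [C0 rP]]]] := growth_rate time f c t0 (fam_time0 _ _ _ fam)
  (fam_time_ge0 _ _ _ fam) (fam_time_add _ _ _ fam) (fam_time_sub _ _ _ fam)
  Tt0 t00 fge fsub c0 fsup floc.
exists rho; split.
  exact: (family_jsr n K time Sg HK fam pos t0 A0 Tt0 t00 cA e ce Ke ce0 He f fP rho C).
apply: (family_norm n K time Sg HK fam pos e ce Ke ce0 He f fP rho C) => // t Tt.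
exact: (rP t Tt).1.
Qed.

(** * Discrete time and matrix exponentials *)

Section Discrete.
Variable n : nat.
Local Notation mat := (mat n).
Arguments mid {n}. Arguments mmul {n}. Arguments mn {n}. Arguments msub {n}.
Variable M : mat -> Prop.

Lemma S_disc_mul k l Q U : S_disc n M k Q -> S_disc n M l U -> S_disc n M (k + l) (mmul Q U).
Proof.
elim: k Q => [|k IH] Q /=; first by move=> -> SU; rewrite mmul1m.
by move=> [A [Q' [MA [SQ ->]]]] SU; exists A, (mmul Q' U); rewrite mmulA; split=> //; split=> //; apply: IH.
Qed.

Lemma S_disc_split k l P : S_disc n M (k + l) P ->
  exists Q U, S_disc n M k Q /\ S_disc n M l U /\ P = mmul Q U.
Proof.
elim: k P => [|k IH] P /=; first by move=> SP; exists mid, P; rewrite mmul1m.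
move=> [A [P' [MA [/IH [Q [U [SQ [SU ->]]]] ->]]]].
by exists (mmul A Q), U; split; [exists A, Q | rewrite mmulA].
Qed.

(** The base [1 + c] instead of [c] makes the bound increase with [k], so one value serves all times
    up to [T]. *)
Lemma S_disc_bound c : (forall A, M A -> mn A <= c) -> 0 <= c ->
  forall k P, S_disc n M k P -> mn P <= (1 + c) ^ k * mn (mid : mat).
Proof.
move=> Mc c0; elim=> [|k IH] P /=; first by move=> ->; lra.
move=> [A [Q [/Mc MA [/IH SQ ->]]]]; apply: Rle_trans (mn_mmul _ _ _) _.
have := mn_ge0 n A; have := mn_ge0 n Q; nra.
Qed.

Lemma family_disc (time : R -> Prop) (Sg : R -> mat -> Prop) : compact_mat n M ->
  (forall t, time t <-> exists k : nat, t = INR k) ->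
  (forall (k : nat) P, Sg (INR k) P <-> S_disc n M k P) -> family_axioms n time Sg.
Proof.
move=> [_ [c cP]] tE SE; split.
- by apply/tE; exists 0%N.
- by move=> t /tE [k ->]; apply: pos_INR.
- by move=> s t /tE [k ->] /tE [l ->]; apply/tE; exists (k + l)%N; rewrite -plus_INR.
- move=> s t /tE [k ->] /tE [l ->] /INR_le kl; apply/tE; exists (l - k)%N.
  by rewrite -minus_INR.
- move=> s t P /tE [k ->] /tE [l ->]; rewrite -plus_INR => /SE /S_disc_split [Q [U [SQ [SU ->]]]].
  by exists Q, U; split; [apply/SE | split=> //; apply/SE].
- move=> s t Q U eps /tE [k ->] /tE [l ->] /SE SQ /SE SU e0; exists 0, (mmul Q U).
  split; first by apply/tE; exists 0%N.
  split; first lra; split; last by rewrite mn_sub_self.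
  by rewrite Rplus_0_r -plus_INR; apply/SE; apply: S_disc_mul.
- move=> T; set c' := INR n * (INR n * Rmax 0 c).
  have c'0 : 0 <= c'.
    by apply: Rmult_le_pos; [exact: pos_INR | apply: Rmult_le_pos; [exact: pos_INR | exact: Rmax_l]].
  have Mc A : M A -> mn A <= c'.
    move=> MA; apply: mn_le_entries => i j; apply: Rle_trans (entry_le_frob _ _ _ _) _.
    by apply: Rle_trans (cP _ MA) (Rmax_r _ _).
  have [N NT] := INR_unbounded T; exists ((1 + c') ^ N * mn (mid : mat)).
  move=> t P /tE [k ->] kT /SE SP; apply: Rle_trans (S_disc_bound c' Mc c'0 _ _ SP) _.
  apply: Rmult_le_compat_r; first exact: mn_ge0.
  by apply: Rle_pow; [lra | apply: INR_le; lra].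
Qed.

End Discrete.

Lemma is_series_exp x : is_series (fun m => x ^ m / INR (Factorial.fact m)) (exp x).
Proof.
apply: (is_series_ext (fun m => / INR (Factorial.fact m) * x ^ m)); first by move=> m; rewrite Rmult_comm.
by apply/is_series_Reals; rewrite /exp; case: (exist_exp x).
Qed.

Lemma series_exp_bound (a : nat -> R) l c x : is_series a l ->
  (forall m, Rabs (a m) <= c * (x ^ m / INR (Factorial.fact m))) -> Rabs l <= c * exp x.
Proof.
move=> al ac.
have ec : is_series (fun m => c * (x ^ m / INR (Factorial.fact m))) (c * exp x).
  exact: (is_series_scal c _ _ (is_series_exp x)).
have ea : ex_series (fun m => Rabs (a m)).
  apply: (ex_series_le _ (fun m => c * (x ^ m / INR (Factorial.fact m)))); last by exists (c * exp x).
  by move=> m; rewrite /norm /= /abs /= Rabs_Rabsolu.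
rewrite -(is_series_unique _ _ al) -(is_series_unique _ _ ec).
apply: Rle_trans (Series_Rabs _ ea) _; apply: Series_le; last by exists (c * exp x).
by move=> m; split; [apply: Rabs_pos | apply: ac].
Qed.

(** * The matrix exponential as an entrywise series *)

Section MatrixExp.
Variable n : nat.
Local Notation mat := (mat n).
Arguments sumI {n}. Arguments mid {n}. Arguments mmul {n}. Arguments mn {n}.
Arguments msub {n}. Arguments mscal {n}. Arguments mpow {n}. Arguments is_mexp {n}.
Implicit Types (A E F P : mat).

Definition exp_term A i j (m : nat) : R := mpow A m i j / INR (Factorial.fact m).

Lemma is_mexpE A E : is_mexp A E <-> forall i j, is_series (exp_term A i j) (E i j).
Proof. by split=> H i j; apply/is_series_Reals; apply: H. Qed.

Lemma mpow_entry A m i j : Rabs (mpow A m i j) <= mn A ^ m.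
Proof.
elim: m i j => [|m IH] i j /=.
  by rewrite /mid; case: (i == j); rewrite ?Rabs_R1 ?Rabs_R0; lra.
rewrite /mmul; apply: Rle_trans (sumI_abs _ _) _.
apply: (Rle_trans _ (sumI (fun k => Rabs (A i k) * mn A ^ m))).
  apply: sumI_le => k; rewrite Rabs_mult.
  by apply: Rmult_le_compat_l; [apply: Rabs_pos | apply: IH].
rewrite sumI_scalr; apply: Rmult_le_compat_r; first by apply: pow_le; apply: mn_ge0.
apply: (sumI_term n (fun i => sumI (fun j => Rabs (A i j)))) => k.
by apply: sumI_ge0 => l; apply: Rabs_pos.
Qed.

Lemma exp_term_bound A i j m :
  Rabs (exp_term A i j m) <= 1 * (mn A ^ m / INR (Factorial.fact m)).
Proof.
have f0 := INR_fact_lt_0 m.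
rewrite Rmult_1_l /exp_term Rabs_div; last lra.
rewrite (Rabs_pos_eq (INR _)); last lra.
apply: Rmult_le_compat_r; first by apply: Rlt_le; apply: Rinv_0_lt_compat.
exact: mpow_entry.
Qed.

Lemma exp_term_abs A i j : ex_series (fun m => Rabs (exp_term A i j m)).
Proof.
apply: (ex_series_le _ (fun m => mn A ^ m / INR (Factorial.fact m))); last first.
  by exists (exp (mn A)); apply: is_series_exp.
by move=> m; rewrite /norm /= /abs /= Rabs_Rabsolu; have := exp_term_bound A i j m; lra.
Qed.

Lemma mexp_ex A : exists E, is_mexp A E.
Proof.
exists (fun i j => Series (exp_term A i j)); apply/is_mexpE => i j.
by apply: Series_correct; apply: ex_series_Rabs; apply: exp_term_abs.
Qed.

Lemma mexp_unique A E F : is_mexp A E -> is_mexp A F -> E = F.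
Proof.
move=> /is_mexpE HE /is_mexpE HF; apply: mat_ext => i j.
by rewrite -(is_series_unique _ _ (HE i j)) -(is_series_unique _ _ (HF i j)).
Qed.

Lemma mexp_bound A E : is_mexp A E -> mn E <= INR n * (INR n * exp (mn A)).
Proof.
move=> /is_mexpE HE; apply: mn_le_entries => i j.
by rewrite -(Rmult_1_l (exp _)); apply: series_exp_bound (HE i j) (exp_term_bound A i j).
Qed.

Lemma mpow_mscal a A m i j : mpow (mscal a A) m i j = a ^ m * mpow A m i j.
Proof.
elim: m i j => [|m IH] i j /=; first by ring.
rewrite /mmul -sumI_scal; apply: sumI_ext => k; rewrite IH /mscal; ring.
Qed.

Lemma mpow_add A m l : mpow A (m + l) = mmul (mpow A m) (mpow A l).
Proof. by elim: m => [|m IH]; rewrite ?mmul1m // addSn /= IH mmulA. Qed.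

Lemma is_series_sumI (u : 'I_n -> nat -> R) (l : 'I_n -> R) :
  (forall k, is_series (u k) (l k)) -> is_series (fun m => sumI (fun k => u k m)) (sumI l).
Proof.
move=> H; rewrite /sumI; elim: (enum _) => /= [|k s IH].
  apply/is_series_Reals => eps e0; exists 0%N => N _.
  by rewrite sum_eq_R0 // /Rdist Rminus_diag Rabs_R0.
exact: (is_series_plus _ _ _ _ (H k) IH).
Qed.

Lemma sumI_sum_f_R0 (u : 'I_n -> nat -> R) N :
  sumI (fun k => sum_f_R0 (u k) N) = sum_f_R0 (fun m => sumI (fun k => u k m)) N.
Proof. by elim: N => [|N IH] //=; rewrite sumI_add IH. Qed.

(** The Cauchy product of the entry series, legitimate by absolute convergence, has the binomial
    expansion of [(a + b)^N A^N / N!] as its term of order [N]. *)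
Lemma mexp_add a b A E F : is_mexp (mscal a A) E -> is_mexp (mscal b A) F ->
  is_mexp (mscal (a + b) A) (mmul E F).
Proof.
move=> /is_mexpE HE /is_mexpE HF; apply/is_mexpE => i j; rewrite /mmul.
have H k := is_series_mult _ _ _ _ (HE i k) (HF k j) (exp_term_abs _ i k) (exp_term_abs _ k j).
apply: is_series_ext (is_series_sumI _ _ H) => N.
rewrite sumI_sum_f_R0 /exp_term mpow_mscal binomial /Rdiv Rmult_assoc.
rewrite [RHS]Rmult_comm scal_sum; apply: PartSum.sum_eq => m mN.
rewrite /Binomial.C.
have -> : mpow A N = mmul (mpow A m) (mpow A (N - m)%coq_nat).
  by rewrite -mpow_add; congr mpow; lia.
rewrite /mmul.
have fN := INR_fact_neq_0 N; have fm := INR_fact_neq_0 m; have fl := INR_fact_neq_0 (N - m)%coq_nat.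
set S1 := sumI (fun k => mpow A m i k * mpow A (N - m)%coq_nat k j).
have -> : sumI (fun k => mpow (mscal a A) m i k * / INR (Factorial.fact m) *
     (mpow (mscal b A) (N - m)%coq_nat k j * / INR (Factorial.fact (N - m)%coq_nat)))
   = a ^ m / INR (Factorial.fact m) * (b ^ (N - m)%coq_nat / INR (Factorial.fact (N - m)%coq_nat)) * S1.
  rewrite /S1 -sumI_scal; apply: sumI_ext => k; rewrite !mpow_mscal; field; split; assumption.
by field; repeat split; assumption.
Qed.

Lemma mexp_0 A : is_mexp (mscal 0 A) mid.
Proof.
apply/is_mexpE => i j; apply/is_series_Reals => eps e0; exists 0%N => N _.
suff -> : sum_f_R0 (exp_term (mscal 0 A) i j) N = mid i j by rewrite /Rdist Rminus_diag Rabs_R0.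
elim: N => [|N IH] /=; first by rewrite /exp_term /= Rdiv_1_r.
by rewrite IH /exp_term mpow_mscal pow_i; [field; exact: INR_fact_neq_0 | lia].
Qed.

Lemma mexp_inv a A E F : is_mexp (mscal a A) E -> is_mexp (mscal (- a) A) F -> mmul F E = mid.
Proof.
move=> HE HF; apply: (mexp_unique (mscal 0 A)); last exact: mexp_0.
by have := mexp_add _ _ _ _ _ HF HE; rewrite Rplus_opp_l.
Qed.

Lemma mpow_comm A P m : mmul A P = mmul P A -> mmul (mpow A m) P = mmul P (mpow A m).
Proof.
move=> AP; elim: m => [|m IH]; first by rewrite /= mmul1m mmulm1.
by rewrite /= -mmulA IH !mmulA AP.
Qed.

Lemma mexp_comm a A E P : mmul A P = mmul P A -> is_mexp (mscal a A) E -> mmul E P = mmul P E.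
Proof.
move=> AP /is_mexpE HE; apply: mat_ext => i j.
have H1 : is_series (fun m => sumI (fun k => P k j * exp_term (mscal a A) i k m))
                    (sumI (fun k => P k j * E i k)).
  by apply: is_series_sumI => k; apply: (is_series_scal (P k j)); apply: HE.
have H2 : is_series (fun m => sumI (fun k => P i k * exp_term (mscal a A) k j m))
                    (sumI (fun k => P i k * E k j)).
  by apply: is_series_sumI => k; apply: (is_series_scal (P i k)); apply: HE.
rewrite /mmul -(is_series_unique _ _ H2).
rewrite (sumI_ext _ _ (fun k => P k j * E i k)); last by move=> k; ring.
rewrite -(is_series_unique _ _ H1); apply: Series_ext => m.
have /(f_equal (fun B : mat => a ^ m / INR (Factorial.fact m) * B i j)) := mpow_comm A P m AP.
rewrite /mmul -!sumI_scal => H.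
transitivity (sumI (fun k => a ^ m / INR (Factorial.fact m) * (mpow A m i k * P k j))).
  by apply: sumI_ext => k; rewrite /exp_term mpow_mscal; field; exact: INR_fact_neq_0.
by rewrite H; apply: sumI_ext => k; rewrite /exp_term mpow_mscal; field; exact: INR_fact_neq_0.
Qed.

(** The term of order [m] of [exp (d A) - I] carries the factor [d^m - 0^m], which is 0 for [m = 0]
    and at most [d] otherwise. *)
Lemma mexp_near d A E : 0 <= d <= 1 -> is_mexp (mscal d A) E ->
  mn (msub E mid) <= INR n * (INR n * (d * exp (mn A))).
Proof.
move=> [d0 d1] /is_mexpE HE; apply: mn_le_entries => i j.
have /is_mexpE H0 := mexp_0 A.
have H : is_series (fun m => (d ^ m - 0 ^ m) * exp_term A i j m) (msub E mid i j).
  apply: is_series_ext (is_series_minus _ _ _ _ (HE i j) (H0 i j)) => m.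
  by rewrite /plus /opp /= /exp_term !mpow_mscal; field; exact: INR_fact_neq_0.
apply: series_exp_bound H _ => m.
rewrite Rabs_mult; apply: Rmult_le_compat; try exact: Rabs_pos; last first.
  by have := exp_term_bound A i j m; lra.
case: m => [|m]; first by rewrite /= Rminus_diag Rabs_R0.
rewrite pow_i; last lia.
rewrite Rminus_0_r Rabs_pos_eq; last exact: pow_le.
have : d ^ m <= 1 by rewrite -(pow1 m); apply: pow_incr.
have := pow_le d m d0; rewrite /=; nra.
Qed.

End MatrixExp.

(** * Jump systems *)

Section Jump.
Variable n : nat.
Local Notation mat := (mat n).
Arguments mid {n}. Arguments mmul {n}. Arguments mn {n}.
Arguments msub {n}. Arguments mscal {n}. Arguments is_mexp {n}. Arguments jump_prod {n}.
Implicit Types (A E F P Q : mat) (tt : nat -> R) (p : nat -> mat * mat).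

Lemma jump_prod_ex tt p k : exists Q, jump_prod tt p k Q.
Proof.
elim: k => [|k [Q HQ]]; first by exists mid.
have [E HE] := mexp_ex n (mscal (tt k.+1 - tt k) (p k).1).
by exists (mmul E (mmul (p k).2 Q)), E, Q.
Qed.

Lemma jump_prod_unique tt p k Q Q' : jump_prod tt p k Q -> jump_prod tt p k Q' -> Q = Q'.
Proof.
elim: k Q Q' => [|k IH] Q Q' /=; first by move=> -> ->.
move=> [E [Q1 [HE [HQ1 ->]]]] [E' [Q1' [HE' [HQ1' ->]]]].
by rewrite (mexp_unique _ _ _ _ HE HE') (IH _ _ HQ1 HQ1').
Qed.

Lemma jump_prod_ext tt p tt' p' k Q : (forall j, (j <= k)%N -> tt j = tt' j) ->
  (forall j, (j < k)%N -> p j = p' j) -> jump_prod tt p k Q -> jump_prod tt' p' k Q.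
Proof.
elim: k Q => [|k IH] Q //= Ht Hp [E [Q' [HE [HQ ->]]]].
exists E, Q'; rewrite -!Ht // -Hp //; split=> //; split=> //.
by apply: IH HQ => j jk; [apply: Ht | apply: Hp]; lia.
Qed.

Lemma switching_le tt i j : valid_switching tt -> (i <= j)%N -> tt i <= tt j.
Proof.
move=> [_ [H _]]; elim: j => [|j IH]; first by rewrite leqn0 => /eqP ->; lra.
rewrite leq_eqVlt => /orP [/eqP -> | ij]; first lra.
by apply: Rle_trans (IH ij) _; apply: Rlt_le.
Qed.

Lemma switching_locate tt t : valid_switching tt -> 0 <= t -> exists j, tt j <= t < tt j.+1.
Proof.
move=> [H0 [_ Hb]] t0; apply: NNPP => H.
have H' j : tt j <= t.
  elim: j => [|j IH]; first by rewrite H0.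
  by apply: Rnot_lt_le => h; apply: H; exists j.
by have [j] := Hb t; have := H' j; lra.
Qed.

Variable M : mat * mat -> Prop.

(** If [t] is a switching time of the run of [U], its last mode would occupy an empty interval after
    concatenation. Prolonging that mode by [d > 0] makes the run admissible; [E] is the resulting
    extra flow. *)
Lemma S_jump_join s t Q U : 0 <= s -> 0 <= t -> S_jump n M s Q -> S_jump n M t U ->
  exists A, forall d E, 0 < d -> is_mexp (mscal d A) E -> S_jump n M (s + t + d) (mmul Q (mmul E U)).
Proof.
move=> s0 t0 [tt' [p' [k' [E' [Q' [vt' [Mp' [k's [HE' [HQ' ->]]]]]]]]]].
move=> [tt [p [k [E1 [Q1 [vt [Mp [kt [HE1 [HQ1 ->]]]]]]]]]].
exists (p k).1 => d E d0 HE.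
pose tu j := if (j <= k)%N then tt j else t + d + tt' (j - k.+1)%N.
pose pu j := if (j <= k)%N then p j else p' (j - k.+1)%N.
have tuR j : tu (k.+1 + j)%N = t + d + tt' j.
  by rewrite /tu ifF; [congr (_ + tt' _); lia | lia].
have puR j : pu (k.+1 + j)%N = p' j.
  by rewrite /pu ifF; [congr (p' _); lia | lia].
have tuL j : (j <= k)%N -> tu j = tt j by rewrite /tu => ->.
have puL j : (j <= k)%N -> pu j = p j by rewrite /pu => ->.
have vu : valid_switching tu.
  case: (vt) => h0 [h1 h2]; case: (vt') => h0' [h1' h2']; split; first by rewrite tuL.
  split.
    move=> j; have [jk | kj] := leqP j.+1 k; first by rewrite !tuL; [apply: h1 | lia | lia].
    have [-> | jk] := eqVneq j k.
      by rewrite tuL // -(addn0 k.+1) tuR h0'; lra.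
    have -> : j = (k.+1 + (j - k.+1))%N by lia.
    by rewrite -addnS !tuR; have := h1' (j - k.+1)%N; lra.
  by move=> B; have [j hj] := h2' B; exists (k.+1 + j)%N; rewrite tuR; lra.
set P1 := mmul (mmul E E1) (mmul (p k).2 Q1).
have J1 j R' : jump_prod tt' p' j R' -> jump_prod tu pu (k.+1 + j) (mmul R' P1).
  elim: j R' => [|j IH] R'.
    move=> ->; rewrite addn0 mmul1m; exists (mmul E E1), Q1; split; last first.
      rewrite puL //; split=> //; apply: jump_prod_ext HQ1 => j jk; first by rewrite tuL.
      by rewrite puL // ltnW.
    rewrite puL // (tuL k) //.
    have -> : tu k.+1 - tt k = d + (t - tt k).
      by rewrite -(addn0 k.+1) tuR; case: vt' => -> _; ring.
    exact: mexp_add.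
  move=> [F [R1 [HF [HR1 ->]]]]; rewrite addnS; exists F, (mmul R1 P1); split; last first.
    by split; [apply: IH | rewrite puR !mmulA].
  rewrite puR -addnS !tuR.
  by have -> : t + d + tt' j.+1 - (t + d + tt' j) = tt' j.+1 - tt' j by ring.
exists tu, pu, (k.+1 + k')%N, E', (mmul Q' P1); split=> //; split.
  by move=> j; rewrite /pu; case: ifP.
split; first by rewrite -addnS !tuR; lra.
split; first by rewrite tuR puR; have -> : s + t + d - (t + d + tt' k') = s - tt' k' by ring.
split; first exact: J1.
by rewrite puR /P1 !mmulA.
Qed.

(** The last mode is kept active until [T] and later switches are postponed. Since [E] is
    invertible, a bound on S_T will control all earlier times. *)
Lemma S_jump_extend r T P : 0 <= r <= T -> S_jump n M r P ->
  exists A Pi E, M (A, Pi) /\ is_mexp (mscal (T - r) A) E /\ S_jump n M T (mmul E P).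
Proof.
move=> [r0 rT] [tt [p [k [E1 [Q1 [vt [Mp [kt [HE1 [HQ1 ->]]]]]]]]]].
have [E HE] := mexp_ex n (mscal (T - r) (p k).1).
exists (p k).1, (p k).2, E; split; first by have := Mp k; case: (p k).
split=> //.
pose tu j := if (j <= k)%N then tt j else tt j + (T - r).
exists tu, p, k, (mmul E E1), Q1; split.
  case: (vt) => h0 [h1 h2]; split=> //; split.
    move=> j; rewrite /tu; have := h1 j; have [a | a] := leqP j k; have [b | b] := leqP j.+1 k; lra || lia.
  move=> B; have [j hj] := h2 B; exists j; rewrite /tu; case: ifP; lra.
split=> //; split; first by rewrite /tu leqnn ltnn; lra.
split.
  rewrite /tu leqnn; have -> : T - tt k = T - r + (r - tt k) by ring.
  exact: mexp_add.
split; last by rewrite !mmulA.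
by apply: jump_prod_ext HQ1 => j jk //; rewrite /tu jk.
Qed.

Hypothesis M_proj : forall A Pi, M (A, Pi) -> mmul Pi Pi = Pi /\ mmul A Pi = mmul Pi A.

Lemma S_jump_split s t P : 0 <= s -> 0 <= t -> S_jump n M (s + t) P ->
  exists Q U, S_jump n M s Q /\ S_jump n M t U /\ P = mmul Q U.
Proof.
move=> s0 t0 [tt [p [k [E1 [Q1 [vt [Mp [kt [HE1 [HQ1 ->]]]]]]]]]].
have [j jt] := switching_locate tt t vt t0.
have jk : (j <= k)%N.
  rewrite leqNgt; apply/negP => kj; have := switching_le tt k.+1 j vt kj; lra.
have [Qj HQj] := jump_prod_ex tt p j.
have [Ej HEj] := mexp_ex n (mscal (t - tt j) (p j).1).
set U := mmul Ej (mmul (p j).2 Qj).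
have SU : S_jump n M t U by exists tt, p, j, Ej, Qj.
(* The second run starts at [t], inside interval [j]: mode [p j] again, with 0 in place of the
   negative or zero [tt j - t], then the remaining switching times shifted by [t]. *)
pose tu i := if i is 0%N then 0 else tt (j + i)%N - t.
pose pu i := p (j + i)%N.
have vu : valid_switching tu.
  case: (vt) => h0 [h1 h2]; split=> //; split.
    case=> [|i] /=; first by rewrite addn1; lra.
    by rewrite (addnS j i.+1); have := h1 (j + i.+1)%N; lra.
  move=> B; have [i hi] := h2 (B + t); exists i.+1; rewrite /tu.
  by have := switching_le tt i (j + i.+1)%N vt ltac:(lia); lra.
have [Pj2 Pjc] : mmul (p j).2 (p j).2 = (p j).2 /\ mmul (p j).1 (p j).2 = mmul (p j).2 (p j).1.
  by have := Mp j; case: (p j) => A Pi; apply: M_proj.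
(* The projection of the interrupted interval is applied a second time at restart,
   which is harmless since it is idempotent and commutes with the flow. *)
have restart u F G : is_mexp (mscal (u - t) (p j).1) F -> is_mexp (mscal (u - tt j) (p j).1) G ->
    mmul G (mmul (p j).2 Qj) = mmul F (mmul (p j).2 U).
  move=> HF HG.
  have -> : G = mmul F Ej.
    apply: mexp_unique HG _; have -> : u - tt j = u - t + (t - tt j) by ring.
    exact: mexp_add.
  rewrite /U (mmulA _ _ Ej) -(mexp_comm _ _ _ _ _ Pjc HEj) -!mmulA; congr (mmul F (mmul Ej _)).
  by rewrite mmulA Pj2.
have J i R' : jump_prod tt p (j + i.+1) R' -> exists R1, jump_prod tu pu i.+1 R1 /\ R' = mmul R1 U.
  elim: i R' => [|i IH] R'.
    rewrite addn1 /= => -[G [Q' [HG [HQ' ->]]]].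
    rewrite (jump_prod_unique _ _ _ _ _ HQ' HQj).
    have [F HF] := mexp_ex n (mscal (tt j.+1 - t) (p j).1).
    exists (mmul F (mmul (p j).2 mid)); split; last first.
      by rewrite (restart _ _ _ HF HG) mmulm1 mmulA.
    by exists F, mid; rewrite /pu addn0 addn1 Rminus_0_r.
  rewrite addnS /= => -[G [Q' [HG [/IH [R1 [HR1 ->]] ->]]]].
  exists (mmul G (mmul (p (j + i.+1)%N).2 R1)); split; last by rewrite !mmulA.
  exists G, R1; split=> //; rewrite /pu.
  have -> : tt (j + i.+2)%N - t - (tt (j + i.+1)%N - t) = tt (j + i.+2)%N - tt (j + i.+1)%N by ring.
  by rewrite (addnS j i.+1).
have [kj | kj] := eqVneq k j.
  rewrite kj in kt HE1 HQ1 *; rewrite (jump_prod_unique _ _ _ _ _ HQ1 HQj).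
  have [F HF] := mexp_ex n (mscal s (p j).1).
  exists (mmul F (mmul (p j).2 mid)), U; split; last first.
    split=> //; rewrite mmulm1 -mmulA; apply: restart HE1.
    by have -> : s + t - t = s by ring.
  exists tu, pu, 0%N, F, mid; rewrite /pu /tu addn0 addn1 Rminus_0_r; split=> //.
  by split=> [i|]; [exact: Mp | split=> //; lra].
pose i := (k - j.+1)%N; have kE : k = (j + i.+1)%N by rewrite /i; lia.
rewrite kE in kt HE1 HQ1 *; have [R1 [HR1 ->]] := J _ _ HQ1.
exists (mmul E1 (mmul (p (j + i.+1)%N).2 R1)), U; split; last by rewrite !mmulA.
exists tu, pu, i.+1, E1, R1; split=> //; split=> [l|]; first exact: Mp.
split; first by rewrite /tu (addnS j i.+1); lra.
split=> //.
rewrite /tu /pu; have -> // : s - (tt (j + i.+1)%N - t) = s + t - tt (j + i.+1)%N by ring.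
Qed.

Lemma family_jump (time : R -> Prop) (Sg : R -> mat -> Prop) : compact_pairs n M ->
  (forall t, time t <-> 0 <= t) -> (forall t P, 0 <= t -> (Sg t P <-> S_jump n M t P)) ->
  (forall t, 0 <= t -> exists c, forall P, Sg t P -> frob n P <= c) -> family_axioms n time Sg.
Proof.
move=> [_ [c cP]] tE SE Sb; split.
- by apply/tE; lra.
- by move=> t /tE.
- by move=> s t /tE s0 /tE t0; apply/tE; lra.
- by move=> s t /tE s0 /tE t0 st; apply/tE; lra.
- move=> s t P /tE s0 /tE t0 /SE SP.
  have [|Q [U [SQ [SU ->]]]] := S_jump_split s t P s0 t0 (SP _); first lra.
  by exists Q, U; split; [apply/SE | split=> //; apply/SE].
- move=> s t Q U eps /tE s0 /tE t0 /(SE _ _ s0) SQ /(SE _ _ t0) SU e0.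
  have [A HA] := S_jump_join s t Q U s0 t0 SQ SU.
  (* The error [Q (E - I) U] is at most [d * (B - 1)]; [B >= 1] also keeps [d] below [eps]. *)
  set B := mn Q * (INR n * (INR n * exp (mn A))) * mn U + 1.
  have B1 : 1 <= B.
    have : 0 <= mn Q * (INR n * (INR n * exp (mn A))) * mn U; last by rewrite /B; lra.
    have ? := mn_ge0 n Q; have ? := mn_ge0 n U; have ? := pos_INR n; have ? := exp_pos (mn A).
    by apply: Rmult_le_pos => //; apply: Rmult_le_pos => //; apply: Rmult_le_pos => //; nra.
  set d := Rmin 1 (eps / (2 * B)).
  have q0 : 0 < eps / (2 * B) by apply: Rdiv_lt_0_compat; lra.
  have d0 : 0 < d by apply: Rmin_glb_lt; lra.
  have d1 : d <= 1 := Rmin_l _ _.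
  have dB : d * B <= eps / 2.
    have -> : eps / 2 = eps / (2 * B) * B by field; lra.
    by apply: Rmult_le_compat_r; [lra | exact: Rmin_r].
  have [E HE] := mexp_ex n (mscal d A).
  exists d, (mmul Q (mmul E U)); split; first by apply/tE; lra.
  split; first nra.
  split; first by apply/SE; [lra | exact: HA].
  rewrite mn_sub_sym -mmul_msubr -{2}[U]mmul1m -mmul_msubl.
  apply: Rle_lt_trans (mn_mmul _ _ _) _.
  have h1 := mn_mmul n (msub E mid) U; have h2 := mexp_near n d A E ltac:(lra) HE.
  have Q0 := mn_ge0 n Q; have U0 := mn_ge0 n U.
  apply: (Rle_lt_trans _ (mn Q * (INR n * (INR n * (d * exp (mn A))) * mn U))).
    apply: Rmult_le_compat_l => //; apply: Rle_trans h1 _; exact: Rmult_le_compat_r.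
  have -> : mn Q * (INR n * (INR n * (d * exp (mn A))) * mn U) = d * (B - 1) by rewrite /B; ring.
  nra.
- move=> T; have [T0 | T0] := Rle_dec 0 T; last first.
    by exists 0 => t P /tE t0 tT; lra.
  (* The bound at the single time [T] serves all [t <= T]: [P = F (E P)] with [E P] in S_T and [F]
     the exponential over time [t - T], which is bounded through [a]. *)
  have [b bP] := Sb T T0.
  pose a := INR n * (INR n * Rmax 0 c).
  have a0 : 0 <= a.
    by apply: Rmult_le_pos; [exact: pos_INR | apply: Rmult_le_pos; [exact: pos_INR | exact: Rmax_l]].
  exists (INR n * (INR n * exp (T * a)) * (INR n * (INR n * b))).
  move=> t P /tE t0 tT /(SE _ _ t0) SP.
  have [A [Pi [E [MA [HE SE']]]]] := S_jump_extend t T P (conj t0 tT) SP.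
  have [F HF] := mexp_ex n (mscal (- (T - t)) A).
  have -> : P = mmul F (mmul E P) by rewrite mmulA (mexp_inv _ _ _ _ _ HE HF) mmul1m.
  apply: Rle_trans (mn_mmul _ _ _) _.
  apply: Rmult_le_compat; [exact: mn_ge0 | exact: mn_ge0 | | ].
    apply: Rle_trans (mexp_bound _ _ _ HF) _.
    do 2 (apply: Rmult_le_compat_l; first exact: pos_INR).
    apply: exp_le_compat.
    have mA : mn A <= a.
      apply: Rle_trans (mn_le_frob _ _) _.
      do 2 (apply: Rmult_le_compat_l; first exact: pos_INR).
      apply: Rle_trans (Rmax_r _ _); have := cP _ _ MA; have := frob_ge0 n Pi; lra.
    have -> : mn (mscal (- (T - t)) A) = (T - t) * mn A.
      rewrite /mn -sumI_scal; apply: sumI_ext => i; rewrite -sumI_scal; apply: sumI_ext => j.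
      by rewrite /mscal Rabs_mult Rabs_Ropp (Rabs_pos_eq (T - t)); lra.
    by have := mn_ge0 n A; nra.
  apply: Rle_trans (mn_le_frob _ _) _.
  do 2 (apply: Rmult_le_compat_l; first exact: pos_INR).
  by apply: bP; apply/SE.
Qed.

End Jump.

(** * Null sets and absolutely continuous functions *)

Lemma small_cover_sub (E F : R -> Prop) eps :
  (forall x, E x -> F x) -> small_cover F eps -> small_cover E eps.
Proof.
by move=> EF [a [b [l [ab [cov sl]]]]]; exists a, b, l; split=> //; split=> // x /EF /cov.
Qed.

Lemma small_cover_interval p q eps : p <= q -> q - p < eps ->
  small_cover (fun x => p < x < q) eps.
Proof.
move=> pq qe; exists (fun k => if k is 0%N then p else 0), (fun k => if k is 0%N then q else 0), (q - p).
split; first by case=> [|k] //; lra.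
split; first by move=> x px; exists 0%N.
split=> // e0 e0p; exists 0%N => N _.
suff -> : sum_f_R0 (fun k => (if k is 0%N then q else 0) - (if k is 0%N then p else 0)) N = q - p.
  by rewrite /Rdist Rminus_diag Rabs_R0.
by elim: N => [|N IH] //=; rewrite IH; ring.
Qed.

Lemma small_cover_shift (E : R -> Prop) h eps :
  small_cover E eps -> small_cover (fun x => E (x + h)) eps.
Proof.
move=> [a [b [l [ab [cov [sl le]]]]]]; exists (fun k => a k - h), (fun k => b k - h), l.
split; first by move=> k; have := ab k; lra.
split; first by move=> x /cov [k kP]; exists k; lra.
split=> //; move=> e0 e0p; have [N HN] := sl _ e0p; exists N => m mN.
rewrite (PartSum.sum_eq _ (fun k => b k - a k)); first exact: HN.
by move=> k _; ring.
Qed.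

(** The two covers are interleaved by parity. Partial sums increase and at odd indices split into
    partial sums of both covers, so they converge to at most [l1 + l2]. *)
Lemma small_cover_union (E F : R -> Prop) e1 e2 : small_cover E e1 -> small_cover F e2 ->
  small_cover (fun x => E x \/ F x) (e1 + e2).
Proof.
move=> [a1 [b1 [l1 [ab1 [cov1 [sl1 le1]]]]]] [a2 [b2 [l2 [ab2 [cov2 [sl2 le2]]]]]].
pose a k := if odd k then a2 k./2 else a1 k./2.
pose b k := if odd k then b2 k./2 else b1 k./2.
have ab k : a k <= b k by rewrite /a /b; case: odd.
pose S N := sum_f_R0 (fun k => b k - a k) N.
have S2 N : S (N.*2.+1)%N = sum_f_R0 (fun k => b1 k - a1 k) N + sum_f_R0 (fun k => b2 k - a2 k) N.
  elim: N => [|N IH].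
    by rewrite /S /= /a /b /=; ring.
  have -> : S (N.+1.*2.+1)%N = S (N.*2.+1)%N + (b (N.+1.*2) - a (N.+1.*2)%N)
       + (b (N.+1.*2.+1) - a (N.+1.*2.+1)%N) by [].
  rewrite IH /a /b /= odd_double /= doubleK uphalf_double; lra.
have nn k : 0 <= b k - a k by have := ab k; lra.
have Sg N : S N <= S N.+1 by rewrite /S /=; have := nn N.+1; lra.
have SM N m : (N <= m)%N -> S N <= S m.
  elim: m => [|m IH]; first by rewrite leqn0 => /eqP ->; lra.
  by rewrite leq_eqVlt => /orP [/eqP -> | /IH]; [lra | have := Sg m; lra].
have Sub N : S N <= l1 + l2.
  apply: Rle_trans (SM N (N.*2.+1)%N _) _; first by rewrite -addnn; lia.
  rewrite S2; apply: Rplus_le_compat; apply: sum_incr => // k.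
    by have := ab1 k; lra.
  by have := ab2 k; lra.
have [||l lP] := growing_cv S => //; first by exists (l1 + l2) => x [N ->].
exists a, b, l; split=> //; split.
  move=> x [/cov1 [k kP] | /cov2 [k kP]].
    by exists k.*2; rewrite /a /b odd_double doubleK.
  by exists k.*2.+1; rewrite /a /b /= odd_double /= uphalf_double.
split; first exact: lP.
apply: Rle_lt_trans (_ : l1 + l2 < _); last lra.
apply: Rnot_lt_le => h; have [N HN] := lP (l - (l1 + l2)) ltac:(lra).
have := HN N (le_n N); have := Sub N; rewrite /Rdist; split_Rabs; lra.
Qed.

Lemma null_set_sub (E F : R -> Prop) : (forall x, E x -> F x) -> null_set F -> null_set E.
Proof. by move=> EF nF eps /nF; apply: small_cover_sub. Qed.

Lemma null_set_union (E F : R -> Prop) : null_set E -> null_set F -> null_set (fun x => E x \/ F x).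
Proof.
move=> nE nF eps e0; have -> : eps = eps / 2 + eps / 2 by field.
by apply: small_cover_union; [apply: nE | apply: nF]; lra.
Qed.

Lemma null_set_point p : null_set (fun x => x = p).
Proof.
move=> eps e0; apply: small_cover_sub (small_cover_interval (p - eps / 4) (p + eps / 4) eps _ _).
- by move=> x ->; lra.
- by lra.
- by lra.
Qed.

Lemma null_set_shift (E : R -> Prop) h : null_set E -> null_set (fun x => E (x + h)).
Proof. by move=> nE eps /nE; apply: small_cover_shift. Qed.

(** * Measurability under restriction, shift and union *)

Lemma leb_ext (E F : R -> Prop) : (forall x, E x <-> F x) -> leb_measurable E -> leb_measurable F.
Proof.
move=> EF mE eps /mE [G [oG [EG cG]]]; exists G; split=> //; split; first by move=> x /EF /EG.
by apply: small_cover_sub cG => x [Gx nF]; split=> // /EF.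
Qed.

Lemma leb_union (E F : R -> Prop) : leb_measurable E -> leb_measurable F ->
  leb_measurable (fun x => E x \/ F x).
Proof.
move=> mE mF eps e0.
have [|G [oG [EG cG]]] := mE (eps / 2); first lra.
have [|H [oH [FH cH]]] := mF (eps / 2); first lra.
exists (fun x => G x \/ H x); split.
  move=> x [/oG [d [d0 dP]] | /oH [d [d0 dP]]]; exists d; split=> // y yd.
    by left; apply: dP.
  by right; apply: dP.
split; first by move=> x [/EG | /FH]; [left | right].
have -> : eps = eps / 2 + eps / 2 by field.
apply: small_cover_sub (small_cover_union _ _ _ _ cG cH) => x [[Gx | Hx] nEF].
  by left; split=> // Ex; apply: nEF; left.
by right; split=> // Fx; apply: nEF; right.
Qed.

Lemma leb_shift (E : R -> Prop) h : leb_measurable E -> leb_measurable (fun x => E (x + h)).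
Proof.
move=> mE eps /mE [G [oG [EG cG]]]; exists (fun x => G (x + h)); split.
  move=> x /oG [d [d0 dP]]; exists d; split=> // y yd; apply: dP.
  by have -> : y + h - (x + h) = y - x by ring.
split; first by move=> x /EG.
exact: (small_cover_shift (fun x => G x /\ ~ E x)).
Qed.

Lemma leb_inter_open (E O : R -> Prop) : open_R O -> leb_measurable E ->
  leb_measurable (fun x => E x /\ O x).
Proof.
move=> oO mE eps /mE [G [oG [EG cG]]]; exists (fun x => G x /\ O x); split.
  move=> x [/oG [d [d0 dP]] /oO [d' [d'0 d'P]]]; exists (Rmin d d').
  split; first exact: Rmin_glb_lt.
  move=> y yd; split; [apply: dP | apply: d'P]; apply: Rlt_le_trans yd _.
    exact: Rmin_l.
  exact: Rmin_r.
split; first by move=> x [/EG].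
by apply: small_cover_sub cG => x [[Gx Ox] nE]; split=> // Ex; apply: nE.
Qed.

Lemma leb_inter_closed (E : R -> Prop) p q : leb_measurable E ->
  leb_measurable (fun x => E x /\ p <= x <= q).
Proof.
move=> mE eps e0; have [|G [oG [EG cG]]] := mE (eps / 3); first lra.
(* The closed interval is opened by [eps / 4] on both sides; the two added pieces are shorter than
   [eps / 3] and are covered separately. *)
exists (fun x => G x /\ p - eps / 4 < x < q + eps / 4); split.
  move=> x [/oG [d [d0 dP]] [x1 x2]].
  exists (Rmin d (Rmin (x - (p - eps / 4)) (q + eps / 4 - x))); split.
    by do 2 (apply: Rmin_glb_lt; try lra).
  move=> y yd; split; first by apply: dP; apply: Rlt_le_trans yd (Rmin_l _ _).
  have y1 := Rlt_le_trans _ _ _ yd (Rle_trans _ _ _ (Rmin_r _ _) (Rmin_l _ _)).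
  have y2 := Rlt_le_trans _ _ _ yd (Rle_trans _ _ _ (Rmin_r _ _) (Rmin_r _ _)).
  split_Rabs; lra.
split; first by move=> x [/EG Gx px]; split=> //; lra.
have c1 : small_cover (fun x => p - eps / 4 < x < p) (eps / 3) by apply: small_cover_interval; lra.
have c2 : small_cover (fun x => q < x < q + eps / 4) (eps / 3) by apply: small_cover_interval; lra.
have -> : eps = eps / 3 + (eps / 3 + eps / 3) by field.
apply: small_cover_sub (small_cover_union _ _ _ _ cG (small_cover_union _ _ _ _ c1 c2)).
move=> x [[Gx px] nE].
have [xp | xp] := Rlt_dec x p; first by right; left; lra.
have [xq | xq] := Rlt_dec q x; first by right; right; lra.
by left; split=> // Ex; apply: nE; split=> //; lra.
Qed.

Lemma sumN_ext m (f g : nat -> R) : (forall k, (k < m)%N -> f k = g k) -> sumN m f = sumN m g.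
Proof.
elim: m => [|m IH] H //=; rewrite H // IH // => k km; apply: H; lia.
Qed.

Lemma sumN_le m (f g : nat -> R) : (forall k, (k < m)%N -> f k <= g k) -> sumN m f <= sumN m g.
Proof.
elim: m => [|m IH] H /=; first lra.
have := H m (ltnSn m); have : sumN m f <= sumN m g by apply: IH => k km; apply: H; lia.
lra.
Qed.

Lemma sumN_scal m c (f : nat -> R) : sumN m (fun k => c * f k) = c * sumN m f.
Proof. by elim: m => [|m IH] /=; rewrite ?IH; ring. Qed.

(** * Length of a cover to the left of a point *)

Section CoverLength.
Variables (a b : nat -> R) (l : R).
Hypothesis ab : forall k, a k <= b k.
Hypothesis sl : infinite_sum (fun k => b k - a k) l.

(** The length of the part of [(a k, b k)] left of [x]; summed over [k] it measures how much of the
    cover is used up before [x]. *)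
Definition part_len x k := Rmax 0 (Rmin x (b k) - a k).
Definition cover_len x := Series (part_len x).

Lemma part_len_le x k : 0 <= part_len x k <= b k - a k.
Proof.
split; first exact: Rmax_l.
by apply: Rmax_lub; [have := ab k; lra | have := Rmin_r x (b k); lra].
Qed.

Lemma part_len_mono x y k : x <= y -> part_len x k <= part_len y k.
Proof.
move=> xy; apply: Rmax_lub; first exact: Rmax_l.
apply: Rle_trans (Rmax_r _ _); suff : Rmin x (b k) <= Rmin y (b k) by lra.
by apply: Rle_min_compat_r.
Qed.

Lemma ex_part_len x : ex_series (part_len x).
Proof.
apply: (ex_series_le _ (fun k => b k - a k)); last by exists l; apply/is_series_Reals.
move=> k; have := part_len_le x k; rewrite /norm /= /abs /= => -[h1 h2].
by rewrite Rabs_pos_eq.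
Qed.

Lemma cover_len_bound x : 0 <= cover_len x <= l.
Proof.
have el : ex_series (fun k => b k - a k) by exists l; apply/is_series_Reals.
have lE : Series (fun k => b k - a k) = l by apply: is_series_unique; apply/is_series_Reals.
split.
  have -> : 0 = Series (fun k => 0 * part_len x k) by rewrite Series_scal_l Rmult_0_l.
  apply: Series_le; last exact: ex_part_len.
  by move=> k; have := part_len_le x k; lra.
by rewrite -lE; apply: Series_le => // k; apply: part_len_le.
Qed.

Lemma cover_len_mono x y : x <= y -> cover_len x <= cover_len y.
Proof.
move=> xy; apply: Series_le; last exact: ex_part_len.
by move=> k; split; [case: (part_len_le x k) | apply: part_len_mono].
Qed.

(** Inside interval [k] the term of index [k] grows by exactly [y - x], and no other term
    decreases. *)
Lemma cover_len_step x y k : a k <= x -> x <= y -> y <= b k ->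
  cover_len x + (y - x) <= cover_len y.
Proof.
move=> ax xy yb.
suff : y - x <= cover_len y - cover_len x by lra.
rewrite /cover_len -Series_minus; [|exact: ex_part_len|exact: ex_part_len].
have pos m : 0 <= part_len y m - part_len x m by have := part_len_mono x y m xy; lra.
have -> : y - x = part_len y k - part_len x k.
  rewrite /part_len !Rmin_left; [|lra|lra].
  by rewrite !Rmax_right; lra.
have ed : ex_series (fun m => part_len y m - part_len x m).
  by apply: (ex_series_minus (V := R_NormedModule)); apply: ex_part_len.
have /is_series_Reals h := Series_correct _ ed.
apply: (Rle_trans _ (sum_f_R0 (fun m => part_len y m - part_len x m) k)).
  case: k {ax yb} => [|k] /=; first lra.
  by have := cond_pos_sum _ k pos; lra.
exact: sum_incr.
Qed.

End CoverLength.

(** * Mean value inequality for absolutely continuous functions *)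

Definition ac_real (t : R) (h : R -> R) := forall eps, 0 < eps -> exists d, 0 < d /\
  forall (m : nat) (a b : nat -> R),
    (forall k : nat, (k < m)%N -> 0 <= a k <= b k /\ b k <= t) ->
    (forall k : nat, (k.+1 < m)%N -> b k <= a k.+1) ->
    sumN m (fun k => b k - a k) < d ->
    sumN m (fun k => Rabs (h (b k) - h (a k))) < eps.

(* The supremum of the points [x] reachable from [u] is [v]: near a differentiability
   point one advances at slope at most [L + eps], and near an exceptional point one
   adds to a finite list of jump intervals, each paid for by the length of the cover. *)
Lemma ac_mean_value t h (E : R -> Prop) L u v : ac_real t h -> null_set E -> 0 <= L ->
  0 <= u -> u <= v -> v <= t ->
  (forall s, u < s < v -> ~ E s -> exists2 D, derivable_pt_lim h s D & D <= L) ->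
  h v - h u <= L * (v - u).
Proof.
move=> ac nE L0 u0 uv vt der.
have nE' : null_set (fun x => E x \/ (x = u \/ x = v)).
  by apply: null_set_union => //; apply: null_set_union; apply: null_set_point.
(* [eps] is both the excess of slope and the total variation allowed on the jump intervals. *)
suff main eps : 0 < eps -> h v - h u <= (L + eps) * (v - u) + eps.
  apply: Rnot_lt_le => H; set g := h v - h u - L * (v - u).
  have g0 : 0 < g by rewrite /g; lra.
  have q0 : 0 < g / (2 * (v - u + 1)) by apply: Rdiv_lt_0_compat; lra.
  have E1 : g / (2 * (v - u + 1)) * (v - u + 1) = g / 2 by field; lra.
  have := main _ q0; move: E1; set q := g / _ => E1 m1.
  have : g <= q * (v - u + 1) by rewrite /g; lra.
  lra.
move=> e0; have [d [d0 dP]] := ac _ e0.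
have [a [b [l [ab [cov [sl ld]]]]]] := nE' _ d0.
pose lam := cover_len a b.
have lam_mono x y : x <= y -> lam x <= lam y by exact: (cover_len_mono a b l ab sl).
pose G x := u <= x <= v /\ exists m (p q : nat -> R),
  (forall k : nat, (k < m)%N -> u <= p k <= q k /\ q k <= x) /\
  (forall k : nat, (k.+1 < m)%N -> q k <= p k.+1) /\
  sumN m (fun k => q k - p k) <= lam x /\
  h x - h u <= (L + eps) * (x - u) + sumN m (fun k => Rabs (h (q k) - h (p k))).
have Gu : G u.
  split; first lra.
  exists 0%N, (fun=> 0), (fun=> 0); split=> //; split=> //=; split; last lra.
  by case: (cover_len_bound a b l ab sl u).
have loc x : u <= x <= v -> exists2 del, 0 < del & forall x1 x2, G x1 -> x - del < x1 <= x ->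
    x <= x2 < x + del -> x2 <= v -> G x2.
  move=> xuv; have [Ex | nEx] := classic (E x \/ (x = u \/ x = v)).
    have [k kx] := cov x Ex.
    exists (Rmin (x - a k) (b k - x)); first by apply: Rmin_glb_lt; lra.
    move=> x1 x2 [x1uv [m [p [q [pq [ord [len hx1]]]]]]] x1x x2x x2v.
    have m1 := Rmin_l (x - a k) (b k - x); have m2 := Rmin_r (x - a k) (b k - x).
    split; first lra.
    exists m.+1, (fun k => if (k < m)%N then p k else x1), (fun k => if (k < m)%N then q k else x2).
    have fold (g : R -> R -> R) : sumN m.+1 (fun k => g (if (k < m)%N then q k else x2)
         (if (k < m)%N then p k else x1)) = sumN m (fun k => g (q k) (p k)) + g x2 x1.
      by rewrite /= ltnn; congr (_ + _); apply: sumN_ext => i ->.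
    split.
      move=> i im; have [lt_im | _] := ltnP i m; last lra.
      by have [? ?] := pq i lt_im; lra.
    split.
      move=> i; rewrite ltnS => im; rewrite im; have [lt_im | _] := ltnP i.+1 m; first exact: ord.
      by case: (pq i im).
    split.
      rewrite (fold (fun y z => y - z)).
      have := cover_len_step a b l ab sl x1 x2 k ltac:(lra) ltac:(lra) ltac:(lra).
      rewrite -/lam; lra.
    rewrite (fold (fun y z => Rabs (h y - h z))).
    have h1 := Rle_abs (h x2 - h x1).
    have h2 : (L + eps) * (x1 - u) <= (L + eps) * (x2 - u) by apply: Rmult_le_compat_l; lra.
    lra.
  have xin : u < x < v.
    split; [case: (xuv) => -[//|xe] _ | case: (xuv) => _ [//|xe]]; case: nEx; right.
      by left.
    by right.
  have [D hD DL] := der x xin (fun Ex => nEx (or_introl Ex)).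
  have [del delP] := hD _ e0; exists del; first exact: cond_pos.
  have up y : x <= y < x + del -> h y - h x <= (L + eps) * (y - x).
    move=> [[xy | <-] yd]; last lra.
    have := delP (y - x) ltac:(lra) ltac:(rewrite Rabs_pos_eq; lra).
    have -> : x + (y - x) = y by ring.
    move=> H; have H' : (h y - h x) / (y - x) <= L + eps by split_Rabs; lra.
    have -> : h y - h x = (h y - h x) / (y - x) * (y - x) by field; lra.
    apply: Rmult_le_compat_r; lra.
  have dn y : x - del < y <= x -> h x - h y <= (L + eps) * (x - y).
    move=> [yd [xy | ->]]; last lra.
    have := delP (y - x) ltac:(lra) ltac:(rewrite Rabs_left; lra).
    have -> : x + (y - x) = y by ring.
    move=> H; have H' : (h y - h x) / (y - x) <= L + eps by split_Rabs; lra.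
    have -> : h x - h y = (h y - h x) / (y - x) * (x - y) by field; lra.
    apply: Rmult_le_compat_r; lra.
  move=> x1 x2 [x1uv [m [p [q [pq [ord [len hx1]]]]]]] x1x x2x x2v; split; first lra.
  exists m, p, q; split; first by move=> i im; have [? ?] := pq i im; lra.
  split=> //; split; first by apply: Rle_trans len _; apply: lam_mono; lra.
  have := up x2 x2x; have := dn x1 x1x; nra.
have [||xs [xs1 xs2]] := completeness G.
- by exists v => x [[]].
- by exists u.
have xsuv : u <= xs <= v by split; [apply: xs1 | apply: xs2 => x [[]]].
have [del del0 locP] := loc xs xsuv.
have [x1 [Gx1 x1s]] : exists x1, G x1 /\ xs - del < x1.
  apply: NNPP => H; have : xs <= xs - del; last lra.
  by apply: xs2 => x Gx; apply: Rnot_lt_le => xd; apply: H; exists x.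
have x1xs := xs1 _ Gx1.
(* Stepping past the supremum, cut off at [v], shows both that the supremum is [v] and that [G v]
   holds. *)
have Gx2 : G (Rmin v (xs + del / 2)).
  apply: (locP x1 _ Gx1 (conj x1s x1xs)); last exact: Rmin_l.
  split; first by apply: Rmin_glb; lra.
  by apply: Rle_lt_trans (Rmin_r _ _) _; lra.
have xsv : v <= xs.
  have := xs1 _ Gx2; rewrite /Rmin; case: Rle_dec => //=; lra.
have Gv : G v by move: Gx2; rewrite Rmin_left //; lra.
case: Gv => _ [m [p [q [pq [ord [len hv]]]]]].
have : sumN m (fun k => Rabs (h (q k) - h (p k))) < eps; last lra.
apply: dP => //; first by move=> k km; have [? ?] := pq k km; lra.
by have := cover_len_bound a b l ab sl v; rewrite -/(lam v); lra.
Qed.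

Lemma ac_lipschitz t h (E : R -> Prop) L u v : ac_real t h -> null_set E -> 0 <= L ->
  0 <= u -> u <= v -> v <= t ->
  (forall s, u < s < v -> ~ E s -> exists2 D, derivable_pt_lim h s D & Rabs D <= L) ->
  Rabs (h v - h u) <= L * (v - u).
Proof.
move=> ac nE L0 u0 uv vt der.
have h1 : h v - h u <= L * (v - u).
  apply: (ac_mean_value t h E) => // s su nEs; have [D hD DL] := der s su nEs.
  by exists D => //; have := Rle_abs D; lra.
have h2 : - h v - - h u <= L * (v - u).
  apply: (ac_mean_value t (fun x => - h x) E) => //.
    move=> eps /ac [d [d0 dP]]; exists d; split=> // m a b H1 H2 H3.
    rewrite (sumN_ext m _ (fun k => Rabs (h (b k) - h (a k)))); first exact: dP.
    move=> k _; rewrite -Rabs_Ropp; congr Rabs; ring.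
  move=> s su nEs; have [D hD DL] := der s su nEs.
  exists (- D); first exact: derivable_pt_lim_opp.
  by have := Rle_abs (- D); rewrite Rabs_Ropp; lra.
apply: Rabs_le; lra.
Qed.

(** * Inverses of injective matrices *)

Module MatrixInverse.
Import bigop ssralg matrix mxalgebra Rstruct GRing.Theory.

Lemma sumIE n (f : 'I_n -> R) : sumI n f = (\sum_(i < n) f i)%R.
Proof. by rewrite /sumI -big_enum /=; elim: (enum _) => [|i s IH]; rewrite ?big_nil ?big_cons //= IH. Qed.

Lemma inverse_of_injective n (A : mat n) : (forall x, mv n A x = vzero n -> x = vzero n) ->
  exists B, mmul n A B = mid n /\ mmul n B A = mid n.
Proof.
move=> inj; pose M : 'M[R]_n := (\matrix_(i, j) A i j)%R.
have uM : M \in unitmx.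
  (* [inj_row_free] concerns row vectors acting from the left, hence the transpose. *)
  rewrite -unitmx_tr -row_free_unit; apply: inj_row_free => w wM.
  have : (fun j => w ord0 j) = vzero n.
    apply: inj; apply: functional_extensionality => i; rewrite /mv sumIE.
    have /(f_equal (fun N : 'rV[R]_n => N ord0 i)) := wM; rewrite !mxE => h.
    by apply: etrans h; apply: eq_bigr => j _; rewrite !mxE; exact: Rmult_comm.
  by move=> w0; apply/rowP => j; rewrite mxE; apply: (f_equal (fun g : vec n => g j) w0).
exists (fun i j => invmx M i j); split; apply: mat_ext => i j; rewrite /mmul /mid sumIE.
  have /(f_equal (fun N : 'M[R]_n => N i j)) := mulmxV uM; rewrite !mxE => h.
  transitivity (((i == j)%:R)%R : R); last by case: eqP.
  by apply: etrans h; apply: eq_bigr => k _; rewrite !mxE.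
have /(f_equal (fun N : 'M[R]_n => N i j)) := mulVmx uM; rewrite !mxE => h.
transitivity (((i == j)%:R)%R : R); last by case: eqP.
by apply: etrans h; apply: eq_bigr => k _; rewrite !mxE.
Qed.
End MatrixInverse.

(** * Caratheodory solutions *)

Section Caratheodory.
Variable n : nat.
Local Notation vec := (vec n).
Local Notation mat := (mat n).
Arguments sumI {n}. Arguments vadd {n}. Arguments vsub {n}. Arguments vscal {n}.
Arguments vzero {n}. Arguments mid {n}. Arguments frob {n}.
Arguments msub {n}. Arguments mscal {n}. Arguments mmul {n}.
Arguments mv {n}. Arguments vn {n}. Arguments mn {n}. Arguments has_mderiv {n}.

(** Serves the shifted and glued trajectories: a Lipschitz bound glues at a point by the triangle
    inequality, without cutting families of intervals. *)
Lemma lipschitz_abs_cont t (Phi : R -> mat) L :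
  (forall u v, 0 <= u -> u <= v -> v <= t -> mn (msub (Phi v) (Phi u)) <= L * (v - u)) ->
  abs_cont_on n t Phi.
Proof.
move=> lip eps e0; have L0 : 0 <= Rabs L := Rabs_pos L.
exists (eps / (Rabs L + 1)); split; first by apply: Rdiv_lt_0_compat; lra.
move=> m a b H1 _ H3.
apply: (Rle_lt_trans _ (sumN m (fun k => (Rabs L + 1) * (b k - a k)))).
  apply: sumN_le => k km; have [[a0 ab] bt] := H1 k km.
  apply: Rle_trans (frob_le_mn _ _) _; apply: Rle_trans (lip _ _ a0 ab bt) _.
  by have := Rle_abs L; nra.
rewrite sumN_scal; have -> : eps = (Rabs L + 1) * (eps / (Rabs L + 1)) by field; lra.
by apply: Rmult_lt_compat_l; lra.
Qed.

Lemma has_mderiv_local (Phi Psi : R -> mat) s D r : 0 < r ->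
  (forall y, Rabs (y - s) < r -> Phi y = Psi y) -> has_mderiv Phi s D -> has_mderiv Psi s D.
Proof.
move=> r0 PP H eps /H [d [d0 dP]]; exists (Rmin d r); split; first exact: Rmin_glb_lt.
move=> h hn hd; rewrite -!PP.
- by apply: dP => //; apply: Rlt_le_trans hd (Rmin_l _ _).
- by rewrite Rminus_diag Rabs_R0.
- have -> : s + h - s = h by ring.
  exact: Rlt_le_trans hd (Rmin_r _ _).
Qed.

Lemma has_mderiv_shift (Phi : R -> mat) s c D :
  has_mderiv Phi (s + c) D -> has_mderiv (fun x => Phi (x + c)) s D.
Proof.
move=> H eps /H [d [d0 dP]]; exists d; split=> // h hn hd.
have -> : s + h + c = s + c + h by ring.
exact: dP.
Qed.

Lemma mn_eps_frob (B : mat) eps : 0 < eps -> exists2 eps', 0 < eps' &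
  forall A, frob A < eps' -> frob (mmul A B) < eps.
Proof.
move=> e0; set c := INR n * INR n * mn B + 1.
have c0 : 0 < c by rewrite /c; have h1 := pos_INR n; have h2 := mn_ge0 n B; nra.
exists (eps / c); first exact: Rdiv_lt_0_compat.
move=> A Ae; apply: Rle_lt_trans (frob_le_mn _ _) _; apply: Rle_lt_trans (mn_mmul _ _ _) _.
have h1 := mn_le_frob n A; have h2 := mn_ge0 n B; have h3 := frob_ge0 n A.
apply: (Rle_lt_trans _ (INR n * (INR n * frob A) * mn B)); first exact: Rmult_le_compat_r.
have -> : INR n * (INR n * frob A) * mn B = (c - 1) * frob A by rewrite /c; ring.
have -> : eps = c * (eps / c) by field; lra.
nra.
Qed.

Lemma has_mderiv_mulr (Phi : R -> mat) s D B :
  has_mderiv Phi s D -> has_mderiv (fun x => mmul (Phi x) B) s (mmul D B).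
Proof.
move=> H eps /(mn_eps_frob B) [eps' e0 eP]; have [d [d0 dP]] := H _ e0.
exists d; split=> // h hn hd.
have -> : msub (mscal (/ h) (msub (mmul (Phi (s + h)) B) (mmul (Phi s) B))) (mmul D B)
    = mmul (msub (mscal (/ h) (msub (Phi (s + h)) (Phi s))) D) B.
  rewrite mmul_msubl -mmul_msubl; congr msub; apply: mat_ext => i j.
  by rewrite /mscal /mmul -sumI_scal; apply: sumI_ext => k; ring.
by apply: eP; apply: dP.
Qed.

Lemma has_mderiv_mv (Phi : R -> mat) s D x i :
  has_mderiv Phi s D -> derivable_pt_lim (fun r => mv (Phi r) x i) s (mv D x i).
Proof.
move=> H eps e0; have x0 := vn_ge0 n x; have n0 := pos_INR n.
set c := INR n * INR n * vn x + 1.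
have c0 : 0 < c by rewrite /c; nra.
have [|d [d0 dP]] := H (eps / c); first exact: Rdiv_lt_0_compat.
exists (mkposreal d d0) => h hn hd.
have := dP h hn hd; set A := msub _ D => Ae.
have -> : (mv (Phi (s + h)) x i - mv (Phi s) x i) / h - mv D x i = mv A x i.
  rewrite /A mv_msub /vsub; congr (_ - _).
  rewrite /mv -sumI_sub /Rdiv -sumI_scalr; apply: sumI_ext => j.
  by rewrite /mscal /msub; ring.
apply: Rle_lt_trans (coord_le_vn _ _ _) _; apply: Rle_lt_trans (vn_mv _ _ _) _.
have h1 := mn_le_frob n A; have h3 := frob_ge0 n A.
apply: (Rle_lt_trans _ (INR n * (INR n * frob A) * vn x)); first exact: Rmult_le_compat_r.
have -> : INR n * (INR n * frob A) * vn x = (c - 1) * frob A by rewrite /c; ring.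
have -> : eps = c * (eps / c) by field; lra.
nra.
Qed.

(** * Growth of solutions in both time directions *)

Section Solution.
Variables (t C : R) (sigma Phi : R -> mat).
Hypothesis C0 : 0 <= C.
Hypothesis sigC : forall s, 0 <= s <= t -> mn (sigma s) <= C.
Hypothesis sol : cara_solution n t sigma Phi.

Let y x s := mv (Phi s) x.

Lemma sol_ac x i : ac_real t (fun s => y x s i).
Proof.
case: sol => _ [ac _] eps e0; have x0 := vn_ge0 n x; have n0 := pos_INR n.
set c := INR n * INR n * vn x + 1.
have c0 : 0 < c by rewrite /c; nra.
have [|d [d0 dP]] := ac (eps / c); first exact: Rdiv_lt_0_compat.
exists d; split=> // m a b H1 H2 H3; have h := dP m a b H1 H2 H3.
apply: (Rle_lt_trans _ (sumN m (fun k => c * frob (msub (Phi (b k)) (Phi (a k)))))).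
  apply: sumN_le => k km; set A := msub _ _.
  have -> : y x (b k) i - y x (a k) i = mv A x i by rewrite /A mv_msub.
  apply: Rle_trans (coord_le_vn _ _ _) _; apply: Rle_trans (vn_mv _ _ _) _.
  have h1 := mn_le_frob n A; have h3 := frob_ge0 n A.
  apply: (Rle_trans _ (INR n * (INR n * frob A) * vn x)); first exact: Rmult_le_compat_r.
  by rewrite /c; nra.
rewrite sumN_scal; have -> : eps = c * (eps / c) by field; lra.
exact: Rmult_lt_compat_l.
Qed.

Lemma sol_lipschitz x M u v i : 0 <= M -> 0 <= u -> u <= v -> v <= t ->
  (forall s, u <= s <= v -> vn (y x s) <= M) -> Rabs (y x v i - y x u i) <= C * M * (v - u).
Proof.
move=> M0 u0 uv vt yM; case: (sol) => _ [_ nE].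
apply: (ac_lipschitz t (fun s => y x s i) _ _ _ _ (sol_ac x i) nE) => //; first nra.
move=> s su nEs.
have hd : has_mderiv Phi s (mmul (sigma s) (Phi s)).
  by apply: NNPP => nd; apply: nEs; split=> //; lra.
exists (mv (mmul (sigma s) (Phi s)) x i); first exact: has_mderiv_mv.
rewrite mv_mmul; apply: Rle_trans (coord_le_vn _ _ _) _; apply: Rle_trans (vn_mv _ _ _) _.
apply: Rmult_le_compat; [exact: mn_ge0 | exact: vn_ge0 | apply: sigC; lra | apply: yM; lra].
Qed.

(** Absolute continuity with [eps = 1] bounds the change over intervals shorter than [d], and
    finitely many steps of length [d / 2] reach all of [[0, t]]. This finiteness is required before
    the doubling argument can take a supremum. *)
Lemma sol_bounded x : exists M, forall s, 0 <= s <= t -> vn (y x s) <= M.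
Proof.
case: (sol) => _ [ac _]; have [|d [d0 dP]] := ac 1; first lra.
have x0 := vn_ge0 n x.
have step r s : 0 <= r -> r <= s -> s <= t -> s - r < d -> vn (y x s) <= INR n * INR n * vn x + vn (y x r).
  move=> r0 rs st sr.
  have := dP 1%N (fun=> r) (fun=> s); rewrite /= !Rplus_0_l => h.
  have fr : frob (msub (Phi s) (Phi r)) < 1 by apply: h => // k _; lra.
  apply: Rle_trans (vn_cont _ _ (y x r)) _; apply: Rplus_le_compat_r.
  rewrite -mv_msub; apply: Rle_trans (vn_mv _ _ _) _; apply: Rmult_le_compat_r => //.
  apply: Rle_trans (mn_le_frob _ _) _; have := pos_INR n; have := frob_ge0 n (msub (Phi s) (Phi r)).
  move=> f0 n0; rewrite -Rmult_assoc; have : 0 <= INR n * INR n by nra.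
  nra.
have all k s : 0 <= s <= t -> s <= INR k * (d / 2) ->
    vn (y x s) <= INR k * (INR n * INR n * vn x) + vn (y x 0).
  have c0 : 0 <= INR n * INR n * vn x.
    by apply: Rmult_le_pos => //; have := pos_INR n; nra.
  elim: k s => [|k IH] s st sk.
    have -> : s = 0 by move: sk; rewrite /=; lra.
    rewrite /=; lra.
  rewrite S_INR in sk *.
  pose r := Rmax 0 (s - d / 2).
  have r1 : r <= s by apply: Rmax_lub; lra.
  have r2 : s - r < d by have := Rmax_r 0 (s - d / 2); rewrite -/r; lra.
  have r3 : 0 <= r := Rmax_l _ _.
  have := step r s r3 r1 st.2 r2.
  have : vn (y x r) <= INR k * (INR n * INR n * vn x) + vn (y x 0).
    apply: IH; first lra.
    apply: Rmax_lub; last lra.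
    by apply: Rmult_le_pos; [exact: pos_INR | lra].
  lra.
have [k kP] := INR_unbounded (t / (d / 2)).
exists (INR k * (INR n * INR n * vn x) + vn (y x 0)) => s st; apply: all => //.
have : t = t / (d / 2) * (d / 2) by field; lra.
nra.
Qed.

(** The time scale on which [n * C * step <= 1 / 2], so that a solution of size at most [M] moves by
    at most [M / 2]. *)
Let step := / (2 * (INR n * C) + 1).

Lemma step_pos : 0 < step.
Proof. by apply: Rinv_0_lt_compat; have := pos_INR n; nra. Qed.

(** Takes the place of Gronwall: if [M] is the supremum of [|y|] on [[u, v]], every value is at most
    [|y w| + M / 2], so [M <= 2 |y w|]. As [w] may lie on either side of [s], the estimate also runs
    backwards. *)
Lemma sol_double x u v w s : 0 <= u -> v <= t -> v - u <= step -> u <= w <= v -> u <= s <= v ->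
  vn (y x s) <= 2 * vn (y x w).
Proof.
move=> u0 vt vu wuv suv; have [M0 M0P] := sol_bounded x.
have [||M [M1 M2]] := completeness (fun r => exists2 s, u <= s <= v & r = vn (y x s)).
- by exists M0 => r [s' s'uv ->]; apply: M0P; lra.
- by exists (vn (y x s)), s.
have yM s' : u <= s' <= v -> vn (y x s') <= M by move=> s'uv; apply: M1; exists s'.
have Mp : 0 <= M by apply: Rle_trans (vn_ge0 n (y x s)) (yM s suv).
have diff s1 s2 : u <= s1 -> s1 <= s2 -> s2 <= v -> vn (vsub (y x s2) (y x s1)) <= M / 2.
  move=> us1 s12 s2v.
  apply: (Rle_trans _ (INR n * (C * M * (s2 - s1)))).
    rewrite -sumI_const; apply: sumI_le => i; apply: sol_lipschitz => //; try lra.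
    by move=> r rs; apply: yM; lra.
  have nC : 0 <= INR n * C by have := pos_INR n; nra.
  have st : (s2 - s1) * (2 * (INR n * C) + 1) <= 1.
    have E1 : step * (2 * (INR n * C) + 1) = 1 by rewrite /step; field; lra.
    by apply: (Rle_trans _ _ _ _ (Req_le _ _ E1)); apply: Rmult_le_compat_r; lra.
  have -> : INR n * (C * M * (s2 - s1)) = (INR n * C * (s2 - s1)) * M by ring.
  have : INR n * C * (s2 - s1) <= 1 / 2 by lra.
  nra.
have half s' : u <= s' <= v -> vn (y x s') <= vn (y x w) + M / 2.
  move=> s'uv; apply: Rle_trans (vn_cont _ _ (y x w)) _.
  have [sw | sw] := Rle_dec s' w.
    by rewrite vn_sub_sym; have := diff s' w; lra.
  by have := diff w s'; lra.
have : M <= vn (y x w) + M / 2 by apply: M2 => r [s' s'uv ->]; apply: half.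
have := yM s suv; lra.
Qed.

Lemma sol_compare x k w s : 0 <= w <= t -> 0 <= s <= t -> Rabs (s - w) <= INR k * step ->
  vn (y x s) <= 2 ^ k * vn (y x w).
Proof.
have sp := step_pos; elim: k s => [|k IH] s wt st.
  rewrite /= Rmult_0_l => h; have -> : s = w by split_Rabs; lra.
  lra.
rewrite S_INR => sw; have k0 := pos_INR k.
(* The point at fraction [k / (k + 1)] of the way from [w] to [s] leaves a last leg of length at
   most [step]. *)
pose r := w + (s - w) * (INR k / (INR k + 1)).
have q1 : INR k / (INR k + 1) = 1 - / (INR k + 1) by field; lra.
have i0 : 0 < / (INR k + 1) by apply: Rinv_0_lt_compat; lra.
have i1 : / (INR k + 1) * (INR k + 1) = 1 by field; lra.
have q0 : 0 <= INR k / (INR k + 1) by apply: Rmult_le_pos; lra.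
have qle : INR k / (INR k + 1) <= 1 by lra.
have rw : r - w = (s - w) * (INR k / (INR k + 1)) by rewrite /r; ring.
have sr : s - r = (s - w) * / (INR k + 1) by rewrite /r q1; ring.
have rt : 0 <= r <= t.
  have rE : r = (1 - INR k / (INR k + 1)) * w + INR k / (INR k + 1) * s by rewrite /r; ring.
  rewrite rE; split; nra.
have h1 : vn (y x r) <= 2 ^ k * vn (y x w).
  apply: IH => //; rewrite rw Rabs_mult (Rabs_pos_eq (_ / _)) //.
  have -> : INR k * step = (INR k + 1) * step * (INR k / (INR k + 1)) by field; lra.
  exact: Rmult_le_compat_r.
have h2 : vn (y x s) <= 2 * vn (y x r).
  have sr' : Rabs (s - r) <= step.
    rewrite sr Rabs_mult (Rabs_pos_eq (/ _)); last lra.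
    have -> : step = (INR k + 1) * step * / (INR k + 1) by field; lra.
    by apply: Rmult_le_compat_r => //; lra.
  have [rs | rs] := Rle_dec r s.
    by apply: (sol_double x r s); try lra; rewrite Rabs_pos_eq in sr'; lra.
  by apply: (sol_double x s r); try lra; rewrite Rabs_left in sr'; lra.
rewrite /=; lra.
Qed.

Lemma sol_mn_bound k s : t <= INR k * step -> 0 <= s <= t -> mn (Phi s) <= INR n * (INR n * 2 ^ k).
Proof.
move=> tk st; apply: mn_le_entries => i j.
pose d : vec := fun l => if j == l then 1 else 0.
have d1 : vn d = 1.
  rewrite /vn -[RHS](sumI_delta n (fun=> 1) j); apply: sumI_ext => l.
  by rewrite /d; case: (j == l); rewrite ?Rabs_R1 ?Rabs_R0; ring.
have -> : Phi s i j = y d s i.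
  rewrite /y /mv -[LHS](sumI_delta n (fun j => Phi s i j) j); apply: sumI_ext => l.
  by rewrite /d; ring.
apply: Rle_trans (coord_le_vn _ _ _) _.
have := sol_compare d k 0 s ltac:(lra) st.
rewrite {2}/y (proj1 sol) mv_mid d1 Rmult_1_r; apply.
rewrite Rminus_0_r Rabs_pos_eq; lra.
Qed.

Lemma sol_mn_lipschitz : exists L, forall u v, 0 <= u -> u <= v -> v <= t ->
  mn (msub (Phi v) (Phi u)) <= L * (v - u).
Proof.
have [k kP] := INR_unbounded (t / step).
have tk : t <= INR k * step.
  have -> : t = t / step * step by field; have := step_pos; lra.
  by have := step_pos; nra.
pose B := INR n * (INR n * 2 ^ k).
exists (INR n * (INR n * (C * B))) => u v u0 uv vt.
have -> : INR n * (INR n * (C * B)) * (v - u) = INR n * (INR n * (C * B * (v - u))) by ring.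
apply: mn_le_entries => i j.
pose d : vec := fun l => if j == l then 1 else 0.
have d1 : vn d = 1.
  rewrite /vn -[RHS](sumI_delta n (fun=> 1) j); apply: sumI_ext => l.
  by rewrite /d; case: (j == l); rewrite ?Rabs_R1 ?Rabs_R0; ring.
have yE s : Phi s i j = y d s i.
  rewrite /y /mv -[LHS](sumI_delta n (fun j => Phi s i j) j); apply: sumI_ext => l.
  by rewrite /d; ring.
rewrite /msub !yE; apply: sol_lipschitz => //.
  have n0 := pos_INR n; have : 0 < 2 ^ k by apply: pow_lt; lra.
  by move=> p0; rewrite /B; apply: Rmult_le_pos => //; nra.
move=> s suv; apply: Rle_trans (vn_mv _ _ _) _; rewrite d1 Rmult_1_r.
by apply: sol_mn_bound => //; lra.
Qed.

(** The comparison run backwards bounds [|x| = |y 0|] by [2 ^ k * |y s| = 0]. *)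
Lemma sol_injective s : 0 <= s <= t -> forall x, mv (Phi s) x = vzero -> x = vzero.
Proof.
move=> st x xs; apply: vn_eq0; have x0 := vn_ge0 n x.
have [k kP] := INR_unbounded (s / step).
have := sol_compare x k s 0 st ltac:(lra).
rewrite {1}/y (proj1 sol) mv_mid /y xs.
have -> : vn (vzero : vec) = 0.
  by rewrite -[RHS](sumI_0 n); apply: sumI_ext => i; rewrite /vzero Rabs_R0.
rewrite Rmult_0_r => h; suff : vn x <= 0 by lra.
apply: h; rewrite Rminus_0_l Rabs_Ropp Rabs_pos_eq; last lra.
have -> : s = s / step * step by field; have := step_pos; lra.
by have := step_pos; nra.
Qed.

End Solution.

(** * Restricting, shifting and joining controls *)

Lemma measurable_restrict s t (sigma : R -> mat) : s <= t ->
  measurable_on n t sigma -> measurable_on n s sigma.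
Proof.
move=> st H U oU; apply: leb_ext (leb_inter_closed _ 0 s (H U oU)) => x.
by split=> [[[x0 Ux] xs] | [x0 Ux]] //; split=> //; split=> //; lra.
Qed.

Lemma measurable_shift s t (sigma : R -> mat) : 0 <= t ->
  measurable_on n (s + t) sigma -> measurable_on n s (fun x => sigma (x + t)).
Proof.
move=> t0 H U oU.
apply: leb_ext (leb_shift _ t (leb_inter_closed _ t (s + t) (H U oU))) => x.
by split=> [[[x0 Ux] xs] | [x0 Ux]]; split=> //; try split=> //; lra.
Qed.

Lemma measurable_concat s t (sig1 sig2 : R -> mat) : 0 <= s -> 0 <= t ->
  measurable_on n s sig1 -> measurable_on n t sig2 ->
  measurable_on n (s + t) (fun x => if Rle_dec x t then sig2 x else sig1 (x - t)).
Proof.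
move=> s0 t0 H1 H2 U oU.
(* The part from [sig1] is cut to positive times, so that [x = t] is governed by [sig2]. *)
have oO : open_R (fun x => 0 < x).
  by move=> x x0; exists x; split=> // z; split_Rabs; lra.
apply: leb_ext (leb_union _ _ (H2 U oU) (leb_shift _ (- t) (leb_inter_open _ _ oO (H1 U oU)))) => x.
rewrite -/(x - t); destruct (Rle_dec x t) as [xt | xt]; simpl; split.
- by move=> [[xx Ux] | [[xx Ux] xp]]; [split=> //; lra | exfalso; lra].
- by move=> [xx Ux]; left; split=> //; lra.
- by move=> [[xx Ux] | [[xx Ux] xp]]; [exfalso; lra | split=> //; lra].
- by move=> [xx Ux]; right; split; [split=> //|]; lra.
Qed.

Variables (M : mat -> Prop) (C : R).
Hypotheses (C0 : 0 <= C) (MC : forall A, M A -> mn A <= C).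

(** With [B] the inverse of [Phi t], the function [Phi (x + t) B] starts at the identity and solves
    the equation for the shifted control, since right multiplication by a constant preserves it. *)
Lemma S_cont_split s t P : 0 <= s -> 0 <= t -> S_cont n M (s + t) P ->
  exists Q U, S_cont n M s Q /\ S_cont n M t U /\ P = mmul Q U.
Proof.
move=> s0 t0 [sigma [Phi [ms [Ms [sol ->]]]]].
have sigC r : 0 <= r <= s + t -> mn (sigma r) <= C by move=> /Ms /MC.
have inj := sol_injective _ _ _ _ C0 sigC sol t ltac:(lra).
have [B [PB BP]] := MatrixInverse.inverse_of_injective n _ inj.
have [L lip] := sol_mn_lipschitz _ _ _ _ C0 sigC sol.
have [P0 [ac nE]] := sol.
exists (mmul (Phi (s + t)) B), (Phi t); split; last split.
- exists (fun x => sigma (x + t)), (fun x => mmul (Phi (x + t)) B); split.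
    exact: measurable_shift.
  split; first by move=> r rs; apply: Ms; lra.
  split=> //; split; first by rewrite /= Rplus_0_l.
  split.
    apply: (lipschitz_abs_cont s _ (L * mn B)) => u v u0 uv vs.
    rewrite -mmul_msubl; apply: Rle_trans (mn_mmul _ _ _) _.
    have := lip (u + t) (v + t) ltac:(lra) ltac:(lra) ltac:(lra).
    have -> : v + t - (u + t) = v - u by ring.
    have := mn_ge0 n B; nra.
  apply: null_set_sub (null_set_shift _ t nE) => r [rs nd]; split; first lra.
  move=> hd; apply: nd; rewrite mmulA.
  exact: (has_mderiv_mulr (fun x => Phi (x + t)) _ _ B (has_mderiv_shift _ _ _ _ hd)).
- exists sigma, Phi; split; first by apply: measurable_restrict ms; lra.
  split; first by move=> r rt; apply: Ms; lra.
  split=> //; split=> //; split.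
    move=> eps /ac [d [d0 dP]]; exists d; split=> // m a b H1 H2 H3; apply: dP => // k km.
    by have := H1 k km; lra.
  by apply: null_set_sub nE => r [rt nd]; split=> //; lra.
- by rewrite -mmulA BP mmulm1.
Qed.

Lemma S_cont_mul s t Q U : 0 <= s -> 0 <= t -> S_cont n M s Q -> S_cont n M t U ->
  S_cont n M (s + t) (mmul Q U).
Proof.
move=> s0 t0 [sig1 [Phi1 [ms1 [Ms1 [sol1 ->]]]]] [sig2 [Phi2 [ms2 [Ms2 [sol2 ->]]]]].
have sigC1 r : 0 <= r <= s -> mn (sig1 r) <= C by move=> /Ms1 /MC.
have sigC2 r : 0 <= r <= t -> mn (sig2 r) <= C by move=> /Ms2 /MC.
have [L1 lip1] := sol_mn_lipschitz _ _ _ _ C0 sigC1 sol1.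
have [L2 lip2] := sol_mn_lipschitz _ _ _ _ C0 sigC2 sol2.
have [P10 [_ nE1]] := sol1; have [P20 [_ nE2]] := sol2.
pose sg x := if Rle_dec x t then sig2 x else sig1 (x - t).
pose Phi x := if Rle_dec x t then Phi2 x else mmul (Phi1 (x - t)) (Phi2 t).
have PhiL x : x <= t -> Phi x = Phi2 x by rewrite /Phi => xt; destruct (Rle_dec x t).
have PhiR x : t <= x -> Phi x = mmul (Phi1 (x - t)) (Phi2 t).
  rewrite /Phi => xt; destruct (Rle_dec x t) as [xt' | xt'] => //=.
  by have -> : x = t; [lra | rewrite Rminus_diag P10 mmul1m].
have sgL x : x <= t -> sg x = sig2 x by rewrite /sg => xt; destruct (Rle_dec x t).
have sgR x : t < x -> sg x = sig1 (x - t).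
  by rewrite /sg => xt; destruct (Rle_dec x t) as [xt' | xt'] => //=; exfalso; lra.
exists sg, Phi; split; first exact: measurable_concat.
split.
  move=> r rst; have [rt | rt] := Rle_dec r t; first by rewrite sgL //; apply: Ms2; lra.
  by rewrite sgR; [apply: Ms1|]; lra.
split; last first.
  by rewrite PhiR; [have -> : s + t - t = s by ring | lra].
split; first by rewrite PhiL.
split.
  set L := Rmax 0 (Rmax (L1 * mn (Phi2 t)) L2).
  have La : L1 * mn (Phi2 t) <= L := Rle_trans _ _ _ (Rmax_l _ _) (Rmax_r _ _).
  have Lb : L2 <= L := Rle_trans _ _ _ (Rmax_r _ _) (Rmax_r _ _).
  have lipL u v : 0 <= u -> u <= v -> v <= t -> mn (msub (Phi v) (Phi u)) <= L * (v - u).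
    by move=> u0 uv vt; rewrite !PhiL; [have := lip2 u v u0 uv vt; nra | lra | lra].
  have lipR u v : t <= u -> u <= v -> v <= s + t -> mn (msub (Phi v) (Phi u)) <= L * (v - u).
    move=> tu uv vst; rewrite !PhiR; [|lra|lra].
    rewrite -mmul_msubl; apply: Rle_trans (mn_mmul _ _ _) _.
    have := lip1 (u - t) (v - t) ltac:(lra) ltac:(lra) ltac:(lra).
    have -> : v - t - (u - t) = v - u by ring.
    have := mn_ge0 n (Phi2 t); nra.
  apply: (lipschitz_abs_cont _ _ L) => u v u0 uv vst.
  have [vt | vt] := Rle_dec v t; first exact: lipL.
  have [tu | tu] := Rle_dec t u; first exact: lipR.
  apply: Rle_trans (mn_sub_triangle _ _ (Phi t) _) _.
  have h1 := lipL u t ltac:(lra) ltac:(lra) ltac:(lra).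
  have h2 := lipR t v ltac:(lra) ltac:(lra) ltac:(lra).
  lra.
(* The junction [t] is exceptional too, since the one-sided derivatives may differ there. *)
have nN := null_set_union _ _ nE2 (null_set_union _ _ (null_set_shift _ (- t) nE1) (null_set_point t)).
apply: null_set_sub nN => r [rst nd].
have [rt | [-> | rt]] := Rtotal_order r t.
- left; split; first lra.
  move=> hd; apply: nd; rewrite sgL ?PhiL; [|lra|lra].
  apply: (has_mderiv_local Phi2 Phi r _ (t - r)) => //; first lra.
  by move=> z zr; rewrite PhiL //; split_Rabs; lra.
- by right; right.
- right; left; split; first lra.
  move=> hd; apply: nd; rewrite sgR ?PhiR; [|lra|lra].
  apply: (has_mderiv_local (fun x => mmul (Phi1 (x + - t)) (Phi2 t)) Phi r _ (r - t)); first lra.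
    by move=> z zr; rewrite PhiR //; split_Rabs; lra.
  rewrite mmulA.
  exact: (has_mderiv_mulr (fun x => Phi1 (x + - t)) _ _ (Phi2 t) (has_mderiv_shift _ _ _ _ hd)).
Qed.

(** The number [k] of doubling steps depends on [T] only, which makes the bound uniform in the
    control and in [t]. *)
Lemma S_cont_bound T : exists L, forall t P, 0 <= t <= T -> S_cont n M t P -> mn P <= L.
Proof.
set h := / (2 * (INR n * C) + 1).
have h0 : 0 < h by apply: Rinv_0_lt_compat; have := pos_INR n; nra.
have [k kP] := INR_unbounded (T / h).
exists (INR n * (INR n * 2 ^ k)) => t P tT [sigma [Phi [_ [Ms [sol ->]]]]].
apply: (sol_mn_bound t C sigma Phi C0 _ sol); last lra; first by move=> r /Ms /MC.
rewrite -/h; have : T = T / h * h by field; lra.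
nra.
Qed.

End Caratheodory.

Lemma family_cont n (M : mat n -> Prop) (time : R -> Prop) (Sg : R -> mat n -> Prop) :
  compact_mat n M -> (forall t, time t <-> 0 <= t) ->
  (forall t P, 0 <= t -> (Sg t P <-> S_cont n M t P)) -> family_axioms n time Sg.
Proof.
move=> [_ [c cP]] tE SE; pose C := INR n * (INR n * Rmax 0 c).
have C0 : 0 <= C.
  by apply: Rmult_le_pos; [exact: pos_INR | apply: Rmult_le_pos; [exact: pos_INR | exact: Rmax_l]].
have MC A : M A -> mn n A <= C.
  move=> MA; apply: mn_le_entries => i j; apply: Rle_trans (entry_le_frob _ _ _ _) _.
  by apply: Rle_trans (cP _ MA) (Rmax_r _ _).
split.
- by apply/tE; lra.
- by move=> t /tE.
- by move=> s t /tE s0 /tE t0; apply/tE; lra.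
- by move=> s t /tE s0 /tE t0 st; apply/tE; lra.
- move=> s t P /tE s0 /tE t0 /SE SP.
  have [|Q [U [SQ [SU ->]]]] := S_cont_split n M C C0 MC s t P s0 t0 (SP _); first lra.
  by exists Q, U; split; [apply/SE | split=> //; apply/SE].
- move=> s t Q U eps /tE s0 /tE t0 /(SE _ _ s0) SQ /(SE _ _ t0) SU e0; exists 0, (mmul n Q U).
  split; first by apply/tE; lra.
  split; first lra; split; last by rewrite mn_sub_self.
  by rewrite Rplus_0_r; apply/SE; [lra | apply: (S_cont_mul n M C)].
- move=> T; have [L LP] := S_cont_bound n M C C0 MC T.
  by exists L => t P /tE t0 tT /(SE _ _ t0) SP; apply: (LP t).
Qed.

Theorem mainTheorem7 (n : nat) (K : vec n -> Prop) (time : R -> Prop)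
    (Sg : R -> mat n -> Prop) :
  proper_cone n K ->
  gen_semigroup n time Sg ->
  (forall t P, time t -> Sg t P -> in_piK n K P) ->
  K_irreducible_sg n K time Sg ->
  exists rho, is_jsr n time Sg rho /\
    (exists v, is_norm n v /\ monotone n K v /\ extremal n time Sg rho v) /\
    (simplicial n K ->
       exists v, is_norm n v /\ monotone n K v /\ extremal n time Sg rho v /\
                 absolute n K v).
Proof.
move=> HK gen pos irr.
have fam : family_axioms n time Sg.
  case: gen => [[M [cM [tE SE]]] | [[M [cM [tE SE]]] | [M [cM [pM [tE [SE Sb]]]]]]].
  - exact: family_disc cM tE SE.
  - exact: family_cont cM tE SE.
  - exact: family_jump pM _ _ cM tE SE Sb.
have [rho [jsr [v [nv [mv [ev av]]]]]] := family_extremal_norm n K time Sg HK fam pos irr.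
by exists rho; split=> //; split; [exists v | move=> _; exists v].
Qed.
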